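(* For every integer $\Delta \ge 2$ and every $\beta \in \mathbb{R}$ there exists $H = H(\Delta,\beta)>0$ such that the following holds. Let $G$ be any graph of maximum degree $\Delta$ on $n$ vertices, and let the external fields $(h_x)_{x\in V(G)}$ be independent $\mathcal{N}(0,H)$ random variables. Then, with probability $1-o(1)$ (as $n\to\infty$) over the choice of the random fields, there exist an FPTAS for $Z_{G,\beta,h}$ and a polynomial-time sampling scheme for $p_{G,\beta,h}$.
   Context: For a finite graph $G=(V,E)$, $h\colon V\to\mathbb{R}$ and $\beta\in\mathbb{R}$, the Ising model is the probability distribution on $\{\pm1\}^V$ given by $p_{G,\beta,h}(\sigma)=e^{-H_{\beta,h}(\sigma)}/Z_{G,\beta,h}$, where $-H_{\beta,h}(\sigma)=\beta\sum_{xy\in E}\sigma_x\sigma_y+\sum_{x\in V}h_x\sigma_x$ and $Z_{G,\beta,h}=\sum_{\sigma\in\{\pm1\}^V}e^{-H_{\beta,h}(\sigma)}$ is the partition function. A fully polynomial-time approximation scheme (FPTAS) for $Z$ is a deterministic algorithm that, given the instance and a tolerance $\epsilon>0$, outputs $\hat Z$ with $e^{-\epsilon}\hat Z\le Z\le e^{\epsilon}\hat Z$, in time polynomial in $1/\epsilon$ and $|V(G)|$. A polynomial-time sampling scheme for a distribution $\mu$ is a randomized algorithm that, given the instance and $\epsilon>0$, outputs a sample from a distribution $\hat\mu$ with $\|\hat\mu-\mu\|_{TV}\le\epsilon$, in time polynomial in $1/\epsilon$ and $|V(G)|$. *)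

(* Defs.v *)
From HB Require Import structures.
From mathcomp Require Import all_boot all_order all_algebra.
From mathcomp Require Import all_classical all_reals all_analysis.
Set Implicit Arguments.
Unset Strict Implicit.
Unset Printing Implicit Defensive.
Import Order.TTheory GRing.Theory Num.Theory.
Import numFieldNormedType.Exports.
Local Open Scope classical_set_scope.
Local Open Scope ring_scope.

Record sgraph (n : nat) := SGraph {
  adj :> rel 'I_n;
  adj_sym : symmetric adj;
  adj_irrefl : irreflexive adj }.

Definition max_degree n (G : sgraph n) : nat :=
  (\max_(x < n) #|[pred y | adj G x y]|)%N.

Section Ising.
Variables (R : realType) (n : nat) (G : sgraph n) (beta : R) (h : 'I_n -> R).

Definition config := {ffun 'I_n -> bool}.

Definition spin (b : bool) : R := if b then 1 else -1.

(* The condition x < y makes every edge {x, y} count once. *)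
Definition hamiltonian (sigma : config) : R :=
  - (beta * (\sum_(x < n) \sum_(y < n | (x < y)%N && adj G x y)
               spin (sigma x) * spin (sigma y))
     + \sum_(x < n) h x * spin (sigma x)).

Definition partition_function : R :=
  \sum_(sigma : config) expR (- hamiltonian sigma).

Definition ising (sigma : config) : R :=
  expR (- hamiltonian sigma) / partition_function.

End Ising.

Definition tv_dist (R : realType) (T : finType) (mu nu : T -> R) : R :=
  2^-1 * \sum_(t : T) `|mu t - nu t|.

(* Model of computation: a real RAM (Blum-Shub-Smale style).  Programs are
   while programs over two unbounded, indirectly addressed memories, one of
   natural numbers and one of real numbers, each organised as a family of arrays
   named by numerals.  Exact real arithmetic and comparisons have unit cost;
   there is no rounding, no floor (hence no conversion from reals to naturals),
   no transcendental operation, and no real constant besides the integers.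
   Naturals have no multiplication, so that t steps only produce naturals
   with O(t) bits.  The input is read-only. *)

Record input (R : Type) := Input {
  in_size : nat;
  in_adj : nat -> nat -> bool;
  in_beta : R;
  in_field : nat -> R;
  in_eps : R }.

Inductive nexp : Type :=
| NConst of nat
| NSize
| NGet of nat & nexp
| NAdd of nexp & nexp
| NSub of nexp & nexp.

Inductive rexp : Type :=
| ROfNat of nexp
| RBeta
| RField of nexp
| REps
| RGet of nat & nexp
| RAdd of rexp & rexp
| RSub of rexp & rexp
| RMul of rexp & rexp
| RDiv of rexp & rexp.

Inductive bexp : Type :=
| BLtN of nexp & nexp
| BLtR of rexp & rexp
| BAdj of nexp & nexp
| BNot of bexp
| BAnd of bexp & bexp.

(* [CSetN a i e] is a[i] := e in the memory of naturals, [CSetR a i e] the same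
   in the memory of reals, and [CCoin a i] stores a fair random bit in a[i]. *)
Inductive cmd : Type :=
| CSkip
| CSetN of nat & nexp & nexp
| CSetR of nat & nexp & rexp
| CCoin of nat & nexp
| CSeq of cmd & cmd
| CIf of bexp & cmd & cmd
| CWhile of bexp & cmd.

Fixpoint coin_free (c : cmd) : bool :=
  match c with
  | CSkip | CSetN _ _ _ | CSetR _ _ _ => true
  | CCoin _ _ => false
  | CSeq c1 c2 | CIf _ c1 c2 => coin_free c1 && coin_free c2
  | CWhile _ c1 => coin_free c1
  end.

Section Semantics.
Variables (R : realType) (I : input R).

Record state := State {
  nmem : nat -> nat -> nat;
  rmem : nat -> nat -> R;
  coins_used : nat }.

Definition init_state : state := State (fun _ _ => 0%N) (fun _ _ => 0) 0.

Definition update (T : Type) (m : nat -> nat -> T) (a i : nat) (v : T) :=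
  fun b j : nat => if (b == a) && (j == i) then v else m b j.

Fixpoint neval (s : state) (e : nexp) : nat :=
  match e with
  | NConst k => k
  | NSize => in_size I
  | NGet a i => nmem s a (neval s i)
  | NAdd e1 e2 => (neval s e1 + neval s e2)%N
  | NSub e1 e2 => (neval s e1 - neval s e2)%N
  end.

Fixpoint reval (s : state) (e : rexp) : R :=
  match e with
  | ROfNat e1 => (neval s e1)%:R
  | RBeta => in_beta I
  | RField i => in_field I (neval s i)
  | REps => in_eps I
  | RGet a i => rmem s a (neval s i)
  | RAdd e1 e2 => reval s e1 + reval s e2
  | RSub e1 e2 => reval s e1 - reval s e2
  | RMul e1 e2 => reval s e1 * reval s e2
  | RDiv e1 e2 => reval s e1 / reval s e2
  end.

Fixpoint beval (s : state) (b : bexp) : bool :=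
  match b with
  | BLtN e1 e2 => (neval s e1 < neval s e2)%N
  | BLtR e1 e2 => reval s e1 < reval s e2
  | BAdj i j => in_adj I (neval s i) (neval s j)
  | BNot b1 => ~~ beval s b1
  | BAnd b1 b2 => beval s b1 && beval s b2
  end.

(* A machine configuration is the stack of commands still to be run, together
   with the memory; [tape] is the sequence of random bits.  The expressions in
   a program have bounded size, so counting one unit per step only changes the
   running time by a constant factor that depends on the program. *)
Definition step (tape : nat -> bool) (K : seq cmd * state) : seq cmd * state :=
  let: (k, s) := K in
  match k with
  | [::] => ([::], s)
  | CSkip :: k' => (k', s)
  | CSetN a i e :: k' =>
      (k', State (update (nmem s) a (neval s i) (neval s e))
                 (rmem s) (coins_used s))
  | CSetR a i e :: k' =>
      (k', State (nmem s) (update (rmem s) a (neval s i) (reval s e))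
                 (coins_used s))
  | CCoin a i :: k' =>
      (k', State (update (nmem s) a (neval s i) (tape (coins_used s) : nat))
                 (rmem s) (coins_used s).+1)
  | CSeq c1 c2 :: k' => ([:: c1, c2 & k'], s)
  | CIf b c1 c2 :: k' => ((if beval s b then c1 else c2) :: k', s)
  | CWhile b c :: k' =>
      (if beval s b then [:: c, CWhile b c & k'] else k', s)
  end.

Definition run (tape : nat -> bool) (c : cmd) (t : nat) : seq cmd * state :=
  iter t (step tape) ([:: c], init_state).

Definition halts (tape : nat -> bool) (c : cmd) (t : nat) : bool :=
  nilp (run tape c t).1.

(* Real outputs are returned in entry 0 of array 0 of the real memory. *)
Definition out_real (tape : nat -> bool) (c : cmd) (t : nat) : R :=
  rmem (run tape c t).2 0 0.

(* Spin configurations are returned in array 0 of the natural memory; a nonzero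
   entry at index x stands for the spin +1 at vertex x. *)
Definition out_config (n : nat) (tape : nat -> bool) (c : cmd) (t : nat) :
    config n :=
  [ffun x : 'I_n => nmem (run tape c t).2 0 x != 0%N].

End Semantics.

Definition instance_input (R : realType) (n : nat) (G : sgraph n) (beta : R)
    (h : 'I_n -> R) (eps : R) : input R :=
  Input n
    (fun i j => if (insub i, insub j) is (Some x, Some y)
                then adj G x y else false)
    beta
    (fun i => if insub i is Some x then h x else 0)
    eps.

Definition bits (T : nat) (w : T.-tuple bool) : nat -> bool := nth false w.

(* Law of the configuration returned within [T] steps; such a run reads at most
   [T] random bits. *)
Definition output_law (R : realType) (n : nat) (I : input R) (c : cmd) (T : nat)
    (sigma : config n) : R :=
  #|[pred w : T.-tuple bool | out_config I n (bits w) c T == sigma]|%:R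
  / 2 ^+ T.

Definition instance_class (R : realType) :=
  forall n : nat, sgraph n -> set ('I_n -> R).

Definition time_bound (R : realType) (C k n : nat) (eps : R) : R :=
  C%:R * (n%:R + eps^-1 + 1) ^+ k.

Definition is_fptas (R : realType) (beta : R) (S : instance_class R)
    (A : cmd) : Prop :=
  coin_free A /\
  exists C k : nat, forall (n : nat) (G : sgraph n) (h : 'I_n -> R),
    S n G h -> forall eps : R, 0 < eps ->
    exists T : nat,
      let I := instance_input G beta h eps in
      let tape := fun=> false in
      let Z := partition_function G beta h in
      let Zhat := out_real I tape A T in
      [/\ T%:R <= time_bound C k n eps, halts I tape A T,
          expR (- eps) * Zhat <= Z & Z <= expR eps * Zhat].

Definition is_sampling_scheme (R : realType) (beta : R) (S : instance_class R)
    (B : cmd) : Prop :=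
  exists C k : nat, forall (n : nat) (G : sgraph n) (h : 'I_n -> R),
    S n G h -> forall eps : R, 0 < eps ->
    exists T : nat,
      let I := instance_input G beta h eps in
      [/\ T%:R <= time_bound C k n eps,
          forall w : T.-tuple bool, halts I (bits w) B T
        & tv_dist (output_law I B T) (ising G beta h) <= eps].

Definition mutually_independent (R : realType) (d : measure_display)
    (Omega : measurableType d) (P : probability Omega R) (J : finType)
    (X : J -> {RV P >-> R}) : Prop :=
  forall (K : {set J}) (A : J -> set R), (forall j, measurable (A j)) ->
    (P (\bigcap_(j in [set` K]) (X j @^-1` A j)) =
     \prod_(j in K) P (X j @^-1` A j))%E.

(* The library's [normal_prob] is parametrised by the standard deviation. *)
Definition gaussian (R : realType) (d : measure_display)
    (Omega : measurableType d) (P : probability Omega R) (v : R)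
    (X : {RV P >-> R}) : Prop :=
  forall A : set R, measurable A ->
    distribution P X A = normal_prob 0 (Num.sqrt v) A.

(* Main.v *)
Require Import Defs.
From mathcomp Require Import all_boot all_order all_algebra.
From mathcomp Require Import all_classical all_reals all_analysis measurable_realfun.
From mathcomp Require Import zify ring lra.
Set Implicit Arguments.
Unset Strict Implicit.
Unset Printing Implicit Defensive.
Import Order.TTheory GRing.Theory Num.Theory.
Import numFieldNormedType.Exports.
Local Open Scope classical_set_scope.
Local Open Scope ring_scope.

(* Writing a spin as s = 2 t - 1 turns the Ising model into a lattice gas with
   vertex weights lam_x = exp (2 h_x - 2 beta deg x) and edge weight
   c = exp (4 beta).  Let r_x be the ratio of the partition functions with x
   occupied and x empty.  Letting the neighbours of x feel its spin one after
   the other gives r_x = lam_x prod_y (1 + c r_y) / (1 + r_y), where r_y is a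
   ratio in the graph without x.  The recursion runs along self-avoiding paths.
   In logarithmic scale a step through y loses at most a constant factor, and
   contracts by an arbitrarily small factor when the field at y is large.  For H
   large, the expectation of the sum over self-avoiding paths of length m of the
   product of these factors is at most 8^-m, so outside an event of small
   probability the recursion can be truncated at depth O(log (n / eps)).  The
   partition function and the conditional marginals used by the sampler are
   products over the vertices of functions of such ratios.  Exponentials are
   replaced by (1 + u / 2^M)^(2^M), which amounts to a small perturbation of beta
   and h.  The sampler tosses enough coins for every conditional probability to
   be right up to a factor close to 1, hence no coupling is needed. *)

(** The randomness sits in the original fields, but contraction is needed for whatever weights the
    recursion meets. Removing a vertex changes only the weights of its neighbours, by a factor [c]
    or 1, so in logarithmic scale every weight met at a surviving vertex stays within a constant,
    depending on [Delta] and [beta], of the original one. A field beyond that margin contracts under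
    every boundary condition. The Gaussian density is at most the inverse of the standard deviation,
    so a large variance makes a field within the margin as unlikely as desired, and independence
    along a self-avoiding path multiplies the mean factors. The obstacle is uniformity: all starting
    points and all lengths must be controlled at once. The gap between the mean 8^-m and the
    required bound 2^-m pays for this as soon as 2^m >= n^2. A single number [M], with [2 ^ M]
    polynomial in n and 1/eps, then serves as recursion depth, as number of squarings and as main
    term of the number of coins; a search tree of degree [Delta] and depth [M] has size polynomial
    in [2 ^ M]. *)

Section TruncatedRecursion.
Variables (R : realType) (n : nat) (a : rel nat) (c : R).
Implicit Types (lam : nat -> R).

Definition edge_factor (r : R) : R := (1 + c * r) / (1 + r).

(* Weights seen when [x] has been removed and its neighbour [i] is visited: the
   neighbours below [i] already feel the spin of [x]. *)
Definition lam_upto lam x i : nat -> R := fun z =>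
  if z == x then 0 else if (z < i)%N && a x z then lam z * c else lam z.

(** No list of visited vertices is kept: a visited vertex has weight 0, hence ratio 0, and
    contributes the factor 1. At depth 0 the vertex is treated as isolated. *)
Fixpoint trunc_ratio m lam x : R :=
  if m is m'.+1 then
    lam x * \prod_(0 <= y < n | a x y)
      edge_factor (trunc_ratio m' (lam_upto lam x y) y)
  else lam x.

(* Weights felt by the vertices from [x] on once the spins [sigma] of the
   vertices below [x] are fixed. *)
Definition pinned lam (sigma : nat -> bool) x : nat -> R := fun z =>
  if (z < x)%N then 0 else lam z * \prod_(0 <= u < x | a u z && sigma u) c.

Lemma eq_pinned lam sigma tau x :
  (forall u, (u < x)%N -> sigma u = tau u) ->
  pinned lam sigma x = pinned lam tau x.
Proof.
move=> eq_st; apply/funext => z; rewrite /pinned; case: ifP => // _; congr (_ * _).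
rewrite big_mkcond [in RHS]big_mkcond; apply: eq_big_nat => u /andP[_ ux].
by rewrite eq_st.
Qed.

(** The incremental form that the programs follow: fixing the spin of [x] deletes [x] and rescales
    its neighbours only if the spin is +1. *)
Lemma pinnedS lam sigma x z : (forall y, ~~ a y y) ->
  pinned lam sigma x.+1 z =
  if z == x then 0 else
  if a x z && sigma x then pinned lam sigma x z * c else pinned lam sigma x z.
Proof.
move=> irr; rewrite /pinned ltnS leq_eqVlt; have [//|zx] := eqVneq z x.
rewrite orFb; case: ifP => zx'; first by rewrite mul0r if_same.
rewrite big_mkcond big_nat_recr //= -big_mkcond /= mulrA.
by case: ifP; rewrite ?mulr1.
Qed.

End TruncatedRecursion.

(** * Weights with the exponentials replaced by powers *)

Section Weights.
Variables (R : realType) (n : nat) (a : rel nat) (beta : R) (h : nat -> R).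
Variable M : nat.

Definition approx_exp (u : R) : R := (1 + u / 2 ^+ M) ^+ (2 ^ M).

Definition edge_base : R := approx_exp beta.
Definition edge_weight : R := edge_base ^+ 4.

(** The value 0 beyond [n] makes indices outside the graph behave like removed vertices. *)
Definition vertex_weight (x : nat) : R :=
  if (x < n)%N then
    approx_exp (h x) ^+ 2 * \prod_(0 <= y < n | a x y) (edge_base ^+ 2)^-1
  else 0.

(** For [k = n] this approximates the Ising weight of the configuration with all spins -1, the
    constant that separates the Ising model from the lattice gas. Each edge is charged to its
    smaller endpoint. *)
Definition prefactor_upto (k : nat) : R :=
  \prod_(0 <= x < k) ((approx_exp (h x))^-1 *
     \prod_(0 <= y < n | a x y && (x < y)%N) edge_base).

(** [M] is both the precision of the exponentials and the recursion depth. *)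
Definition pinned_ratio sigma x : R :=
  trunc_ratio n a edge_weight M (pinned a edge_weight vertex_weight sigma x) x.

End Weights.

Definition coin_value (R : realType) (tape : nat -> bool) (k L : nat) : R :=
  \sum_(0 <= j < L) (tape (k + j)%N)%:R / 2 ^+ j.+1.

(** * Weakest preconditions with running times *)

Section WeakestPrecondition.
Variables (R : realType) (I : input R) (tape : nat -> bool).
Implicit Types (s : state R) (Q : state R -> Prop) (c : cmd).

(** The number of steps [t] is the same for every stack [k] of pending commands, which is what makes
    the times of composed commands add up. Termination is part of the claim. *)
Definition wp c (T : nat) Q s : Prop :=
  exists t s', [/\ (t <= T)%N,
    forall k, iter t (step I tape) (c :: k, s) = (k, s') & Q s'].

Definition setN s a i v : state R :=
  State (update (nmem s) a i v) (rmem s) (coins_used s).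
Definition setR s a i v : state R :=
  State (nmem s) (update (rmem s) a i v) (coins_used s).

Lemma wp_weaken c T T' Q Q' s :
  wp c T Q s -> (T <= T')%N -> (forall s', Q s' -> Q' s') -> wp c T' Q' s.
Proof.
move=> [t [s' [tT ts Qs]]] TT' QQ'; exists t, s'; split=> //.
- exact: leq_trans tT TT'.
- exact: QQ'.
Qed.

Lemma wp_skip T Q s : Q s -> wp CSkip T.+1 Q s.
Proof. by move=> Qs; exists 1%N, s. Qed.

Lemma wp_setN a i e T Q s :
  Q (setN s a (neval I s i) (neval I s e)) -> wp (CSetN a i e) T.+1 Q s.
Proof. by move=> Qs; exists 1%N, (setN s a (neval I s i) (neval I s e)). Qed.

Lemma wp_setR a i e T Q s :
  Q (setR s a (neval I s i) (reval I s e)) -> wp (CSetR a i e) T.+1 Q s.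
Proof. by move=> Qs; exists 1%N, (setR s a (neval I s i) (reval I s e)). Qed.

Lemma wp_coin a i T Q s :
  Q (State (update (nmem s) a (neval I s i) (tape (coins_used s) : nat))
       (rmem s) (coins_used s).+1) ->
  wp (CCoin a i) T.+1 Q s.
Proof. by move=> Qs; exists 1%N; eexists; split; last exact: Qs. Qed.

Lemma wp_seq c1 c2 T1 T2 Q s :
  wp c1 T1 (wp c2 T2 Q) s -> wp (CSeq c1 c2) (T1 + T2).+1 Q s.
Proof.
move=> [t1 [s1 [le1 run1 [t2 [s2 [le2 run2 Qs2]]]]]].
exists (t2 + t1).+1, s2; split=> //; first by rewrite ltnS addnC leq_add.
by move=> k; rewrite iterSr iterD /= run1 run2.
Qed.

Lemma wp_seq_setN a i e c T Q s : (2 <= T)%N ->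
  wp c (T - 2) Q (setN s a (neval I s i) (neval I s e)) ->
  wp (CSeq (CSetN a i e) c) T Q s.
Proof.
move=> le2T H; have -> : T = (1 + (T - 2)).+1 by lia.
by apply: wp_seq; apply: wp_setN.
Qed.

Lemma wp_seq_setR a i e c T Q s : (2 <= T)%N ->
  wp c (T - 2) Q (setR s a (neval I s i) (reval I s e)) ->
  wp (CSeq (CSetR a i e) c) T Q s.
Proof.
move=> le2T H; have -> : T = (1 + (T - 2)).+1 by lia.
by apply: wp_seq; apply: wp_setR.
Qed.

Lemma wp_seq_le T1 c1 c2 T Q s : (T1 < T)%N ->
  wp c1 T1 (wp c2 (T - T1.+1) Q) s -> wp (CSeq c1 c2) T Q s.
Proof.
move=> ltT H; have -> : T = (T1 + (T - T1.+1)).+1 by lia.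
exact: wp_seq.
Qed.

Lemma wp_skip_gt0 T Q s : (0 < T)%N -> Q s -> wp CSkip T Q s.
Proof. by case: T => // T _; exact: wp_skip. Qed.

Lemma wp_if b c1 c2 T Q s :
  (beval I s b -> wp c1 T Q s) -> (~~ beval I s b -> wp c2 T Q s) ->
  wp (CIf b c1 c2) T.+1 Q s.
Proof.
move=> H1 H2.
have : wp (if beval I s b then c1 else c2) T Q s.
  by case: ifP => [/H1//|/negbT /H2].
move=> [t [s' [le_tT run Qs']]].
by exists t.+1, s'; split=> // k; rewrite iterSr /= run.
Qed.

Lemma wp_while_false b c T Q s :
  ~~ beval I s b -> Q s -> wp (CWhile b c) T.+1 Q s.
Proof.
by move=> /negbTE bF Qs; exists 1%N, s; split=> // k; rewrite /= bF.
Qed.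

Lemma wp_while_true b c T1 T2 Q s :
  beval I s b -> wp c T1 (wp (CWhile b c) T2 Q) s ->
  wp (CWhile b c) (T1 + T2).+1 Q s.
Proof.
move=> bT [t1 [s1 [le1 run1 [t2 [s2 [le2 run2 Qs2]]]]]].
exists (t2 + t1).+1, s2; split=> //; first by rewrite ltnS addnC leq_add.
by move=> k; rewrite iterSr iterD /= bT run1 run2.
Qed.

Lemma wp_while_inv b c N T (Inv : nat -> state R -> Prop) s :
  (forall k s, (k < N)%N -> Inv k s -> beval I s b /\ wp c T (Inv k.+1) s) ->
  (forall s, Inv N s -> ~~ beval I s b) ->
  Inv 0%N s -> wp (CWhile b c) (N * T.+1).+1 (Inv N) s.
Proof.
move=> Hstep Hend.
suff H k s' : (k <= N)%N -> Inv (N - k)%N s' ->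
    wp (CWhile b c) (k * T.+1).+1 (Inv N) s'.
  by move=> Is; apply: H; rewrite ?subnn.
elim: k s' => [|k IHk] s' lekN; first by rewrite subn0 => Is; apply: wp_while_false => //; exact: Hend.
move=> Is; have ltN : (N - k.+1 < N)%N by lia.
have [bT Hwp] := Hstep _ _ ltN Is.
rewrite mulSn addSn -addnS; apply: wp_while_true => //.
apply: wp_weaken Hwp _ _ => // s1 I1; apply: IHk; first exact: ltnW.
by rewrite -subSS subSn.
Qed.

Definition CFor i (bound : nexp) (c : cmd) : cmd :=
  CSeq (CSetN i (NConst 0) (NConst 0))
    (CWhile (BLtN (NGet i (NConst 0)) bound)
       (CSeq c (CSetN i (NConst 0) (NAdd (NGet i (NConst 0)) (NConst 1))))).

(** The invariant at [k.+1] is demanded with the counter already increased, since [CFor] increases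
    it after the body; the body itself must leave it at [k]. A round costs 3 steps besides the
    body. *)
Lemma wp_for i bound c N T T' (Inv : nat -> state R -> Prop) Q s :
  (forall k s, Inv k s -> neval I s bound = N) ->
  (forall k s, (k < N)%N -> nmem s i 0%N = k -> Inv k s ->
     wp c T (fun s' => nmem s' i 0%N = k /\ Inv k.+1 (setN s' i 0%N k.+1)) s) ->
  Inv 0%N (setN s i 0%N 0%N) ->
  (forall s', Inv N s' -> nmem s' i 0%N = N -> Q s') ->
  (N * T.+3 + 3 <= T')%N -> wp (CFor i bound c) T' Q s.
Proof.
move=> Hb Hstep I0 HQ leT'; rewrite /CFor.
apply: (@wp_weaken _ (N * T.+3 + 3) _ Q) => //.
have -> : (N * T.+3 + 3 = (1 + (N * T.+3).+1).+1)%N by lia.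
apply: wp_seq; apply: wp_setN => /=.
pose J k s' := nmem s' i 0%N = k /\ Inv k s'.
apply: (@wp_weaken _ (N * T.+3).+1 _ (J N)) => //; last by move=> s' [? ?]; exact: HQ.
apply: wp_while_inv => [k s1 ltkN [ik Ik]|s1 [ik Ik]|].
- split; first by rewrite /= ik (Hb _ _ Ik).
  have -> : T.+2 = (T + 1).+1 by lia.
  apply: wp_seq; apply: wp_weaken (Hstep _ _ ltkN ik Ik) _ _ => // s2 [ik2 Ik2].
  apply: wp_setN => /=; rewrite ik2 addn1; split=> //.
  by rewrite /= /update !eqxx.
- by rewrite /= ik (Hb _ _ Ik) ltnn.
- by split=> //; rewrite /= /update !eqxx.
Qed.

End WeakestPrecondition.

(** * The depth-first evaluation of the recursion *)

(* Natural-number arrays: 0 output, 1 vertex stack, 2 neighbour pointers,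
   3 stack height, 4 depth bound [M], 6-8 loop counters, 9 coin.  Real arrays:
   0 partition function, 1 vertex weights, 2 partial products, 3 saved weights,
   4 result of the last call, 5 edge weight, 6 approximation of [exp beta],
   7 [2 ^ M], 8 approximation of [exp h_x], 9 uniform variable, 10 weight of the
   last coin.  The search updates the vertex weights in place: a frame multiplies
   the weights of the neighbours that it has visited by [c], and divides them
   again when it is popped. *)
Definition nvar a := NGet a (NConst 0).
Definition rvar a := RGet a (NConst 0).
Definition height := nvar 3.
Definition top_vtx := NGet 1 height.
Definition top_ptr := NGet 2 height.
Definition seqs (cs : seq cmd) : cmd := foldr CSeq CSkip cs.

Definition dfs_push : cmd := seqs [::
  CSetN 1 (NAdd height (NConst 1)) top_ptr;
  CSetN 2 (NAdd height (NConst 1)) (NConst 0);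
  CSetR 2 (NAdd height (NConst 1)) (RGet 1 top_ptr);
  CSetR 3 (NAdd height (NConst 1)) (RGet 1 top_ptr);
  CSetR 1 top_ptr (ROfNat (NConst 0));
  CSetN 3 (NConst 0) (NAdd height (NConst 1))].

Definition dfs_undo : cmd :=
  CWhile (BLtN (NConst 0) top_ptr)
    (CSeq (CSetN 2 height (NSub top_ptr (NConst 1)))
       (CIf (BAdj top_vtx top_ptr)
          (CSetR 1 top_ptr (RDiv (RGet 1 top_ptr) (rvar 5))) CSkip)).

(** The popped vertex gets its saved weight times [c], because for the frame below it is now a
    visited neighbour. When the outermost frame is popped, the updates of the frame below go to the
    dummy entry 0. *)
Definition dfs_pop : cmd := seqs [::
  CSetR 4 (NConst 0) (RGet 2 height);
  CSetR 1 top_vtx (RMul (RGet 3 height) (rvar 5));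
  CSetN 3 (NConst 0) (NSub height (NConst 1));
  CSetR 2 height (RMul (RGet 2 height)
    (RDiv (RAdd (ROfNat (NConst 1)) (RMul (rvar 5) (rvar 4)))
          (RAdd (ROfNat (NConst 1)) (rvar 4))));
  CSetN 2 height (NAdd top_ptr (NConst 1))].

(** Vertices already on the stack are entered again; their weight is 0, so the call returns 0 and
    the partial product below is multiplied by 1. *)
Definition dfs_loop : cmd :=
  CWhile (BLtN (NConst 0) height)
    (CIf (BAnd (BLtN top_ptr NSize) (BLtN height (NAdd (nvar 4) (NConst 1))))
       (CIf (BAdj top_vtx top_ptr) dfs_push
          (CSetN 2 height (NAdd top_ptr (NConst 1))))
       (CSeq dfs_undo dfs_pop)).

Section DepthFirstSearch.
Variables (R : realType) (I : input R) (tape : nat -> bool).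
Local Notation n := (in_size I).
Local Notation a := (in_adj I).
Implicit Types (s : state R) (Q : state R -> Prop).

(** Only neighbours open a subtree, so the branching is the degree bound [D]; the other pointer
    positions cost a constant each. Branching [n] at logarithmic depth would not be polynomial. *)
Fixpoint dfs_time (D m : nat) : nat :=
  if m is m'.+1 then (12 * n + 40 + D * (20 + dfs_time D m'))%N else 40.

(** [d] is the height of the calling frame. Its pointer and its partial product, the entries [d] of
    the two arrays 2, are left out because a return modifies them. *)
Definition dfs_frame s s' d := [/\
  forall b i, b \notin [:: 1; 2; 3]%N -> nmem s' b i = nmem s b i,
  forall b i, b \notin [:: 1; 2; 3; 4]%N -> rmem s' b i = rmem s b i,
  coins_used s' = coins_used s,
  (forall j, (j <= d)%N -> nmem s' 1 j = nmem s 1 j) /\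
  (forall j, (j < d)%N -> nmem s' 2 j = nmem s 2 j) &
  (forall j, (j < d)%N -> rmem s' 2 j = rmem s 2 j) /\
  (forall j, (j <= d)%N -> rmem s' 3 j = rmem s 3 j)].

Definition dfs_return (c : R) s s' d (lam : nat -> R) x v := [/\
  dfs_frame s s' d,
  nmem s' 3 0%N = d /\ nmem s' 2 d = (nmem s 2 d).+1,
  rmem s' 4 0%N = v,
  rmem s' 2 d = rmem s 2 d * edge_factor c v &
  forall z, rmem s' 1 z = if z == x then lam x * c else lam z].

Lemma wp_dfs_undo s Q (c : R) lam d x i T :
  c != 0 -> rmem s 5 0%N = c -> (forall y, a x y -> y != x) ->
  nmem s 3 0%N = d -> nmem s 1 d = x -> nmem s 2 d = i ->
  (forall z, rmem s 1 z = lam_upto a c lam x i z) ->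
  (forall s', [/\ forall b j, b != 2%N -> nmem s' b j = nmem s b j,
     forall b j, b != 1%N -> rmem s' b j = rmem s b j,
     coins_used s' = coins_used s,
     forall j, j != d -> nmem s' 2 j = nmem s 2 j &
     forall z, rmem s' 1 z = if z == x then 0 else lam z] -> Q s') ->
  (i * 6 < T)%N ->
  wp I tape dfs_undo T Q s.
Proof.
move=> c0 + irr; elim: i s T => [|i IHi] s T sc sd sx si slam HQ leT.
  case: T leT => // T _; apply: wp_while_false; first by rewrite /= sd si.
  apply: HQ; split=> // z; rewrite slam /lam_upto ltn0; by case: ifP.
have -> : T = (4 + (T - 5)).+1 by lia.
apply: wp_while_true; first by rewrite /= sd si.
apply: (@wp_seq _ _ _ _ _ 1 2); apply: wp_setN => /=; rewrite !sd si subn1 /=.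
apply: wp_if => /=; rewrite /update /= ?sd /= ?eqxx /= sx => axi.
  apply: wp_setR => /=; rewrite /update /= ?sd /= ?eqxx /=.
  apply: IHi; rewrite /= /update /= ?sd ?eqxx //=; last by lia.
    move=> z; have [->|zi] := eqVneq z i.
      rewrite slam /lam_upto ltnSn axi ltnn /= (negbTE (irr _ axi)) sc.
      by rewrite mulfK.
    by rewrite slam /lam_upto ltnS leq_eqVlt (negbTE zi).
  move=> s' [H1 H2 H3 H4 H5]; apply: HQ; split=> //.
  - by move=> b j b2; rewrite H1 //= (negbTE b2).
  - by move=> b j b1; rewrite H2 //= (negbTE b1).
  - by move=> j jd; rewrite H4 //= (negbTE jd).
apply: wp_skip; apply: IHi; rewrite /= /update /= ?sd ?eqxx //=; last by lia.
  move=> z; rewrite slam /lam_upto ltnS leq_eqVlt.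
  by have [->|zi] := eqVneq z i; rewrite ?(negbTE axi) ?andbF.
move=> s' [H1 H2 H3 H4 H5]; apply: HQ; split=> //.
- by move=> b j b2; rewrite H1 //= (negbTE b2).
- by move=> j jd; rewrite H4 //= (negbTE jd).
Qed.

(** Shared by the two ways in which a frame ends, all neighbours examined or depth bound reached;
    [v] is the partial product accumulated so far. *)
Lemma wp_dfs_finish s Q (c : R) lam d x i v T T' :
  c != 0 -> rmem s 5 0%N = c -> (forall y, a x y -> y != x) ->
  nmem s 3 0%N = d.+1 -> nmem s 1 d.+1 = x -> nmem s 2 d.+1 = i ->
  rmem s 2 d.+1 = v -> rmem s 3 d.+1 = lam x ->
  (forall z, rmem s 1 z = lam_upto a c lam x i z) ->
  ~~ ((i < n) && (d < nmem s 4 0))%N ->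
  (forall s', dfs_return c s s' d lam x v -> wp I tape dfs_loop T' Q s') ->
  (T' + i * 6 + 20 <= T)%N ->
  wp I tape dfs_loop T Q s.
Proof.
move=> c0 sc irr sd sx si sv sl slam cond HQ leT.
have -> : T = ((T - T').-1 + T').+1 by lia.
apply: wp_while_true; first by rewrite /= sd.
have -> : (T - T').-1 = (((i * 6).+1 + ((T - T').-2.-2 - i * 6)).+1.+1) by lia.
apply: wp_if => /=; rewrite sd si addn1 ltnS => cond'; first by rewrite cond' in cond.
apply: wp_seq; apply: (wp_dfs_undo c0 sc irr sd sx si slam) => // s1 [H1 H2 H3 H4 H5].
do 2 (apply: wp_seq_setR; first by lia); apply: wp_seq_setN; first by lia.
apply: wp_seq_setR; first by lia.
apply: wp_seq_setN; first by lia.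
apply: wp_skip_gt0; first by lia.
apply: HQ; rewrite /setN /setR /update /=.
have E3 : nmem s1 3 0%N = d.+1 by rewrite H1.
have E1 : nmem s1 1 d.+1 = x by rewrite H1.
have E4 : rmem s1 5 0%N = c by rewrite H2.
have E5 : rmem s1 2 d.+1 = v by rewrite H2.
have E6 : rmem s1 3 d.+1 = lam x by rewrite H2.
split=> //=; rewrite ?E3 ?E1 ?E4 ?E5 ?E6 ?subn1 /= ?eqxx //.
- split=> //=; rewrite ?E3.
  + move=> b j; rewrite !inE !negb_or => /and3P[b1 b2 b3].
    by rewrite (negbTE b2) (negbTE b3) /= H1.
  + move=> b j; rewrite !inE !negb_or => /and4P[b1 b2 b3 b4].
    by rewrite (negbTE b1) (negbTE b2) (negbTE b4) /= H2.
  + split=> j ltjd; first by rewrite H1.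
    by rewrite (ltn_eqF ltjd) H4 // ltn_eqF // ltnW.
  + by split=> j ltjd; rewrite ?(ltn_eqF ltjd) H2.
- split=> //=; rewrite ?E3 ?eqxx /= H4 ?addn1 //.
  by rewrite neq_ltn ltnSn.
- by rewrite H2 // /edge_factor.
- by move=> z; rewrite H5; case: (z == x).
Qed.

(** All calls run inside one loop, so the specification is in continuation style: [s'] is the state
    when the call for [x] returns, and [T'] the time left for the rest of the loop. The remaining
    depth [m] decreases as the stack grows. *)
Lemma wp_dfs m s Q (c : R) lam d x D T T' :
  c != 0 -> rmem s 5 0%N = c -> (forall y, ~~ a y y) ->
  (forall y, count (a y) (iota 0 n) <= D)%N ->
  (d.+1 + m = (nmem s 4 0).+1)%N ->
  nmem s 3 0%N = d.+1 -> nmem s 1 d.+1 = x -> nmem s 2 d.+1 = 0%N ->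
  rmem s 2 d.+1 = lam x -> rmem s 3 d.+1 = lam x ->
  (forall z, rmem s 1 z = lam_upto a c lam x 0 z) ->
  (forall s', dfs_return c s s' d lam x (trunc_ratio n a c m lam x) ->
     wp I tape dfs_loop T' Q s') ->
  (T' + dfs_time D m <= T)%N ->
  wp I tape dfs_loop T Q s.
Proof.
move=> c0 + irr leD.
have irr' u v : a u v -> v != u.
  by move=> auv; apply: contraTneq auv => ->; exact: irr.
elim: m s Q lam d x T T' => [|m IHm] s Q lam d x T T' sc sM sd sx si sp sv slam HQ leT.
  apply: (wp_dfs_finish c0 sc (irr' x) sd sx si sp sv slam _ HQ); last by rewrite /= in leT; lia.
  by rewrite negb_and; apply/orP; right; lia.
set F := fun i => lam x * \prod_(0 <= y < i | a x y)
   edge_factor c (trunc_ratio n a c m (lam_upto a c lam x y) y) in HQ.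
(* Inner induction over the neighbour pointer: [i] is the next candidate, [k] the number of
   candidates left, and [F i] the partial product at that point. *)
suff H k i s' : (i + k = n)%N -> rmem s' 5 0%N = c -> nmem s' 4 0%N = nmem s 4 0%N ->
   nmem s' 3 0%N = d.+1 -> nmem s' 1 d.+1 = x -> nmem s' 2 d.+1 = i ->
   rmem s' 2 d.+1 = F i -> rmem s' 3 d.+1 = lam x ->
   (forall z, rmem s' 1 z = lam_upto a c lam x i z) ->
   (forall s'', dfs_return c s' s'' d lam x (F n) -> wp I tape dfs_loop T' Q s'') ->
   wp I tape dfs_loop (T' + n * 6 + 20 + k * 4 + count (a x) (iota i k) * (20 + dfs_time D m)) Q s'.
  apply: wp_weaken (H n 0%N s _ _ _ _ _ _ _ _ _ _) _ _ => //.
    by rewrite /F big_nil mulr1.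
  have leDx := leD x; rewrite /= in leT.
  apply: leq_trans leT; rewrite -!addnA leq_add2l.
  by have := leq_mul leDx (leqnn (20 + dfs_time D m)); lia.
elim: k i s' => [|k IHk] i s' ik sc' sM' sd' sx' si' sp' sv' slam' HQ'.
  rewrite addn0 in ik; rewrite {i}ik in si' sp' slam' *.
  apply: (wp_dfs_finish c0 sc' (irr' x) sd' sx' _ sp' sv' slam' _ HQ'); rewrite ?ltnn //=; last by lia.
rewrite /=; set K := count _ _.
have [axi|axi] := boolP (a x i); rewrite ?mul1n ?add0n.
  have -> : (T' + n * 6 + 20 + k.+1 * 4 + (true + K) * (20 + dfs_time D m) =
    ((T' + n * 6 + 20 + k * 4 + K * (20 + dfs_time D m) + dfs_time D m) + 23).+1)%N by lia.
  rewrite addnC; apply: wp_while_true; first by rewrite /= sd'.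
  apply: wp_if => /=; rewrite sd' si' addn1 ltnS sM' => cond; last by move: cond; rewrite negb_and; lia.
  apply: wp_if => /=; rewrite sd' sx' si' => axi'; last by rewrite axi in axi'.
  do 2 (apply: wp_seq_setN; first by []); do 3 (apply: wp_seq_setR; first by []).
  apply: wp_seq_setN => //; apply: wp_skip_gt0 => //.
  rewrite /setN /setR /update /= ?sd' /= ?addn1 ?eqxx /= ?sd' ?(ltn_eqF (ltnSn _)) /= si'.
  have slami : rmem s' 1 i = lam_upto a c lam x i i by [].
  apply: (IHm _ _ (lam_upto a c lam x i) d.+1 i _ _ _ _ _ _ _ _ _ _ _ (leqnn _)) => //=;
    rewrite ?eqxx ?andbF //=.
  - by rewrite sM'; lia.
  - by move=> z; rewrite /lam_upto ltn0 /= slam'.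
  move=> s1 [[F1 F2 F3 [F4 F5] [F6 F7]] [G1 G2] H2 H3 H4].
  (* While [i] is being visited it does not yet feel the spin of [x]; the factor [c] left behind by
     the return turns the weights into [lam_upto] at [i.+1]. *)
  have lamii : lam_upto a c lam x i i = lam i.
    by rewrite /lam_upto ltnn (negbTE (irr' _ _ axi)).
  move: G2 H3 F1 F2 F3 F4 F5 F6 F7 => /=; rewrite ?eqxx /= ?(ltn_eqF (ltnSn _)) ?si' sp' => G2 H3 F1 F2 F3 F4 F5 F6 F7.
  apply: IHk => //; first by lia.
  - by rewrite F2.
  - by rewrite F1.
  - by rewrite F4 //= ltn_eqF.
  - by rewrite H3 /F big_mkcond /= [in RHS]big_mkcond big_nat_recr //= axi mulrA.
  - by rewrite F7 //= ltn_eqF.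
  - move=> z; rewrite H4 lamii /lam_upto ltnS (leq_eqVlt z i).
    have [->|zi] := eqVneq z i; last by rewrite orFb.
    by rewrite (negbTE (irr' _ _ axi)) orTb axi.
  move=> s2 [[E1 E2 E3 [E4 E5] [E6 E7]] [K1 K2] J2 J3 J4]; apply: HQ'; split=> //.
  + split=> //.
    * move=> b j bs; rewrite E1 // F1 //.
      by move: bs; rewrite !inE !negb_or => /and3P[/negbTE-> /negbTE-> /negbTE->].
    * move=> b j bs; rewrite E2 // F2 //.
      by move: bs; rewrite !inE !negb_or => /and4P[/negbTE-> /negbTE-> /negbTE->].
    * by rewrite E3 F3.
    * split=> j jd; first by rewrite E4 // F4 ?ltn_eqF //; lia.
      by rewrite E5 // F5 ?ltn_eqF //; lia.
    * split=> j jd; first by rewrite E6 // F6 ?ltn_eqF //; lia.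
      by rewrite E7 // F7 ?ltn_eqF //; lia.
  + by rewrite K1 K2 F5 // ltn_eqF.
  + by rewrite J3 F6 // ltn_eqF.
have -> : (T' + n * 6 + 20 + k.+1 * 4 + K * (20 + dfs_time D m) =
    (3 + (T' + n * 6 + 20 + k * 4 + K * (20 + dfs_time D m))).+1)%N by lia.
apply: wp_while_true; first by rewrite /= sd'.
apply: wp_if => /=; rewrite sd' si' addn1 ltnS sM' => cond; last by move: cond; rewrite negb_and; lia.
apply: wp_if => /=; rewrite sd' sx' si' => axi'; first by rewrite axi' in axi.
apply: wp_setN => /=; rewrite /= sd' si' addn1.
apply: IHk; rewrite /= ?/update /= ?eqxx ?sd' //=; first by lia.
- by rewrite sp' /F big_mkcond /= [in RHS]big_mkcond big_nat_recr //= (negbTE axi) mulr1.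
- move=> z; rewrite slam' /lam_upto ltnS (leq_eqVlt z i).
  have [->|zi] := eqVneq z i; last by rewrite orFb.
  by rewrite (negbTE axi) !andbF.
move=> s2 [[E1 E2 E3 [E4 E5] [E6 E7]] [K1 K2] J2 J3 J4]; apply: HQ'; split=> //.
- split=> //.
  + move=> b j bs; rewrite E1 //.
    by move: bs; rewrite !inE !negb_or => /and3P[_ b2 _]; rewrite /setN /update /= (negbTE b2).
  + split=> j jd; first by rewrite E4.
    by rewrite E5 //= /update /= ltn_eqF //; lia.
- by rewrite K1 K2 /= /update /= ltn_eqF.
Qed.

End DepthFirstSearch.

(** * The set-up phase shared by both programs *)

Definition rnum k := ROfNat (NConst k).

Definition scale_bound (D : nat) : rexp :=
  RMul (RMul (rnum D)
    (RMul (RMul (ROfNat (NAdd NSize (NConst 1))) (ROfNat (NAdd NSize (NConst 1))))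
          (RMul (ROfNat (NAdd NSize (NConst 1))) (ROfNat (NAdd NSize (NConst 1))))))
    (RAdd (rnum 1) (RDiv (rnum 1) REps)).

(** Doubling produces [2 ^ M] among the reals and, by counting, [M] among the naturals, between
    which the machine has no conversion from reals. The constant [D] will depend on [Delta] and
    [beta] only, so it may be part of the program. *)
Definition scale_cmd (D : nat) : cmd := seqs [::
  CSetR 7 (NConst 0) (rnum 1);
  CWhile (BLtR (rvar 7) (scale_bound D))
    (CSeq (CSetR 7 (NConst 0) (RAdd (rvar 7) (rvar 7)))
       (CSetN 4 (NConst 0) (NAdd (nvar 4) (NConst 1))))].

Definition square_cmd (v : nat) : cmd :=
  CFor 8 (nvar 4) (CSetR v (NConst 0) (RMul (rvar v) (rvar v))).

Definition divide_base (e : rexp) : rexp := RDiv e (RMul (rvar 6) (rvar 6)).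

Definition weight_cmd : cmd := seqs [::
  CSetR 8 (NConst 0) (RAdd (rnum 1) (RDiv (RField (nvar 6)) (rvar 7)));
  square_cmd 8;
  CSetR 0 (NConst 0) (RDiv (rvar 0) (rvar 8));
  CSetR 1 (nvar 6) (RMul (rvar 8) (rvar 8));
  CFor 7 NSize
    (CIf (BAdj (nvar 6) (nvar 7))
       (CSeq (CSetR 1 (nvar 6) (divide_base (RGet 1 (nvar 6))))
          (CIf (BLtN (nvar 6) (nvar 7))
             (CSetR 0 (NConst 0) (RMul (rvar 0) (rvar 6))) CSkip))
       CSkip)].

Definition setup_cmd (D : nat) : cmd := seqs [::
  scale_cmd D;
  CSetR 6 (NConst 0) (RAdd (rnum 1) (RDiv RBeta (rvar 7)));
  square_cmd 6;
  CSetR 5 (NConst 0) (RMul (RMul (rvar 6) (rvar 6)) (RMul (rvar 6) (rvar 6)));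
  CSetR 0 (NConst 0) (rnum 1);
  CFor 6 NSize weight_cmd].

Section Setup.
Variables (R : realType) (I : input R) (tape : nat -> bool).
Local Notation n := (in_size I).
Local Notation a := (in_adj I).
Local Notation beta := (in_beta I).
Local Notation h := (in_field I).
Local Notation eps := (in_eps I).
Implicit Types (s : state R) (Q : state R -> Prop).

Definition scale_value (D : nat) : R := D%:R * n.+1%:R ^+ 4 * (1 + eps^-1).

Lemma scale_boundE D s : reval I s (scale_bound D) = scale_value D.
Proof. by rewrite /= /scale_value addn1 div1r -!expr2 -exprM. Qed.

Lemma wp_scale D M Q T :
  scale_value D <= 2 ^+ M -> (forall k, (k < M)%N -> 2 ^+ k < scale_value D) ->
  (M * 5 + 6 <= T)%N ->
  (forall s, [/\ forall b i, b != 4%N -> nmem s b i = 0%N,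
     nmem s 4 0%N = M, forall b i, b != 7%N -> rmem s b i = 0,
     rmem s 7 0%N = 2 ^+ M & coins_used s = 0%N] -> Q s) ->
  wp I tape (scale_cmd D) T Q (init_state R).
Proof.
move=> leM ltM leT HQ; apply: wp_seq_setR; first by lia.
pose Inv k s := [/\ forall b i, b != 4%N -> nmem s b i = 0%N,
     nmem s 4 0%N = k, forall b i, b != 7%N -> rmem s b i = 0,
     rmem s 7 0%N = 2 ^+ k & coins_used s = 0%N].
apply: (@wp_seq_le _ _ _ ((M * 4).+1)); first by lia.
apply: wp_weaken (wp_while_inv (N := M) (T := 3) (Inv := Inv) _ _ _) (leqnn _) _.
- move=> k s ltkM [H1 H2 H3 H4 H5]; split.
    by rewrite /beval scale_boundE /= H4 ltM.
  apply: (@wp_seq _ _ _ _ _ 1 1); apply: wp_setR; apply: wp_setN; split=> //=.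
  + by move=> b i b4; rewrite /update (negbTE b4) /= H1.
  + by rewrite /update /= H2 addn1.
  + by move=> b i b7; rewrite /update (negbTE b7) /= H3.
  + by rewrite /update /= H4 exprS mulr_natl.
- by move=> s [_ _ _ H4 _]; rewrite /beval scale_boundE /= H4 -leNgt.
- split=> //= b i b7; by rewrite /update (negbTE b7).
- by move=> s Hs; apply: wp_skip_gt0; [lia|exact: HQ].
Qed.

Lemma wp_square v M s Q T : nmem s 4 0%N = M -> (M * 4 + 3 <= T)%N ->
  (forall s', [/\ forall b i, b != 8%N -> nmem s' b i = nmem s b i,
     forall b i, b != v -> rmem s' b i = rmem s b i,
     rmem s' v 0%N = rmem s v 0%N ^+ (2 ^ M) & coins_used s' = coins_used s] -> Q s') ->
  wp I tape (square_cmd v) T Q s.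
Proof.
move=> sM leT HQ.
pose Inv k s' := [/\ forall b i, b != 8%N -> nmem s' b i = nmem s b i,
     forall b i, b != v -> rmem s' b i = rmem s b i,
     rmem s' v 0%N = rmem s v 0%N ^+ (2 ^ k) & coins_used s' = coins_used s].
apply: (wp_for (N := M) (T := 1) (Inv := Inv)) => //.
- by move=> k s1 [H1 _ _ _] /=; rewrite H1.
- move=> k s1 _ s18 [H1 H2 H3 H4]; apply: wp_setR; rewrite /setN /setR /update /=.
  split=> //; split=> //=.
  + by move=> b i b8; rewrite (negbTE b8) H1.
  + by move=> b i bv; rewrite (negbTE bv) /= H2.
  + by rewrite !eqxx /= H3 expnSr exprM expr2.
- by split=> //= b i b8; rewrite /update (negbTE b8).
- by move=> s' Is' _; exact: HQ.
Qed.

Lemma wp_weight M (b : R) x s Q T :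
  nmem s 4 0%N = M -> nmem s 6 0%N = x -> rmem s 7 0%N = 2 ^+ M -> rmem s 6 0%N = b ->
  (M * 4 + n * 9 + 20 <= T)%N ->
  (forall s', [/\ forall d i, d \notin [:: 7; 8]%N -> nmem s' d i = nmem s d i,
     forall d i, d \notin [:: 0; 1; 8]%N -> rmem s' d i = rmem s d i,
     forall z, rmem s' 1 z = if z == x then approx_exp M (h x) ^+ 2 *
        \prod_(0 <= y < n | a x y) (b ^+ 2)^-1 else rmem s 1 z,
     rmem s' 0 0%N = rmem s 0 0%N * ((approx_exp M (h x))^-1 *
       \prod_(0 <= y < n | a x y && (x < y)%N) b) &
     coins_used s' = coins_used s] -> Q s') ->
  wp I tape weight_cmd T Q s.
Proof.
move=> s4 s6 s7 sb leT HQ.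
apply: wp_seq_setR; first by lia.
rewrite /= s6 s7.
apply: (@wp_seq_le _ _ _ (M * 4 + 3)); first by lia.
apply: (@wp_square _ M) => // s1 [H1 H2 H3 H4].
have Ee : rmem s1 8 0%N = approx_exp M (h x) by rewrite H3.
apply: wp_seq_setR; first by lia.
apply: wp_seq_setR; first by lia.
have E6 : nmem s1 6 0%N = x by rewrite H1.
rewrite /= /setR /update /= Ee E6.
have E0 : rmem s1 0 0%N = rmem s 0 0%N by rewrite H2.
rewrite E0.
apply: (@wp_seq_le _ _ _ (n * 9 + 3)); first by lia.
pose Inv k s' := [/\ forall d i, d \notin [:: 7; 8]%N -> nmem s' d i = nmem s d i,
     forall d i, d \notin [:: 0; 1; 8]%N -> rmem s' d i = rmem s d i,
     forall z, rmem s' 1 z = if z == x then approx_exp M (h x) ^+ 2 *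
        \prod_(0 <= y < k | a x y) (b ^+ 2)^-1 else rmem s 1 z,
     rmem s' 0 0%N = rmem s 0 0%N * ((approx_exp M (h x))^-1 *
       \prod_(0 <= y < k | a x y && (x < y)%N) b) &
     coins_used s' = coins_used s].
apply: (wp_for (N := n) (T := 6) (Inv := Inv)) => //.
- move=> k s2 ltkn s2k [K1 K2 K3 K4 K5].
  have k6 : nmem s2 6 0%N = x by rewrite K1.
  have kb : rmem s2 6 0%N = b by rewrite K2.
  apply: wp_if; rewrite /= k6 s2k => axk.
    apply: (@wp_seq _ _ _ _ _ 1 3); apply: wp_setR; rewrite /= k6 kb.
    apply: wp_if; rewrite /= k6 s2k => ltxk; [apply: wp_setR|apply: wp_skip];
      rewrite /= /setN /setR /update /=; split=> //; split=> //=.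
    + by move=> d i; rewrite !inE negb_or => /andP[d7 d8]; rewrite (negbTE d7) K1 // !inE negb_or d7.
    + move=> d i; rewrite !inE !negb_or => /and3P[d0 d1 d8].
      by rewrite (negbTE d0) (negbTE d1) /= K2 // !inE !negb_or d0 d1.
    + move=> z; rewrite !K3 eqxx; case: eqP => // _.
      by rewrite big_mkcond [in RHS]big_mkcond big_nat_recr //= axk mulrA expr2.
    + by rewrite K4 kb [in RHS]big_mkcond big_nat_recr //= axk ltxk -big_mkcond !mulrA.
    + by move=> d i; rewrite !inE negb_or => /andP[d7 d8]; rewrite (negbTE d7) K1 // !inE negb_or d7.
    + move=> d i; rewrite !inE !negb_or => /and3P[d0 d1 d8].
      by rewrite (negbTE d1) /= K2 // !inE !negb_or d0 d1.
    + move=> z; rewrite !K3 eqxx; case: eqP => // _.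
      by rewrite big_mkcond [in RHS]big_mkcond big_nat_recr //= axk mulrA expr2.
    + by rewrite K4 [in RHS]big_mkcond big_nat_recr //= (negbTE ltxk) andbF -big_mkcond /= mulr1.
  apply: wp_skip; rewrite /= /setN /update /=; split=> //; split=> //=.
  + by move=> d i; rewrite !inE negb_or => /andP[d7 d8]; rewrite (negbTE d7) K1 // !inE negb_or d7.
  + move=> z; rewrite !K3; case: eqP => // _.
    by rewrite big_mkcond [in RHS]big_mkcond big_nat_recr //= (negbTE axk) mulr1.
  + by rewrite K4 [in RHS]big_mkcond big_nat_recr //= (negbTE axk) /= -big_mkcond /= mulr1.
- rewrite /setN /update /=; split=> //=.
  + move=> d i; rewrite !inE negb_or => /andP[d7 d8]; rewrite (negbTE d7) /=.
    by rewrite H1.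
  + move=> d i; rewrite !inE !negb_or => /and3P[d0 d1 d8].
    by rewrite (negbTE d0) (negbTE d1) /= H2 //= /update (negbTE d8).
  + by move=> z; rewrite big_geq // mulr1 H2 //= expr2.
  + by rewrite big_geq // mulr1.
- by move=> s' Is' _; apply: wp_skip_gt0; [lia|exact: HQ].
Qed.

Definition setup_time M := (M * 9 + n * (M * 4 + n * 9 + 23) + 40)%N.

Definition setup_post M s := [/\
  nmem s 4 0%N = M, rmem s 5 0%N = edge_weight beta M,
  forall z, rmem s 1 z = vertex_weight n a beta h M z,
  rmem s 0 0%N = prefactor_upto n a beta h M n &
  coins_used s = 0%N /\ forall i, nmem s 0 i = 0%N].

Lemma wp_setup D M Q T :
  scale_value D <= 2 ^+ M -> (forall k, (k < M)%N -> 2 ^+ k < scale_value D) ->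
  (setup_time M <= T)%N -> (forall s, setup_post M s -> Q s) ->
  wp I tape (setup_cmd D) T Q (init_state R).
Proof.
move=> leM ltM; rewrite /setup_time => leT HQ.
apply: (@wp_seq_le _ _ _ (M * 5 + 6)); first by lia.
apply: (wp_scale leM ltM) => // s1 [H1 H2 H3 H4 H5].
apply: wp_seq_setR; first by lia.
rewrite /= H4; apply: (@wp_seq_le _ _ _ (M * 4 + 3)); first by lia.
apply: (@wp_square _ M) => // s2 [G1 G2 G3 G4].
have Eb : rmem s2 6 0%N = edge_base beta M by rewrite G3.
have E7 : rmem s2 7 0%N = 2 ^+ M by rewrite G2.
apply: wp_seq_setR; first by lia.
apply: wp_seq_setR; first by lia.
rewrite /= Eb /setR /update /=.
apply: (@wp_seq_le _ _ _ (n * (M * 4 + n * 9 + 23) + 3)); first by lia.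
pose Inv k s' := [/\ [/\ nmem s' 4 0%N = M, rmem s' 7 0%N = 2 ^+ M & rmem s' 6 0%N = edge_base beta M],
  rmem s' 5 0%N = edge_weight beta M,
  forall z, rmem s' 1 z = if (z < k)%N then vertex_weight n a beta h M z else 0,
  rmem s' 0 0%N = prefactor_upto n a beta h M k &
  coins_used s' = 0%N /\ forall i, nmem s' 0 i = 0%N].
apply: (wp_for (N := n) (T := M * 4 + n * 9 + 20) (Inv := Inv)) => //.
- move=> k s3 ltkn s3k [[K1 K2 K3] K4 K5 K6 [K7 K8]].
  apply: (wp_weight K1 s3k K2 K3) => // s4 [J1 J2 J3 J4 J5].
  rewrite /setN /update /=; split; first by rewrite J1.
  split=> //=.
  + by rewrite J1 // !J2.
  + by rewrite J2.
  + move=> z; rewrite J3 ltnS leq_eqVlt K5; have [->|//] := eqVneq z k.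
    by rewrite /vertex_weight ltkn.
  + by rewrite J4 K6 /prefactor_upto big_nat_recr.
  + by split=> [|i]; rewrite ?J5 // J1.
- rewrite /setN /update; split=> //=.
  + by rewrite G1 //= H2.
  + by rewrite /edge_weight !exprS expr0 mulr1 !mulrA.
  + by move=> z; rewrite G2 //= /update /= H3.
  + by rewrite /prefactor_upto big_geq.
  + by rewrite G4; split=> // i; rewrite G1 //= H1.
- move=> s' [[K1 K2 K3] K4 K5 K6 K7] _; apply: wp_skip_gt0; [lia|apply: HQ].
  by split=> // z; rewrite K5 /vertex_weight; case: ltnP.
- by lia.
Qed.

End Setup.

(** * The counting and the sampling programs *)

Definition call_cmd : cmd := seqs [::
  CSetN 1 (NConst 1) (nvar 6);
  CSetN 2 (NConst 1) (NConst 0);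
  CSetR 2 (NConst 1) (RGet 1 (nvar 6));
  CSetR 3 (NConst 1) (RGet 1 (nvar 6));
  CSetR 1 (nvar 6) (rnum 0);
  CSetN 3 (NConst 0) (NConst 1);
  dfs_loop].

(** Self-reduction along the configuration with all spins -1: deleting the vertices one after the
    other divides the partition function by [1 + r] each time. *)
Definition count_cmd (D : nat) : cmd :=
  CSeq (setup_cmd D)
    (CFor 6 NSize (seqs [:: call_cmd;
       CSetR 0 (NConst 0) (RMul (rvar 0) (RAdd (rnum 1) (rvar 4)));
       CSetR 1 (nvar 6) (rnum 0)])).

(** [4 n] coins compensate conditional probabilities of order [exp (- 2 n)], [D] coins a constant
    depending on [Delta] and [beta]; the other [M] give the relative precision. *)
Definition coin_bound (D : nat) : nexp :=
  NAdd (nvar 4) (NAdd (NAdd (NAdd NSize NSize) (NAdd NSize NSize)) (NConst D)).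

Definition sample_cmd (D : nat) : cmd :=
  CSeq (setup_cmd D)
    (CFor 6 NSize (seqs [:: call_cmd;
       CSetR 9 (NConst 0) (rnum 0);
       CSetR 10 (NConst 0) (rnum 1);
       CFor 8 (coin_bound D) (seqs [::
         CCoin 9 (NConst 0);
         CSetR 10 (NConst 0) (RDiv (rvar 10) (rnum 2));
         CSetR 9 (NConst 0) (RAdd (rvar 9) (RMul (ROfNat (nvar 9)) (rvar 10)))]);
       CIf (BLtR (RMul (rvar 9) (RAdd (rnum 1) (rvar 4))) (rvar 4))
         (CSeq (CSetN 0 (nvar 6) (NConst 1))
            (CFor 7 NSize (CIf (BAdj (nvar 6) (nvar 7))
               (CSetR 1 (nvar 7) (RMul (RGet 1 (nvar 7)) (rvar 5))) CSkip)))
         CSkip;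
       CSetR 1 (nvar 6) (rnum 0)])).

Section Programs.
Variables (R : realType) (I : input R) (tape : nat -> bool).
Local Notation n := (in_size I).
Local Notation a := (in_adj I).
Local Notation beta := (in_beta I).
Local Notation h := (in_field I).
Implicit Types (s : state R) (Q : state R -> Prop).
Variables (Delta D M : nat).
Hypothesis irr : forall y, ~~ a y y.
Hypothesis leDelta : forall y, (count (a y) (iota 0 n) <= Delta)%N.
Hypothesis c_neq0 : edge_weight beta M != 0.
Hypothesis leM : scale_value I D <= 2 ^+ M.
Hypothesis ltM : forall k, (k < M)%N -> 2 ^+ k < scale_value I D.
Local Notation c := (edge_weight beta M).
Local Notation lam := (vertex_weight n a beta h M).
Local Notation ratio := (pinned_ratio n a beta h M).

Lemma wp_call s Q l x T :
  nmem s 4 0%N = M -> nmem s 6 0%N = x -> rmem s 5 0%N = c ->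
  (forall z, rmem s 1 z = l z) -> (dfs_time I Delta M + 20 <= T)%N ->
  (forall s', [/\ forall b i, b \notin [:: 1; 2; 3]%N -> nmem s' b i = nmem s b i,
     forall b i, b \notin [:: 1; 2; 3; 4]%N -> rmem s' b i = rmem s b i,
     rmem s' 4 0%N = trunc_ratio n a c M l x,
     forall z, rmem s' 1 z = if z == x then l x * c else l z &
     coins_used s' = coins_used s] -> Q s') ->
  wp I tape call_cmd T Q s.
Proof.
move=> s4 s6 s5 sl leT HQ.
do 2 (apply: wp_seq_setN; first by lia); do 3 (apply: wp_seq_setR; first by lia).
apply: wp_seq_setN; first by lia.
rewrite /setN /setR /update /= s6 sl.
apply: (@wp_seq_le _ _ _ (dfs_time I Delta M + 2)); first by lia.
apply: (wp_dfs (m := M) (c := c) (lam := l) (d := 0) (x := x) (D := Delta) (T' := 2)) => //=.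
- by rewrite s4.
- by move=> z; rewrite /lam_upto ltn0 /= sl.
- move=> s1 [[F1 F2 F3 _ _] [G1 G2] H1 H2 H3]; apply: wp_while_false; first by rewrite /= G1.
  apply: wp_skip_gt0; first by lia.
  apply: HQ; split=> //.
  + move=> b i bs; rewrite F1 //; move: bs.
    by rewrite !inE !negb_or => /and3P[/negbTE b1 /negbTE b2 /negbTE b3] /=; rewrite ?b1 ?b2 ?b3.
  + move=> b i bs; rewrite F2 //; move: bs.
    by rewrite !inE !negb_or => /and4P[/negbTE b1 /negbTE b2 /negbTE b3 _] /=; rewrite ?b1 ?b2 ?b3.
- by lia.
Qed.

Definition count_time := (setup_time I M + n * (dfs_time I Delta M + 30) + 10)%N.

Lemma wp_count :
  wp I tape (count_cmd D) count_time (fun s => rmem s 0 0%N =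
     prefactor_upto n a beta h M n * \prod_(0 <= x < n) (1 + ratio xpred0 x))
   (init_state R).
Proof.
rewrite /count_time; apply: (@wp_seq_le _ _ _ (setup_time I M)); first by lia.
apply: (wp_setup _ leM ltM) => // s1 [H1 H2 H3 H4 H5].
pose Inv k s' := [/\ nmem s' 4 0%N = M, rmem s' 5 0%N = c,
  forall z, rmem s' 1 z = pinned a c lam xpred0 k z &
  rmem s' 0 0%N = prefactor_upto n a beta h M n * \prod_(0 <= x < k) (1 + ratio xpred0 x)].
apply: (wp_for (N := n) (T := dfs_time I Delta M + 27) (Inv := Inv)).
- by [].
- move=> k s2 ltkn s2k [K1 K2 K3 K4].
  apply: (@wp_seq_le _ _ _ (dfs_time I Delta M + 20)); first by lia.
  apply: (wp_call K1 s2k K2 K3) => // s3 [J1 J2 J3 J4 J5].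
  do 2 (apply: wp_seq_setR; first by lia); apply: wp_skip_gt0; first by lia.
  rewrite /= /setN /setR /update /= J3 !J1 // s2k; split=> //; split=> //=.
  + by rewrite J1.
  + by rewrite J2.
  + move=> z; rewrite pinnedS // andbF J4; by case: (z == k).
  + by rewrite J2 // K4 -mulrA [in RHS]big_nat_recr.
- rewrite /setN /update; split=> //=.
  + move=> z; rewrite H3 /pinned ltn0 big_geq ?mulr1 //.
  + by rewrite H4 big_geq // mulr1.
- by move=> s' [_ _ _ ->].
- by lia.
Qed.

Definition coins_per_vertex := (M + (4 * n + D))%N.
Local Notation L := coins_per_vertex.

Definition sample_time :=
  (setup_time I M + n * (dfs_time I Delta M + L * 10 + n * 6 + 50) + 10)%N.

(** The ratio at [x] sees only the spins below [x], so this self-referential condition, read in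
    increasing order of the vertices, determines the output. It can be stated on the final memory
    because spins once written are kept. *)
Lemma wp_sample :
  wp I tape (sample_cmd D) sample_time (fun s => forall x, (x < n)%N ->
     let sigma := fun y => nmem s 0 y != 0%N in
     sigma x = (coin_value R tape (x * L) L * (1 + ratio sigma x) < ratio sigma x))
   (init_state R).
Proof.
rewrite /sample_time; apply: (@wp_seq_le _ _ _ (setup_time I M)); first by lia.
apply: (wp_setup _ leM ltM) => // s1 [H1 H2 H3 H4 [H5 H6]].
pose sg s := fun y => nmem s 0 y != 0%N.
pose Inv k s' := [/\ nmem s' 4 0%N = M, rmem s' 5 0%N = c,
  forall z, rmem s' 1 z = pinned a c lam (sg s') k z,
  coins_used s' = (k * L)%N /\ (forall x, (k <= x)%N -> nmem s' 0 x = 0%N) &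
  forall x, (x < k)%N -> sg s' x =
    (coin_value R tape (x * L) L * (1 + ratio (sg s') x) < ratio (sg s') x)].
have sgS s s' k : (forall y, (y < k)%N -> nmem s' 0 y = nmem s 0 y) ->
   forall x, (x <= k)%N -> pinned a c lam (sg s') x = pinned a c lam (sg s) x.
  by move=> E x lexk; apply: eq_pinned => u ux; rewrite /sg E //; lia.
apply: (wp_for (N := n) (T := dfs_time I Delta M + L * 10 + n * 6 + 47) (Inv := Inv)).
- by [].
- move=> k s2 ltkn s2k [K1 K2 K3 [K4 K4'] K5].
  apply: (@wp_seq_le _ _ _ (dfs_time I Delta M + 20)); first by lia.
  apply: (wp_call K1 s2k K2 K3) => // s3 [J1 J2 J3 J4 J5].
  do 2 (apply: wp_seq_setR; first by lia).
  rewrite /= /setR /update /=.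
  apply: (@wp_seq_le _ _ _ (L * 10 + 3)); first by lia.
  pose InvL j s' := [/\ forall b i, b \notin [:: 8; 9]%N -> nmem s' b i = nmem s3 b i,
    forall b i, b \notin [:: 9; 10]%N -> rmem s' b i = rmem s3 b i,
    rmem s' 9 0%N = coin_value R tape (k * L) j,
    rmem s' 10 0%N = 2 ^- j & coins_used s' = (k * L + j)%N].
  apply: (wp_for (N := L) (T := 7) (Inv := InvL)).
  + move=> j s' [G1 _ _ _ _] /=; rewrite G1 // J1 // K1 /L; lia.
  + move=> j s4 ltjL s4j [G1 G2 G3 G4 G5].
    apply: (@wp_seq_le _ _ _ 1) => //.
    apply: wp_coin; do 2 (apply: wp_seq_setR; first by []); apply: wp_skip_gt0 => //.
    rewrite /setN /setR /update /= s4j; split=> //; split=> //=.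
    * move=> b i; rewrite !inE !negb_or => /andP[b8 b9].
      by rewrite (negbTE b8) (negbTE b9) /= G1 // !inE negb_or b8.
    * move=> b i; rewrite !inE !negb_or => /andP[b9 b10].
      by rewrite (negbTE b9) (negbTE b10) /= G2 // !inE negb_or b9.
    * by rewrite G3 G4 G5 /coin_value [in RHS]big_nat_recr //= exprSr invfM.
    * by rewrite G4 exprSr invfM.
    * by rewrite G5 addnS.
  + rewrite /setN /update /=; split=> //=.
    * by move=> b i; rewrite !inE !negb_or => /andP[/negbTE-> _].
    * by move=> b i; rewrite !inE !negb_or => /andP[/negbTE-> /negbTE->].
    * by rewrite /coin_value big_geq.
    * by rewrite expr0 invr1.
    * by rewrite addn0 J5.
  + move=> s4 [G1 G2 G3 G4 G5] _.
    have E1 z : rmem s4 1 z = if z == k then pinned a c lam (sg s2) k k * c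
        else pinned a c lam (sg s2) k z by rewrite G2.
    have E4 : rmem s4 4 0%N = ratio (sg s2) k by rewrite G2.
    have E5 : rmem s4 5 0%N = c by rewrite G2 // J2.
    have En b i : b \notin [:: 1; 2; 3; 8; 9]%N -> nmem s4 b i = nmem s2 b i.
      move=> bs; rewrite G1; last by move: bs; rewrite !inE; lia.
      by rewrite J1 //; move: bs; rewrite !inE; lia.
    pose up := coin_value R tape (k * L) L * (1 + ratio (sg s2) k) < ratio (sg s2) k.
    pose post := fun s' : state R => [/\ forall b i, b \notin [:: 0; 7]%N -> nmem s' b i = nmem s4 b i,
      forall i, nmem s' 0 i = if i == k then nat_of_bool up else nmem s2 0 i,
      rmem s' 5 0%N = c,
      forall z, z != k -> rmem s' 1 z =
        if a k z && (nmem s' 0 k != 0%N) then pinned a c lam (sg s2) k z * c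
        else pinned a c lam (sg s2) k z &
      coins_used s' = coins_used s4].
    apply: (@wp_seq_le _ _ _ (n * 6 + 9).+1); first by rewrite /L; lia.
    apply: (@wp_weaken _ _ _ _ (n * 6 + 9).+1 _ post) => [||s5 [F1 F2 F3 F4 F5]].
    * apply: wp_if; rewrite /= G3 E4 => upE; last first.
        have up0 : up = false by apply: negbTE.
        apply: wp_skip_gt0; first by lia.
        split=> //.
        -- move=> i; rewrite En // up0; case: eqP => // ->; exact: K4'.
        -- by move=> z zk; rewrite E1 (negbTE zk) En // K4' // eqxx andbF.
      have up1 : up = true by [].
      apply: wp_seq_setN; first by lia.
      have E6 : nmem s4 6 0%N = k by rewrite En.
      rewrite /setN /= E6.
      pose InvY j s' := [/\ forall b i, b \notin [:: 0; 7]%N -> nmem s' b i = nmem s4 b i,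
         forall i, nmem s' 0 i = if i == k then 1%N else nmem s2 0 i,
         forall i, rmem s' 5 i = rmem s4 5 i,
         forall z, z != k -> rmem s' 1 z =
           if (z < j)%N && a k z then pinned a c lam (sg s2) k z * c
           else pinned a c lam (sg s2) k z &
         coins_used s' = coins_used s4].
      apply: (wp_for (N := n) (T := 2) (Inv := InvY)) => //.
      -- move=> j s5 ltjn s5j [F1 F2 F3 F4 F5].
         have Ek : nmem s5 6 0%N = k by rewrite F1.
         apply: wp_if; rewrite /= Ek s5j => akj; [apply: wp_setR|apply: wp_skip];
           rewrite /= /setN /setR /update /= ?s5j; split=> //; split=> //=.
         ++ by move=> b i; rewrite !inE !negb_or => /andP[b0 b7]; rewrite (negbTE b7) /= F1 // !inE negb_or b0.
         ++ move=> z zk; have jk : j != k by apply: contraTneq akj => ->; exact: irr.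
            rewrite !F4 // ltnS (leq_eqVlt z j); have [->|zj] //= := eqVneq z j.
            by rewrite ltnn akj F3 E5.
         ++ by move=> b i; rewrite !inE !negb_or => /andP[b0 b7]; rewrite (negbTE b7) /= F1 // !inE negb_or b0.
         ++ move=> z zk; rewrite !F4 // ltnS (leq_eqVlt z j); have [->|zj] //= := eqVneq z j.
            by rewrite (negbTE akj) !andbF.
      -- rewrite /setN /update /=; split=> //=.
         ++ by move=> b i; rewrite !inE !negb_or => /andP[/negbTE-> /negbTE->].
         ++ by move=> i; rewrite En.
         ++ by move=> z zk; rewrite E1 (negbTE zk).
      -- move=> s5 [F1 F2 F3 F4 F5] _; split=> //.
         ++ by move=> i; rewrite F2 up1.
         ++ by rewrite F3.
         ++ move=> z zk; rewrite F4 // F2 eqxx andbT.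
            (* The update loop stops at [n]; beyond it every weight is 0, and multiplying by [c]
               changes nothing. *)
            have [//|nz] := ltnP z n.
            by rewrite /pinned /vertex_weight (leq_gtF nz) !mul0r !if_same mul0r if_same.
      -- by lia.
    * by [].
    * apply: wp_seq_setR; first by rewrite /L; lia.
      apply: wp_skip_gt0; first by rewrite /L; lia.
      rewrite /= /setN /setR /update /= F1 // En // s2k; split=> //.
      have sgE : forall y, (y < k)%N -> nmem s5 0 y = nmem s2 0 y.
        by move=> y yk; rewrite F2 (ltn_eqF yk).
      have sgE' : sg s5 k = up by rewrite /sg F2 eqxx; case: (up).
      split=> //=.
      -- by rewrite F1 // En.
      -- move=> z; rewrite pinnedS //; case: eqP => // /eqP zk.
         change (rmem s5 1 z = if a k z && sg s5 k then pinned a c lam (sg s5) k z * c else pinned a c lam (sg s5) k z).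
         by rewrite F4 // (sgS s2 s5 k).
      -- rewrite F5 G5 mulSn addnC; split=> // x ltkx.
         by rewrite F2 (gtn_eqF ltkx) K4' // ltnW.
      -- move=> x; rewrite ltnS => lexk.
         change (sg s5 x = (coin_value R tape (x * L) L * (1 + ratio (sg s5) x) < ratio (sg s5) x)).
         rewrite /pinned_ratio (sgS s2 s5 k) //.
         move: lexk; rewrite leq_eqVlt => /orP[/eqP->//|ltxk].
         rewrite -[trunc_ratio _ _ _ _ _ _]/(ratio (sg s2) x) -K5 //.
         by rewrite /sg sgE.
  + by [].
- rewrite /setN /update; split=> //=.
  + by move=> z; rewrite H3 /pinned ltn0 big_geq ?mulr1.
- by move=> s' [_ _ _ _ H] _ x; exact: H.
- lia.
Qed.

End Programs.

(** * The lattice gas and the ratio recursion *)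

Section LatticeGas.
Variables (R : realType) (n : nat) (a : rel nat) (c : R).
Hypothesis irr : forall y, ~~ a y y.
Hypothesis sym : symmetric a.
Hypothesis c_gt0 : 0 < c.
Implicit Types (lam : nat -> R) (sigma : config n).

Definition gas_weight lam sigma : R :=
  \prod_(x < n) (if sigma x then lam x else 1) *
  \prod_(x < n) \prod_(y < n | a x y && (x < y)%N)
     (if sigma x && sigma y then c else 1).

Definition gas_sum lam : R := \sum_sigma gas_weight lam sigma.

Lemma lam_upto_ge0 lam x i :
  (forall z, 0 <= lam z) -> forall z, 0 <= lam_upto a c lam x i z.
Proof.
move=> lam0 z; rewrite /lam_upto; do 2 case: ifP => // _.
by rewrite mulr_ge0 // ltW.
Qed.

Lemma gas_sum_gt0 lam : (forall z, 0 <= lam z) -> 0 < gas_sum lam.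
Proof.
move=> lam0; rewrite /gas_sum (bigD1 [ffun=> false]) //=.
apply: ltr_wpDr.
  apply: sumr_ge0 => sigma _; rewrite mulr_ge0 //.
    by apply: prodr_ge0 => x _; case: ifP.
  by apply: prodr_ge0 => x _; apply: prodr_ge0 => y _; case: ifP => // _; exact: ltW.
rewrite /gas_weight !big1 ?mulr1 //.
- by move=> x _; rewrite ffunE big1 // => y _.
- by move=> x _; rewrite ffunE.
Qed.

Definition flip (x : 'I_n) sigma : config n :=
  [ffun y => if y == x then ~~ sigma y else sigma y].

Lemma flipK x : involutive (flip x).
Proof.
by move=> s; apply/ffunP => y; rewrite !ffunE; case: eqP => //; rewrite negbK.
Qed.

Lemma prod_nbr (F : 'I_n -> R) (x : 'I_n) :
  \prod_(y < n | a x y) F y =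
  (\prod_(y < n | a x y && (x < y)%N) F y) * \prod_(y < n | a y x && (y < x)%N) F y.
Proof.
rewrite (bigID (fun y : 'I_n => (x < y)%N)) /=; congr (_ * _).
apply: eq_bigl => y; rewrite sym; have [ayx|//] := boolP (a y x).
rewrite -leqNgt leq_eqVlt /=; case: eqP => //= /ord_inj yx.
by rewrite yx (negbTE (irr _)) in ayx.
Qed.

(** Occupying [x] costs [lam x] and one factor [c] for each occupied neighbour, which can be
    absorbed into the weights of the neighbours. *)
Lemma gas_weight_flip lam (x : 'I_n) sigma : sigma x = false ->
  gas_weight lam (flip x sigma) = lam x * gas_weight (lam_upto a c lam x n) sigma.
Proof.
move=> sx; rewrite /gas_weight mulrA.
have E1 : \prod_(y < n) (if flip x sigma y then lam y else 1) =
   lam x * \prod_(y < n) (if sigma y then lam y else 1).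
  rewrite (bigD1 x) //= [in RHS](bigD1 x) //= ffunE eqxx sx mul1r; congr (_ * _).
  by apply: eq_bigr => y yx; rewrite ffunE (negbTE yx).
have E2 : \prod_(y < n) (if sigma y then lam_upto a c lam x n y else 1) =
   \prod_(y < n) (if sigma y then lam y else 1) *
   \prod_(y < n | a x y) (if sigma y then c else 1).
  rewrite [X in _ * X]big_mkcond -big_split /=; apply: eq_bigr => y _.
  rewrite /lam_upto ltn_ord /= val_eqE; have [->|yx] := eqVneq y x.
    by rewrite sx (negbTE (irr _)) mulr1.
  by case: (a x y); case: (sigma y); rewrite ?mulr1.
have E3 : \prod_(u < n) \prod_(v < n | a u v && (u < v)%N)
     (if flip x sigma u && flip x sigma v then c else 1) =
   \prod_(u < n) \prod_(v < n | a u v && (u < v)%N)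
     ((if sigma u && sigma v then c else 1) *
      ((if (u == x) && sigma v then c else 1) * (if (v == x) && sigma u then c else 1))).
  apply: eq_bigr => u _; apply: eq_bigr => v /andP[auv ltuv]; rewrite !ffunE.
  have [ux|ux] := eqVneq u x; have [vx|vx] := eqVneq v x.
  - by rewrite ux vx ltnn in ltuv.
  - by rewrite ux sx /= mul1r mulr1.
  - by rewrite vx sx andbF andbT /= !mul1r.
  - by rewrite /= !mulr1.
rewrite E1 E2 E3 -!mulrA; congr (_ * (_ * _)).
under [LHS]eq_bigr do rewrite !big_split /=.
rewrite !big_split /= mulrC; congr (_ * _); rewrite prod_nbr; congr (_ * _).
  rewrite (bigD1 x) //= [X in _ * X]big1 ?mulr1.
    by apply: eq_bigr => v _; rewrite eqxx.
  by move=> u ux; apply: big1 => v _; rewrite (negbTE ux).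
rewrite [RHS]big_mkcond; apply: eq_bigr => u _; rewrite big_mkcond (bigD1 x) //=.
rewrite eqxx big1 ?mulr1 // => v vx; by rewrite (negbTE vx) if_same.
Qed.

Lemma gas_weight_zero lam (x : 'I_n) sigma : lam x = 0 -> sigma x ->
  gas_weight lam sigma = 0.
Proof. by move=> l0 sx; rewrite /gas_weight (bigD1 x) //= sx l0 !mul0r. Qed.

Lemma gas_weight_upto0 lam (x : 'I_n) sigma : sigma x = false ->
  gas_weight (lam_upto a c lam x 0) sigma = gas_weight lam sigma.
Proof.
move=> sx; congr (_ * _); apply: eq_bigr => y _; rewrite /lam_upto ltn0 /= val_eqE.
by have [->|//] := eqVneq y x; rewrite sx.
Qed.

Lemma gas_sum_split lam (x : 'I_n) :
  gas_sum lam = gas_sum (lam_upto a c lam x 0) + lam x * gas_sum (lam_upto a c lam x n).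
Proof.
have cancel_true i : gas_sum (lam_upto a c lam x i) =
   \sum_(sigma : config n | ~~ sigma x) gas_weight (lam_upto a c lam x i) sigma.
  rewrite /gas_sum (bigID (fun sigma : config n => ~~ sigma x)) /= addrC big1 ?add0r //.
  by move=> sigma; rewrite negbK; apply: gas_weight_zero; rewrite /lam_upto eqxx.
rewrite !cancel_true {1}/gas_sum (bigID (fun sigma : config n => ~~ sigma x)) /=.
congr (_ + _); first by apply: eq_bigr => sigma /negbTE sx; rewrite gas_weight_upto0.
rewrite mulr_sumr (reindex_inj (inv_inj (flipK x))) /=; apply: eq_big.
  by move=> sigma; rewrite ffunE eqxx negbK.
by move=> sigma; rewrite ffunE eqxx negbK => /negbTE; exact: gas_weight_flip.
Qed.

(** Partition function with [x] occupied over the one with [x] empty. Deleting [x] is encoded by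
    weight 0, so the vertex set never changes; the bounds [n] and 0 mean that all neighbours, or
    none, feel [x]. *)
Definition gas_ratio lam (x : nat) : R :=
  lam x * (gas_sum (lam_upto a c lam x n) / gas_sum (lam_upto a c lam x 0)).

Lemma gas_ratio_ge0 lam x : (forall z, 0 <= lam z) -> 0 <= gas_ratio lam x.
Proof.
move=> lam0; rewrite mulr_ge0 // divr_ge0 // ltW // gas_sum_gt0 //; exact: lam_upto_ge0.
Qed.

Lemma gas_sum_ratio lam (x : nat) : (forall z, 0 <= lam z) -> (x < n)%N ->
  gas_sum lam = gas_sum (lam_upto a c lam x 0) * (1 + gas_ratio lam x).
Proof.
move=> lam0 ltxn; rewrite (gas_sum_split lam (Ordinal ltxn)) /=.
rewrite mulrDr mulr1 /gas_ratio; congr (_ + _); rewrite mulrCA; congr (_ * _).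
by rewrite mulrC divfK // gt_eqF // gas_sum_gt0 //; exact: lam_upto_ge0.
Qed.

Lemma gas_ratioE lam (x : nat) : (forall z, 0 <= lam z) -> (x < n)%N ->
  gas_ratio lam x = lam x * \prod_(0 <= y < n | a x y)
     edge_factor c (gas_ratio (lam_upto a c lam x y) y).
Proof.
move=> lam0 ltxn; rewrite {1}/gas_ratio; congr (_ * _).
have upto_gt0 i : gas_sum (lam_upto a c lam x i) != 0.
  by rewrite gt_eqF // gas_sum_gt0 //; exact: lam_upto_ge0.
(* Telescoping between no neighbour and all neighbours feeling [x]. *)
transitivity (\prod_(0 <= y < n) (gas_sum (lam_upto a c lam x y.+1) / gas_sum (lam_upto a c lam x y))).
  by rewrite telescope_prodf ?(leq_ltn_trans _ ltxn).
rewrite [RHS]big_mkcond; apply: eq_big_nat => y /andP[_ ltyn].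
set mu := lam_upto a c lam x y.
have mu0 : forall z, 0 <= mu z by exact: lam_upto_ge0.
case: ifP => [axy|axy].
  have yx : y != x by apply: contraTneq axy => ->; exact: irr.
  (* Consecutive weights differ only at [y], so with [Z0] the sum without [y] and [r] its ratio, the
     quotient is [Z0 (1 + c r)] over [Z0 (1 + r)]. *)
  have -> : lam_upto a c lam x y.+1 = fun z => if z == y then mu y * c else mu z.
    apply/funext => z; rewrite /mu /lam_upto ltnS (leq_eqVlt z y).
    have [->|zy] //= := eqVneq z y; by rewrite (negbTE yx) axy ltnn.
  rewrite (gas_sum_split _ (Ordinal ltyn)) /= eqxx.
  have E i : lam_upto a c (fun z => if z == y then mu y * c else mu z) y i = lam_upto a c mu y i.
    by apply/funext => z; rewrite /lam_upto; case: (z == y).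
  rewrite !E (gas_sum_ratio mu0 ltyn) /edge_factor.
  have Z0 : gas_sum (lam_upto a c mu y 0) != 0.
    by rewrite gt_eqF // gas_sum_gt0 //; exact: lam_upto_ge0.
  have -> : mu y * c * gas_sum (lam_upto a c mu y n) =
      gas_sum (lam_upto a c mu y 0) * (c * gas_ratio mu y).
    by rewrite /gas_ratio; field.
  by rewrite -{1}[gas_sum _]mulr1 -mulrDr -mulf_div divff // mul1r.
have -> : lam_upto a c lam x y.+1 = mu; last by rewrite divff // upto_gt0.
apply/funext => z; rewrite /mu /lam_upto ltnS (leq_eqVlt z y).
by have [->|//] := eqVneq z y; rewrite axy !andbF.
Qed.

End LatticeGas.

(** * Calculus of relative errors *)

Section Approx.
Variable R : realType.
Implicit Types d e x y : R.

(** For positive numbers this is [|ln x - ln y| <= d]; the form without logarithm also makes sense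
    at 0, the ratio of a removed vertex. *)
Definition mult_close d x y := x <= expR d * y /\ y <= expR d * x.

Lemma mult_close_sym d x y : mult_close d x y -> mult_close d y x.
Proof. by case. Qed.

Lemma mult_close_refl d x : 0 <= d -> 0 <= x -> mult_close d x x.
Proof. by move=> d0 x0; split; rewrite ler_peMl // -expR0 ler_expR. Qed.

Lemma mult_close_trans d e x y z : mult_close d x y -> mult_close e y z -> mult_close (d + e) x z.
Proof.
move=> [xy yx] [yz zy]; split; rewrite expRD.
  by rewrite -mulrA; apply: le_trans xy _; rewrite ler_wpM2l // expR_ge0.
by rewrite [_ * expR e]mulrC -mulrA; apply: le_trans zy _; rewrite ler_wpM2l // expR_ge0.
Qed.

Lemma mult_close_weaken d e x y : 0 <= x -> 0 <= y -> d <= e -> mult_close d x y -> mult_close e x y.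
Proof.
move=> x0 y0 de [xy yx]; split.
  by apply: le_trans xy _; rewrite ler_wpM2r // ler_expR.
by apply: le_trans yx _; rewrite ler_wpM2r // ler_expR.
Qed.

Lemma mult_close_mul d e x y x' y' : 0 <= x -> 0 <= y -> 0 <= x' -> 0 <= y' ->
  mult_close d x y -> mult_close e x' y' -> mult_close (d + e) (x * x') (y * y').
Proof. by move=> x0 y0 x0' y0' [xy yx] [xy' yx']; split; rewrite expRD mulrACA ler_pM. Qed.

Lemma mult_close_inv d x y : 0 < x -> 0 < y -> mult_close d x y -> mult_close d x^-1 y^-1.
Proof.
move=> x0 y0 [xy yx]; split.
  by rewrite ler_pdivlMr // mulrC ler_pdivrMr // mulrC.
by rewrite ler_pdivlMr // mulrC ler_pdivrMr // mulrC.
Qed.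

Lemma mult_close_prod (I : Type) (r : seq I) (P : pred I) (F G d : I -> R) :
  (forall i, P i -> 0 <= F i) -> (forall i, P i -> 0 <= G i) ->
  (forall i, P i -> mult_close (d i) (F i) (G i)) ->
  mult_close (\sum_(i <- r | P i) d i) (\prod_(i <- r | P i) F i) (\prod_(i <- r | P i) G i).
Proof.
move=> F0 G0 FG.
suff [] : [/\ 0 <= \prod_(i <- r | P i) F i, 0 <= \prod_(i <- r | P i) G i &
  mult_close (\sum_(i <- r | P i) d i) (\prod_(i <- r | P i) F i) (\prod_(i <- r | P i) G i)] by [].
elim/big_rec3: _ => [|i z y x Pi [x0 y0 xy]].
  by split => //; exact: mult_close_refl.
by split; rewrite ?mulr_ge0 ?F0 ?G0 //; apply: mult_close_mul => //; [exact: F0|exact: G0|exact: FG].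
Qed.

Lemma mult_close_sum (I : Type) (r : seq I) (P : pred I) (F G : I -> R) d :
  (forall i, P i -> mult_close d (F i) (G i)) ->
  mult_close d (\sum_(i <- r | P i) F i) (\sum_(i <- r | P i) G i).
Proof.
move=> FG; split; rewrite mulr_sumr; apply: ler_sum => i Pi; by have [] := FG i Pi.
Qed.

Lemma mult_close_1D d x y : 0 <= d -> mult_close d x y -> mult_close d (1 + x) (1 + y).
Proof.
move=> d0 [xy yx]; have e1 : 1 <= expR d by rewrite -expR0 ler_expR.
by split; rewrite mulrDr mulr1 lerD.
Qed.

Lemma mult_close_div d e x y x' y' : 0 <= x -> 0 <= y -> 0 < x' -> 0 < y' ->
  mult_close d x y -> mult_close e x' y' -> mult_close (d + e) (x / x') (y / y').
Proof.
move=> x0 y0 x0' y0' xy xy'; apply: mult_close_mul; rewrite ?invr_ge0 ?(ltW x0') ?(ltW y0') //.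
exact: mult_close_inv.
Qed.

End Approx.

(** * Contraction of one recursion step *)

Section EdgeFactor.
Variables (R : realType) (c k : R).
Hypothesis k_ge0 : 0 <= k.
Hypothesis c_le : c <= expR k.
Hypothesis c_ge : expR (- k) <= c.
Local Notation f := (edge_factor c).
Implicit Types r s : R.

Let c_gt0 : 0 < c. Proof. exact: lt_le_trans (expR_gt0 _) c_ge. Qed.
Let e_ge1 : 1 <= expR k. Proof. by rewrite -expR0 ler_expR. Qed.
Let e_gt0 : 0 < expR k. Proof. exact: expR_gt0. Qed.
Let ce_ge1 : 1 <= c * expR k.
Proof. by rewrite -ler_pdivrMr // div1r -expRN. Qed.

Lemma edge_factor_gt0 r : 0 <= r -> 0 < f r.
Proof. by move=> r0; rewrite divr_gt0 // ltr_pwDl // mulr_ge0 // ltW. Qed.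

(** The edge factor is a weighted mean of 1 and [c]. *)
Lemma mult_close_edge_factor r : 0 <= r -> mult_close k (f r) 1.
Proof.
move=> r0; have r1 : 0 < 1 + r by rewrite ltr_pwDl.
have cr : c * r <= expR k * r by rewrite ler_wpM2r.
have ecr : r <= expR k * (c * r) by rewrite mulrA ler_peMl // mulrC.
split; rewrite /edge_factor.
  by rewrite mulr1 ler_pdivrMr // mulrDr mulr1 lerD.
by rewrite mulrA ler_pdivlMr // mul1r mulrDr mulr1 lerD.
Qed.

(** A derivative-free Lipschitz bound in logarithmic scale. For [c >= 1], [f r / f s - 1] equals
    [(c - 1) (r - s)] over [(1 + r) (1 + c s)], and [r - s <= d r]; this explains the mixed
    denominators. For [c <= 1] the quotient is inverted. *)
Lemma edge_factor_lipschitz d eta r s : 0 <= s <= r -> 0 <= d -> 0 <= eta ->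
  mult_close d r s ->
  (1 <= c -> (c - 1) * r <= eta * ((1 + r) * (1 + c * s))) ->
  (c <= 1 -> (1 - c) * r <= eta * ((1 + c * r) * (1 + s))) ->
  mult_close (eta * d) (f r) (f s).
Proof.
move=> /andP[s0 sr] d0 eta0 [rs _] H1 H2; have r0 := le_trans s0 sr.
have r1 : 0 < 1 + r by rewrite ltr_pwDl.
have s1 : 0 < 1 + s by rewrite ltr_pwDl.
have cr1 : 0 < 1 + c * r by rewrite ltr_pwDl // mulr_ge0 // ltW.
have cs1 : 0 < 1 + c * s by rewrite ltr_pwDl // mulr_ge0 // ltW.
have ed1 : 1 <= expR (eta * d) by rewrite -expR0 ler_expR mulr_ge0.
have rsd : r - s <= d * r.
  have : expR (- d) * r <= s by rewrite expRN mulrC ler_pdivrMr ?expR_gt0 // mulrC.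
  have : (1 - d) * r <= expR (- d) * r by rewrite ler_wpM2r // expR_ge1Dx.
  by move=> *; nra.
have [c1|/ltW c1] := leP 1 c.
- split.
    have u : (1 + c * r) * (1 + s) <= (1 + eta * d) * ((1 + c * s) * (1 + r)).
      have : (c - 1) * (r - s) <= (c - 1) * (d * r) by rewrite ler_wpM2l // subr_ge0.
      have := H1 c1; move=> h1; have := ler_wpM2l d0 h1; nra.
    rewrite /edge_factor ler_pdivrMr // mulrA mulrAC ler_pdivlMr //.
    apply: le_trans u _; rewrite -mulrA ler_wpM2r //; first by rewrite mulr_ge0 // ltW.
    exact: expR_ge1Dx.
  apply: (@le_trans _ _ (f r)); last by rewrite ler_peMl // ltW // edge_factor_gt0.
  rewrite /edge_factor ler_pdivrMr // mulrAC ler_pdivlMr //.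
  have : 0 <= (c - 1) * (r - s) by rewrite mulr_ge0 // subr_ge0.
  nra.
- split; last first.
    have u : (1 + c * s) * (1 + r) <= (1 + eta * d) * ((1 + c * r) * (1 + s)).
      have : (1 - c) * (r - s) <= (1 - c) * (d * r) by rewrite ler_wpM2l // subr_ge0.
      have := H2 c1; move=> h1; have := ler_wpM2l d0 h1; nra.
    rewrite /edge_factor ler_pdivrMr // mulrA mulrAC ler_pdivlMr //.
    apply: le_trans u _; rewrite -mulrA ler_wpM2r //; first by rewrite mulr_ge0 // ltW.
    exact: expR_ge1Dx.
  apply: (@le_trans _ _ (f s)); last by rewrite ler_peMl // ltW // edge_factor_gt0.
  rewrite /edge_factor ler_pdivrMr // mulrAC ler_pdivlMr //.
  have : 0 <= (1 - c) * (r - s) by rewrite mulr_ge0 // subr_ge0.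
  nra.
Qed.

Lemma mult_close_edge_factor2 d r s : 0 <= r -> 0 <= s -> 0 <= d -> mult_close d r s ->
  mult_close (expR k * d) (f r) (f s).
Proof.
wlog sr : r s / s <= r => [H r0 s0 d0 rs|r0 s0 d0 rs].
  have [sr|/ltW sr] := leP s r; first exact: H.
  by apply: mult_close_sym; apply: H => //; exact: mult_close_sym.
have cr0 : 0 <= c * r by rewrite mulr_ge0 // ltW.
have cs0 : 0 <= c * s by rewrite mulr_ge0 // ltW.
have rcs : 0 <= r * (c * s) by rewrite mulr_ge0.
apply: edge_factor_lipschitz => //; rewrite ?s0 ?sr ?expR_ge0 // => c1.
  have : (c - 1) * r <= expR k * r by rewrite ler_wpM2r //; have := c_le; lra.
  have : expR k * r <= expR k * ((1 + r) * (1 + c * s)) by rewrite ler_wpM2l ?expR_ge0 //; lra.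
  lra.
have : expR k * (c * r) <= expR k * ((1 + c * r) * (1 + s)) by rewrite ler_wpM2l ?expR_ge0 //; lra.
have : 1 * r <= c * expR k * r by rewrite ler_wpM2r.
lra.
Qed.

(** The edge factor is nearly constant near 0, where it tends to 1, and near infinity, where it
    tends to [c]. Both ratios have to be on the same side. *)
Lemma mult_close_edge_factor2_far A d r s : 0 < A -> 0 <= r -> 0 <= s -> 0 <= d ->
  mult_close d r s -> (A <= r /\ A <= s) \/ (r <= A^-1 /\ s <= A^-1) ->
  mult_close (expR k / A * d) (f r) (f s).
Proof.
move=> A0; wlog sr : r s / s <= r => [H r0 s0 d0 rs far|r0 s0 d0 rs far].
  have [sr|/ltW sr] := leP s r; first exact: H.
  apply: mult_close_sym; apply: H => //; first exact: mult_close_sym.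
  by case: far => -[]; [left|right].
have cr0 : 0 <= c * r by rewrite mulr_ge0 // ltW.
have cs0 : 0 <= c * s by rewrite mulr_ge0 // ltW.
have far' : r <= A^-1 * (r * s) \/ r <= A^-1.
  case: far => [[_ As]|[rA _]]; [left|by right].
  by rewrite mulrC ler_pdivlMr // ler_wpM2l.
(* One inequality that covers both the large and the small case, so that the rest needs no case
   analysis on the side. *)
have far2 : r <= A^-1 * (1 + r * s).
  have Ai : 0 <= A^-1 by rewrite invr_ge0 ltW.
  have : 0 <= A^-1 * (r * s) by rewrite !mulr_ge0.
  by rewrite mulrDr mulr1; case: far' => ? ?; lra.
set B := A^-1 in far2 *; have B0 : 0 <= B by rewrite invr_ge0 ltW.
have eB : 0 <= expR k * B by rewrite mulr_ge0 ?expR_ge0.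
apply: edge_factor_lipschitz => //; rewrite ?s0 ?sr // => c1.
- have h : c * r <= c * (B * (1 + r * s)) by rewrite ler_wpM2l // ltW.
  have h2 : c * (B * (1 + r * s)) <= expR k * B + B * (c * (r * s)).
    have : c * B <= expR k * B by rewrite ler_wpM2r.
    lra.
  have h3 : B * (c * (r * s)) <= expR k * B * (r * (c * s)).
    have : 0 <= B * (r * (c * s)) by rewrite !mulr_ge0 // ltW.
    move=> q; have : 1 * (B * (r * (c * s))) <= expR k * (B * (r * (c * s))) by rewrite ler_wpM2r.
    lra.
  have h4 : 0 <= expR k * B * (r + c * s) by rewrite mulr_ge0 // addr_ge0.
  lra.
- have h2 : B * (r * s) <= expR k * B * (c * r * s).
    have q : 0 <= B * (r * s) by rewrite !mulr_ge0.
    have : 1 * (B * (r * s)) <= c * expR k * (B * (r * s)) by rewrite ler_wpM2r.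
    lra.
  have h3 : B <= expR k * B by rewrite ler_peMl.
  have h4 : 0 <= expR k * B * (s + c * r) by rewrite mulr_ge0 // addr_ge0.
  have : 0 <= c * r by [].
  lra.
Qed.

End EdgeFactor.

(** * Correlation decay along self-avoiding paths *)

Section CorrelationDecay.
Variables (R : realType) (n : nat) (a : rel nat) (c k : R) (D : nat).
Hypothesis irr : forall y, ~~ a y y.
Hypothesis sym : symmetric a.
Hypothesis degree : forall y, (count (a y) (iota 0 n) <= D)%N.
Hypothesis k_ge0 : 0 <= k.
Hypothesis c_le : c <= expR k.
Hypothesis c_ge : expR (- k) <= c.
Implicit Types (lam : nat -> R) (m x y : nat) (p : seq nat).

Local Notation f := (edge_factor c).
Local Notation upto := (lam_upto a c).
Local Notation ratio := (gas_ratio n a c).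
Local Notation trunc := (trunc_ratio n a c).

Let c_gt0 : 0 < c. Proof. exact: lt_le_trans (expR_gt0 _) c_ge. Qed.

Lemma trunc_ratio_ge0 m lam x : (forall z, 0 <= lam z) -> 0 <= trunc m lam x.
Proof.
elim: m lam x => [|m IHm] lam x lam0 //=; rewrite mulr_ge0 //.
apply: prodr_ge0 => y _; apply: ltW; apply: edge_factor_gt0 c_ge _ _.
by apply: IHm; apply: lam_upto_ge0.
Qed.

Lemma mult_close_prod_edge_factor x (r : nat -> R) : (forall y, 0 <= r y) ->
  mult_close (k * D%:R) (\prod_(0 <= y < n | a x y) f (r y)) 1.
Proof.
move=> r0; apply: (@mult_close_weaken _ (\sum_(0 <= y < n | a x y) k)).
- by apply: prodr_ge0 => y _; apply: ltW; apply: edge_factor_gt0 c_ge _ _.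
- by [].
- rewrite big_const_seq iter_addr addr0 -[k *+ _]mulr_natr ler_wpM2l // ler_nat.
  by rewrite -[index_iota 0 n]/(iota 0 (n - 0)) subn0.
- have E : \prod_(0 <= y < n | a x y) 1 = 1 :> R by rewrite big1.
  rewrite -[X in mult_close _ _ X]E; apply: mult_close_prod => y _ //.
    by apply: ltW; apply: edge_factor_gt0 c_ge _ _.
  exact: mult_close_edge_factor.
Qed.

Lemma mult_close_trunc_ratio m lam x : (forall z, 0 <= lam z) ->
  mult_close (k * D%:R) (trunc m lam x) (lam x).
Proof.
have kD : 0 <= k * D%:R by rewrite mulr_ge0.
case: m => [|m] lam0 /=; first exact: mult_close_refl.
rewrite -[X in mult_close _ _ X]mulr1 -[k * _]add0r.
apply: mult_close_mul => //.
- apply: prodr_ge0 => y _; apply: ltW; apply: edge_factor_gt0 c_ge _ _.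
  by apply: trunc_ratio_ge0; exact: lam_upto_ge0.
- exact: mult_close_refl.
- by apply: mult_close_prod_edge_factor => y; apply: trunc_ratio_ge0; exact: lam_upto_ge0.
Qed.

Lemma mult_close_gas_ratio lam x : (forall z, 0 <= lam z) -> (x < n)%N ->
  mult_close (k * D%:R) (ratio lam x) (lam x).
Proof.
move=> lam0 xn; rewrite gas_ratioE // -[X in mult_close _ _ X]mulr1 -[k * _]add0r.
have r0 y : 0 <= ratio (upto lam x y) y by apply: gas_ratio_ge0 => //; exact: lam_upto_ge0.
apply: mult_close_mul => //; [|exact: mult_close_refl|exact: mult_close_prod_edge_factor].
by apply: prodr_ge0 => y _; apply: ltW; apply: edge_factor_gt0 c_ge _ _.
Qed.

Variables (lam0 : nat -> R) (A : R).
Hypothesis lam0_ge0 : forall z, 0 <= lam0 z.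
Hypothesis A_gt0 : 0 < A.

Definition zero_nbrs lam z := count (fun u => a z u && (lam u == 0)) (iota 0 n).

(* The weights reachable from [lam0] by fixing spins: a fixed vertex has weight
   [0], and each of its neighbours has been multiplied by [c] at most once. *)
Definition reachable lam := (forall z, 0 <= lam z) /\
  forall z, lam z = 0 \/ exists2 j, (j <= zero_nbrs lam z)%N & lam z = lam0 z * c ^+ j.

Lemma reachable_start : reachable lam0.
Proof. by split=> // z; right; exists 0%N; rewrite ?mulr1. Qed.

Lemma reachable_upto lam x i : (x < n)%N -> lam x != 0 ->
  reachable lam -> reachable (upto lam x i).
Proof.
move=> xn lx [l0 lE]; split=> [|z]; first exact: lam_upto_ge0.
have sub : subpred (fun u => a z u && (lam u == 0)) (fun u => a z u && (upto lam x i u == 0)).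
  move=> u /andP[-> /eqP lu]; rewrite /lam_upto lu mul0r.
  by rewrite !if_same eqxx.
have le_nbrs : (zero_nbrs lam z <= zero_nbrs (upto lam x i) z)%N by exact: sub_count.
rewrite {1 3}/lam_upto; have [zx|zx] := eqVneq z x; first by left.
case: (lE z) => [->|[j jn lz]]; first by left; rewrite mul0r if_same.
right; case: ifP => [/andP[_ axz]|_]; last by exists j => //; exact: leq_trans le_nbrs.
exists j.+1; last by rewrite lz exprSr mulrA.
apply: leq_ltn_trans jn _; rewrite /zero_nbrs.
have count_x : count (pred1 x) (iota 0 n) = 1%N.
  by rewrite count_uniq_mem ?iota_uniq // mem_iota add0n xn.
rewrite -addn1 -count_x -count_predUI.
rewrite (@eq_count _ (predI _ _) pred0) ?count_pred0 ?addn0; last first.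
  by move=> u /=; have [->|] := eqVneq u x; rewrite ?(negbTE lx) ?andbF.
apply: sub_count => u /orP[|/eqP ->]; first exact: sub.
by rewrite sym axz /lam_upto !eqxx.
Qed.

Lemma mult_close_exprn j : mult_close (k * j%:R) (c ^+ j) 1.
Proof.
elim: j => [|j IHj]; first by rewrite mulr0 expr0; exact: mult_close_refl.
rewrite exprS mulrS mulrDr mulr1 -[X in mult_close _ _ X]mulr1.
apply: mult_close_mul => //; rewrite ?exprn_ge0 ?(ltW c_gt0) //.
split; first by rewrite mulr1.
by rewrite mulrC -ler_pdivrMr ?expR_gt0 // div1r -expRN.
Qed.

Lemma reachable_close lam z : reachable lam -> lam z != 0 ->
  mult_close (k * D%:R) (lam z) (lam0 z).
Proof.
move=> [l0 lE] lz; case: (lE z) => [E|[j jn E]]; first by rewrite E eqxx in lz.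
apply: (@mult_close_weaken _ (0 + k * j%:R)) => //.
  rewrite add0r ler_wpM2l // ler_nat; apply: leq_trans jn _.
  by apply: leq_trans (degree z); apply: sub_count => u /andP[].
rewrite E -[X in mult_close _ _ X]mulr1; apply: mult_close_mul => //.
- by rewrite exprn_ge0 // ltW.
- exact: mult_close_refl.
- exact: mult_close_exprn.
Qed.

(** The margin is twice [k * D]: once for the removed neighbours that have shifted the weight, once
    for the distance from a weight to its ratio. *)
Definition far_vertex z :=
  (expR (2 * (k * D%:R)) * A <= lam0 z) || (expR (2 * (k * D%:R)) * lam0 z <= A^-1).

Lemma far_of_close z r s : far_vertex z ->
  mult_close (2 * (k * D%:R)) r (lam0 z) -> mult_close (2 * (k * D%:R)) s (lam0 z) ->
  (A <= r /\ A <= s) \/ (r <= A^-1 /\ s <= A^-1).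
Proof.
move=> /orP[h|h] [r1 r2] [s1 s2]; [left|right].
  by split; [have := le_trans h r2|have := le_trans h s2]; rewrite ler_pM2l // expR_gt0.
by split; [exact: le_trans r1 h|exact: le_trans s1 h].
Qed.

Definition decay_factor z : R := if far_vertex z then expR k / A else expR k.

Lemma decay_factor_ge0 z : 0 <= decay_factor z.
Proof. by rewrite /decay_factor; case: ifP; rewrite ?divr_ge0 ?expR_ge0 // ltW. Qed.

(** A sum over self-avoiding paths with exactly [m] steps from [x] that avoid the history [p]; the
    starting vertex carries no factor. *)
Fixpoint path_sum (kappa : nat -> R) m p x : R :=
  if m is m'.+1 then
    \sum_(0 <= y < n | a x y && (y \notin x :: p)) kappa y * path_sum kappa m' (x :: p) y
  else 1.

Lemma path_sum_ge0 kappa m p x : (forall z, 0 <= kappa z) -> 0 <= path_sum kappa m p x.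
Proof.
move=> k0; elim: m p x => [|m IHm] p x //=.
by apply: sumr_ge0 => y _; rewrite mulr_ge0.
Qed.

Lemma trunc_ratio_zero m lam x : lam x = 0 -> trunc m lam x = 0.
Proof. by case: m => [|m] //= ->; rewrite mul0r. Qed.

(** At depth 0 the error is [k * D], the distance from a weight to its ratio. On the way up each
    vertex scales it by its decay factor. At a visited vertex both ratios are 0 and no error arises,
    so only self-avoiding paths remain. *)
Lemma trunc_ratio_close m lam p x : reachable lam -> (x < n)%N ->
  (forall z, z \in p -> lam z = 0) ->
  mult_close (k * D%:R * path_sum decay_factor m p x) (trunc m lam x) (ratio lam x).
Proof.
have kD : 0 <= k * D%:R by rewrite mulr_ge0.
have ps0 m' p' x' : 0 <= path_sum decay_factor m' p' x'.
  exact/path_sum_ge0/decay_factor_ge0.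
elim: m lam p x => [|m IHm] lam p x hl xn lp.
  rewrite /= mulr1; apply: mult_close_sym; apply: mult_close_gas_ratio => //; exact: hl.1.
have l0 := hl.1.
have [lx|lx] := eqVneq (lam x) 0.
  rewrite trunc_ratio_zero // /gas_ratio lx mul0r; apply: mult_close_refl => //.
  by rewrite mulr_ge0.
rewrite gas_ratioE //= mulr_sumr -[X in mult_close X _ _]add0r.
have up0 y : forall z, 0 <= upto lam x y z by exact: lam_upto_ge0.
have fr0 y : 0 <= f (ratio (upto lam x y) y).
  by apply: ltW; apply: edge_factor_gt0 c_ge _ _; apply: gas_ratio_ge0.
have ft0 y : 0 <= f (trunc m (upto lam x y) y).
  by apply: ltW; apply: edge_factor_gt0 c_ge _ _; apply: trunc_ratio_ge0.
apply: mult_close_mul => //; last 1 first.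
  (* Visited neighbours reappear in the error sum with the term 0, so that it matches products over
     all neighbours. *)
  rewrite big_mkcondr /= big_seq_cond [X in mult_close _ X _]big_seq_cond.
  rewrite [X in mult_close _ _ X]big_seq_cond.
  apply: mult_close_prod => y // /andP[]; rewrite mem_index_iota /= => yn axy.
  have d0 : 0 <= k * D%:R * path_sum decay_factor m (x :: p) y by rewrite mulr_ge0.
  have upto_p z : z \in x :: p -> upto lam x y z = 0.
    by rewrite inE /lam_upto; case: eqP => //= _ /lp ->; rewrite mul0r if_same.
  have zero_case d : 0 <= d -> upto lam x y y = 0 ->
      mult_close d (f (trunc m (upto lam x y) y)) (f (ratio (upto lam x y) y)).
    move=> dge u0; have -> : ratio (upto lam x y) y = 0 by rewrite /gas_ratio u0 mul0r.
    rewrite trunc_ratio_zero //; apply: mult_close_refl => //.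
    by apply: ltW; apply: edge_factor_gt0 c_ge _ _.
  case: ifP => yp; last by apply: zero_case => //; apply: upto_p; move/negbFE: yp.
  have [u0|u0] := eqVneq (upto lam x y y) 0.
    by apply: zero_case => //; rewrite mulr_ge0 // mulr_ge0 // decay_factor_ge0.
  have hu := reachable_upto y xn lx hl.
  have IH := IHm _ _ _ hu yn upto_p.
  rewrite mulrCA /decay_factor; case: ifP => far; last first.
    by apply: mult_close_edge_factor2 => //; [exact: trunc_ratio_ge0|exact: gas_ratio_ge0].
  apply: mult_close_edge_factor2_far => //; [exact: trunc_ratio_ge0|exact: gas_ratio_ge0|].
  have close_lam0 r : mult_close (k * D%:R) r (upto lam x y y) ->
      mult_close (2 * (k * D%:R)) r (lam0 y).
    move=> h; rewrite mulrDl mul1r; apply: mult_close_trans h _.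
    exact: reachable_close.
  apply: far_of_close far _ _; apply: close_lam0; last exact: mult_close_gas_ratio.
  exact: mult_close_trunc_ratio.
- by apply: prodr_ge0.
- by apply: prodr_ge0.
- exact: mult_close_refl.
Qed.

End CorrelationDecay.

(** * Self-reduction: fixing the spins one by one *)

Section ChainRule.
Variables (R : realType) (n : nat) (a : rel nat) (c : R).
Hypothesis irr : forall y, ~~ a y y.
Hypothesis sym : symmetric a.
Hypothesis c_gt0 : 0 < c.
Variable lam : nat -> R.
Hypothesis lam_gt0 : forall z, (z < n)%N -> 0 < lam z.
Hypothesis lam_out : forall z, (n <= z)%N -> lam z = 0.
Implicit Type s : nat -> bool.

Local Notation upto := (lam_upto a c).
Local Notation Z := (gas_sum n a c).

Lemma lam_ge0 z : 0 <= lam z.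
Proof. by have [/lam_gt0/ltW//|/lam_out->] := ltnP z n. Qed.

Lemma pinned_ge0 s x z : 0 <= pinned a c lam s x z.
Proof.
rewrite /pinned; case: ifP => // _; rewrite mulr_ge0 ?lam_ge0 //.
by apply: prodr_ge0 => u _; exact: ltW.
Qed.

Lemma pinned_gt0 s x : (x < n)%N -> 0 < pinned a c lam s x x.
Proof.
by move=> xn; rewrite /pinned ltnn mulr_gt0 ?lam_gt0 // prodr_gt0.
Qed.

Lemma pinned0 s : pinned a c lam s 0 = lam.
Proof. by apply/funext => z; rewrite /pinned ltn0 big_geq // mulr1. Qed.

(** Fixing a spin is the same move as removing a vertex in the recursion, with all neighbours or
    none feeling it. Hence pinned weights are reachable and the decay estimate applies to them. *)
Lemma pinned_step s x :
  pinned a c lam s x.+1 = upto (pinned a c lam s x) x (if s x then n else 0%N).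
Proof.
apply/funext => z; rewrite pinnedS // /lam_upto; case: eqP => // _.
have [sx|sx] := boolP (s x); last by rewrite ltn0 andbF.
rewrite andbT; have [//|nz] := ltnP z n.
by rewrite /pinned lam_out // !mul0r !if_same mul0r if_same.
Qed.

Lemma reachable_pinned k s x : expR (- k) <= c -> (x <= n)%N -> reachable n a c lam (pinned a c lam s x).
Proof.
move=> c_ge; elim: x => [|x IHx] xn.
  by rewrite pinned0; apply: reachable_start; exact: lam_ge0.
rewrite pinned_step; apply: (reachable_upto sym c_ge) => //; last exact/IHx/ltnW.
by rewrite gt_eqF // pinned_gt0.
Qed.

Definition spin_prob (r : R) (b : bool) : R := (if b then r else 1) / (1 + r).

Lemma gas_sum_pinned s x : (x < n)%N ->
  (if s x then pinned a c lam s x x else 1) * (Z (pinned a c lam s x.+1) / Z (pinned a c lam s x)) =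
  spin_prob (gas_ratio n a c (pinned a c lam s x) x) (s x).
Proof.
move=> xn; set l := pinned a c lam s x.
have l0 : forall z, 0 <= l z by exact: pinned_ge0.
have r0 := @gas_ratio_ge0 R n a c c_gt0 l x l0.
have Z0 : 0 < Z (upto l x 0) by apply: gas_sum_gt0 => //; exact: lam_upto_ge0.
rewrite (gas_sum_ratio irr sym c_gt0 l0 xn) pinned_step -/l /spin_prob.
have r1 : 1 + gas_ratio n a c l x != 0 by rewrite gt_eqF // ltr_pwDl.
case: (s x); last by rewrite mul1r invfM mulrA divff ?gt_eqF.
by rewrite invfM !mulrA -[X in X / _]mulrA.
Qed.

Lemma gas_sum_pinned_end s : Z (pinned a c lam s n) = 1.
Proof.
rewrite /gas_sum (bigD1 [ffun=> false]) //= [X in _ + X]big1 ?addr0.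
  rewrite /gas_weight !big1 ?mulr1 // => x _; first by rewrite big1 // => y _; rewrite ffunE.
  by rewrite ffunE.
move=> sigma; case: (pickP (fun x => sigma x)) => [x sx _|s0].
  by apply: (@gas_weight_zero _ _ _ _ _ x) => //; rewrite /pinned ltn_ord.
by move/eqP => []; apply/ffunP => x; rewrite ffunE s0.
Qed.

(** Each edge is charged to its larger endpoint, at whose turn the spin of the smaller one has
    already been absorbed into the weight. *)
Lemma gas_weight_pinned s :
  gas_weight a c lam [ffun x : 'I_n => s x] =
  \prod_(0 <= x < n) (if s x then pinned a c lam s x x else 1).
Proof.
rewrite big_mkord /gas_weight.
have -> : \prod_(x < n) \prod_(y < n | a x y && (x < y)%N)
     (if [ffun x : 'I_n => s x] x && [ffun x : 'I_n => s x] y then c else 1) =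
   \prod_(y < n) \prod_(x < n | a x y && (x < y)%N) (if s x && s y then c else 1).
  rewrite (exchange_big_dep xpredT) //=; apply: eq_bigr => y _.
  by apply: eq_bigr => x _; rewrite !ffunE.
rewrite -big_split /=; apply: eq_bigr => x _; rewrite ffunE.
case: (s x); last by rewrite mul1r big1 // => y _; rewrite andbF.
rewrite /pinned ltnn; congr (_ * _).
rewrite (big_nat_widen _ _ n) ?big_mkord; last exact: ltnW.
rewrite big_mkcond [RHS]big_mkcond; apply: eq_bigr => y _; rewrite andbT.
by case: (a y x); case: (y < x)%N; case: (s y).
Qed.

Lemma gas_chain_rule s :
  gas_weight a c lam [ffun x : 'I_n => s x] / Z lam =
  \prod_(0 <= x < n) spin_prob (gas_ratio n a c (pinned a c lam s x) x) (s x).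
Proof.
have Zp x : Z (pinned a c lam s x) != 0.
  by rewrite gt_eqF // gas_sum_gt0 //; exact: pinned_ge0.
transitivity (\prod_(0 <= x < n) ((if s x then pinned a c lam s x x else 1) *
     (Z (pinned a c lam s x.+1) / Z (pinned a c lam s x)))); last first.
  by apply: eq_big_nat => x /andP[_ xn]; exact: gas_sum_pinned.
rewrite big_split /= -gas_weight_pinned; congr (_ * _).
have [n0|n0] := posnP n; first by rewrite n0 big_geq // -(pinned0 s) -n0 gas_sum_pinned_end invr1.
by rewrite telescope_prodf // gas_sum_pinned_end pinned0 mul1r.
Qed.

End ChainRule.

(** * From spins to occupation numbers *)

Section SpinWeights.
Variables (R : realType) (n : nat) (a : rel nat).
Hypothesis irr : forall y, ~~ a y y.
Hypothesis sym : symmetric a.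
Implicit Types (b : R) (e : nat -> R) (sigma : config n).

(** [b] and [e x] stand for [exp beta] and [exp h_x], exact or approximated, so that one formula
    covers the true model and the computed one. *)
Definition spin_weight b e sigma : R :=
  \prod_(x < n) \prod_(y < n | a x y && (x < y)%N) (if sigma x == sigma y then b else b^-1) *
  \prod_(x < n) (if sigma x then e x else (e x)^-1).

(** With [s = 2 t - 1] one has [s s' = 4 t t' - 2 t - 2 t' + 1]: an edge gives one [b] to the
    prefactor, [b ^ -2] to the weight of each endpoint and [b ^ 4] to the interaction. *)
Lemma spin_weight_gas b e sigma : 0 < b -> (forall x, 0 < e x) ->
  spin_weight b e sigma =
  \prod_(0 <= x < n) ((e x)^-1 * \prod_(0 <= y < n | a x y && (x < y)%N) b) *
  gas_weight a (b ^+ 4)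
    (fun x => if (x < n)%N then e x ^+ 2 * \prod_(0 <= y < n | a x y) (b ^+ 2)^-1 else 0) sigma.
Proof.
move=> b0 e0; have bn0 : b != 0 by rewrite gt_eqF.
pose g (x : 'I_n) : R := if sigma x then (b ^+ 2)^-1 else 1.
rewrite /spin_weight /gas_weight big_mkord.
have E1 : \prod_(x < n) \prod_(y < n | a x y && (x < y)%N) (if sigma x == sigma y then b else b^-1) =
   \prod_(x < n) \prod_(y < n | a x y && (x < y)%N) b *
   (\prod_(x < n) \prod_(y < n | a x y) g x) *
   \prod_(x < n) \prod_(y < n | a x y && (x < y)%N) (if sigma x && sigma y then b ^+ 4 else 1).
  have -> : \prod_(x < n) \prod_(y < n | a x y) g x =
     \prod_(x < n) \prod_(y < n | a x y && (x < y)%N) (g x * g y).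
    under [RHS]eq_bigr do rewrite big_split /=.
    under [LHS]eq_bigr do rewrite (prod_nbr irr sym).
    rewrite !big_split /=; congr (_ * _).
    by rewrite (exchange_big_dep xpredT).
  rewrite -!big_split /=; apply: eq_bigr => x _; rewrite -!big_split /=; apply: eq_bigr => y _.
  by rewrite /g; case: (sigma x); case: (sigma y) => /=; field.
have E2 : \prod_(x < n) (if sigma x then e x else (e x)^-1) =
   \prod_(x < n) (e x)^-1 * \prod_(x < n) (if sigma x then e x ^+ 2 else 1).
  rewrite -big_split; apply: eq_bigr => x _; case: (sigma x) => /=; last by rewrite mulr1.
  by have := e0 x; rewrite lt0r => /andP[ex _]; field.
rewrite E1 E2 big_split /=.
have -> : \prod_(x < n) \prod_(0 <= y < n | a x y && (x < y)%N) b =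
    \prod_(x < n) \prod_(y < n | a x y && (x < y)%N) b.
  by apply: eq_bigr => x _; rewrite big_mkord.
have -> : \prod_(x < n) (if sigma x then
      if (x < n)%N then e x ^+ 2 * \prod_(0 <= y < n | a x y) (b ^+ 2)^-1 else 0 else 1) =
    \prod_(x < n) (if sigma x then e x ^+ 2 else 1) * \prod_(x < n) \prod_(y < n | a x y) g x.
  rewrite -big_split; apply: eq_bigr => x _; rewrite ltn_ord big_mkord /g /=.
  by case: (sigma x) => //; rewrite big1 ?mulr1.
by ring.
Qed.

Lemma spin_weight_close b b' e e' d sigma : 0 <= d ->
  0 < b -> 0 < b' -> (forall x : 'I_n, 0 < e x) -> (forall x : 'I_n, 0 < e' x) ->
  mult_close d b b' -> (forall x : 'I_n, mult_close d (e x) (e' x)) ->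
  mult_close ((n * n + n)%:R * d) (spin_weight b e sigma) (spin_weight b' e' sigma).
Proof.
move=> d0 b0 b0' e0 e0' bb ee; rewrite natrD mulrDl.
have if_ge0 (t : bool) (u v : R) : 0 < u -> 0 < v -> 0 <= (if t then u else v).
  by case: t => u0 v0; apply: ltW.
apply: mult_close_mul; do ?[by apply: prodr_ge0 => *; apply: prodr_ge0 => *; apply: if_ge0; rewrite ?invr_gt0 |
   by apply: prodr_ge0 => *; apply: if_ge0; rewrite ?invr_gt0].
- apply: (@mult_close_weaken _ (\sum_(x < n) \sum_(y < n | a x y && (x < y)%N) d)).
  + by apply: prodr_ge0 => *; apply: prodr_ge0 => *; apply: if_ge0; rewrite ?invr_gt0.
  + by apply: prodr_ge0 => *; apply: prodr_ge0 => *; apply: if_ge0; rewrite ?invr_gt0.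
  + apply: (@le_trans _ _ (\sum_(x < n) \sum_(y < n) d)).
      by apply: ler_sum => x _; rewrite [leRHS](bigID (fun y : 'I_n => a x y && (x < y)%N)) /= lerDl sumr_ge0.
    by rewrite !sumr_const !card_ord -!mulrnA mulr_natl.
  apply: mult_close_prod => x _; do ?[by apply: prodr_ge0 => *; apply: if_ge0; rewrite ?invr_gt0].
  apply: mult_close_prod => y _; do ?[by apply: if_ge0; rewrite ?invr_gt0].
  by case: (_ == _) => //; exact: mult_close_inv.
- have -> : n%:R * d = \sum_(x < n) d by rewrite sumr_const card_ord mulr_natl.
  apply: mult_close_prod => x _; do ?[by apply: if_ge0; rewrite ?invr_gt0].
  by case: (sigma x) => //; exact: mult_close_inv.
Qed.

End SpinWeights.

(** * Law of the coin tosses *)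

Section CoinLaw.
Variable R : realType.
Implicit Types (t : nat -> bool) (P Q : (nat -> bool) -> bool) (p r : R).

Definition tape_cons (b : bool) t : nat -> bool := fun i => if i is j.+1 then t j else b.

(** Recursion on the first coin, suited to induction. Beyond [T] the tape is continued by [false],
    in agreement with [bits]. *)
Fixpoint coin_prob T P : R :=
  if T is T'.+1 then
    (coin_prob T' (P \o tape_cons true) + coin_prob T' (P \o tape_cons false)) / 2
  else (P xpred0)%:R.

Lemma eq_coin_prob T P Q : P =1 Q -> coin_prob T P = coin_prob T Q.
Proof. by move=> /funext ->. Qed.

Lemma card_coin_prob T P :
  #|[pred w : T.-tuple bool | P (bits w)]|%:R / 2 ^+ T = coin_prob T P.
Proof.
have cardE S (A : pred (S.-tuple bool)) : #|A|%:R = \sum_(w : S.-tuple bool) (A w)%:R :> R.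
  by rewrite -sum1_card natr_sum [RHS]big_mkcond [LHS]big_mkcond; apply: eq_bigr => w _; rewrite unfold_in; case: (A w).
elim: T P => [|T IHT] P /=.
  rewrite divr1 cardE (big_pred1 [tuple]) /=; last by move=> w; apply/esym/eqP; rewrite [w]tuple0; apply: val_inj.
  by congr ((P _)%:R); apply/funext => i; rewrite /bits nth_nil.
rewrite -!IHT !cardE -mulrDl exprSr invfM mulrA; congr (_ / _ / _).
rewrite (reindex (fun bw : bool * T.-tuple bool => cons_tuple bw.1 bw.2)) /=; last first.
  exists (fun w => (thead w, behead_tuple w)) => [[b w] _|w _] /=.
    by congr (_, _); apply: val_inj.
  by rewrite [RHS]tuple_eta; apply: val_inj.
rewrite -(pair_bigA _ (fun b (w : T.-tuple bool) => (P (bits (cons_tuple b w)))%:R)) /=.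
have E b (w : T.-tuple bool) : bits (cons_tuple b w) = tape_cons b (bits w).
  by apply/funext => -[].
rewrite big_bool /=; congr (_ + _); by apply: eq_bigr => w _; rewrite E.
Qed.

Lemma coin_prob_true T : coin_prob T xpredT = 1.
Proof.
elim: T => [|T IHT] //=; rewrite -[_ \o tape_cons true]/(xpredT : (nat -> bool) -> bool).
by rewrite -[_ \o tape_cons false]/(xpredT : (nat -> bool) -> bool) IHT; field.
Qed.

Lemma coin_prob_ge0 T P : 0 <= coin_prob T P.
Proof.
elim: T P => [|T IHT] P /=; first by rewrite ler0n.
by rewrite divr_ge0 // addr_ge0.
Qed.

Lemma coin_prob_not T P : coin_prob T (fun t => ~~ P t) = 1 - coin_prob T P.
Proof.
elim: T P => [|T IHT] P /=; first by case: (P _) => /=; rewrite ?subrr ?subr0.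
rewrite -[_ \o tape_cons true]/(fun t => ~~ (P \o tape_cons true) t).
rewrite -[_ \o tape_cons false]/(fun t => ~~ (P \o tape_cons false) t).
by rewrite !IHT; field.
Qed.

Lemma coin_prob_and m T P Q :
  (forall t t', (forall i, (i < m)%N -> t i = t' i) -> P t = P t') ->
  coin_prob (m + T) (fun t => P t && Q (fun i => t (m + i)%N)) =
  coin_prob m P * coin_prob T Q.
Proof.
elim: m P => [|m IHm] P extP /=.
  have E t : P t = P xpred0 by apply: extP.
  rewrite add0n; case: (P xpred0) E => E; rewrite ?mul1r ?mul0r.
    by apply: eq_coin_prob => t; rewrite E.
  have -> : (fun t => P t && Q (fun i => t (0 + i)%N)) = (fun t => ~~ xpredT t).
    by apply/funext => t; rewrite E.
  by rewrite coin_prob_not coin_prob_true subrr.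
have E b : coin_prob (m + T) ((fun t => P t && Q (fun i => t (m.+1 + i)%N)) \o tape_cons b) =
    coin_prob m (P \o tape_cons b) * coin_prob T Q.
  by apply: IHm => t t' tt; apply: extP => -[|i] //=; exact: tt.
by rewrite !E -mulrDl mulrAC.
Qed.

Lemma coin_value_cons b t L :
  coin_value R (tape_cons b t) 0 L.+1 = (b%:R + coin_value R t 0 L) / 2.
Proof.
rewrite /coin_value big_nat_recl //= expr1 mulrDl mulr_suml; congr (_ + _).
by apply: eq_bigr => j _; rewrite [in LHS]exprSr invfM mulrA.
Qed.

(** A first digit [b] turns the threshold [p] into [2 p - b] and halves the error. The first two
    clauses serve the induction, since one of the two new thresholds is at most 0 or at least 1. *)
Lemma coin_prob_lt L p :
  [/\ p <= 0 -> coin_prob L (fun t => coin_value R t 0 L < p) = 0,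
      1 <= p -> coin_prob L (fun t => coin_value R t 0 L < p) = 1 &
      0 <= p <= 1 -> `|coin_prob L (fun t => coin_value R t 0 L < p) - p| <= 2 ^- L].
Proof.
elim: L p => [|L IHL] p /=.
  rewrite /coin_value big_geq // invr1; split=> [p0|p1|/andP[p0 p1]].
  - by rewrite ltNge p0.
  - by rewrite (lt_le_trans _ p1).
  - rewrite ler_norml; case: (0 < p) => /=; lra.
have E b : (fun t => coin_value R t 0 L.+1 < p) \o tape_cons b =
    fun t => coin_value R t 0 L < 2 * p - b%:R.
  by apply/funext => t /=; rewrite coin_value_cons ltr_pdivrMr // ltrBrDl [2 * p]mulrC.
rewrite !E /=.
have [A1 A2 A3] := IHL (2 * p - 1); have [B1 B2 B3] := IHL (2 * p - 0).
split=> [p0|p1|/andP[p0 p1]].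
- by rewrite A1 ?B1; lra.
- by rewrite A2 ?B2; lra.
rewrite exprSr invfM; have [ph|/ltW ph] := leP p 2^-1.
  have : 0 <= 2 * p - 0 <= 1 by lra.
  move/B3; rewrite A1 ?subr0; last by lra.
  by rewrite !ler_norml => /andP[? ?]; apply/andP; split; lra.
have : 0 <= 2 * p - 1 <= 1 by lra.
move/A3; rewrite B2 ?subr0; last by lra.
by rewrite !ler_norml => /andP[? ?]; apply/andP; split; lra.
Qed.

Lemma coin_value_ext t t' k L : (forall i, (k <= i < k + L)%N -> t i = t' i) ->
  coin_value R t k L = coin_value R t' k L.
Proof.
move=> tt; apply: eq_big_nat => j /andP[_ jL]; rewrite tt //.
by rewrite leq_addr ltn_add2l.
Qed.

Lemma coin_prob_blocks n L T (test : nat -> R -> bool) :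
  coin_prob (n * L + T) (fun t => all (fun x => test x (coin_value R t (x * L) L)) (iota 0 n)) =
  \prod_(0 <= x < n) coin_prob L (fun t => test x (coin_value R t 0 L)).
Proof.
elim: n test => [|n IHn] test; first by rewrite big_geq // coin_prob_true.
rewrite big_nat_recl // -(IHn (fun x => test x.+1)) mulSn -addnA -coin_prob_and; last first.
  by move=> t t' tt; rewrite (@coin_value_ext t t') // => i /andP[_]; exact: tt.
apply: eq_coin_prob => t; rewrite /= mul0n; congr (_ && _).
rewrite -[1%N]addn0 iotaDl all_map; apply: eq_all => x /=.
congr (test _ _); apply: eq_bigr => j _; congr ((t _)%:R / _); lia.
Qed.

End CoinLaw.

(** * Errors of exponentials and of probabilities *)

Section ApproxExp.
Variable R : realType.
Implicit Types (u v d : R).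

(** The inverse of [1 + v] is [1 - v / (1 + v)], hence at most [exp (- v / (1 + v))]; and
    [v / (1 + v) >= v - 2 v ^ 2] on this range. *)
Lemma expR_le_1D v : - 2^-1 <= v -> expR (v - 2 * v ^+ 2) <= 1 + v.
Proof.
move=> v2; have v1 : 0 < 1 + v by lra.
apply: (@le_trans _ _ (expR (v / (1 + v)))).
  by rewrite ler_expR ler_pdivlMr //; nra.
rewrite -[leLHS]invrK -expRN -[leRHS]invrK lef_pV2 ?posrE ?expR_gt0 ?invr_gt0 //.
apply: le_trans (expR_ge1Dx _); rewrite le_eqVlt; apply/orP; left; apply/eqP.
by field; rewrite gt_eqF.
Qed.

Lemma approx_exp_gt0 M u : `|u| <= 2 ^+ M / 2 -> 0 < approx_exp M u.
Proof.
move=> uM; rewrite exprn_gt0 // -ltrBlDl sub0r ltrNl -mulNr ltr_pdivrMr ?exprn_gt0 //.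
rewrite mul1r; have := ler_norm (- u); rewrite normrN.
have : 0 < 2 ^+ M :> R by rewrite exprn_gt0.
lra.
Qed.

(** With [v = u / 2 ^ M], each of the [2 ^ M] factors [1 + v] is off by at most [2 v ^ 2] in
    logarithmic scale. *)
Lemma approx_exp_close M u : `|u| <= 2 ^+ M / 2 ->
  mult_close (2 * u ^+ 2 / 2 ^+ M) (approx_exp M u) (expR u).
Proof.
move=> uM; have N0 : 0 < 2 ^+ M :> R by rewrite exprn_gt0.
set v := u / 2 ^+ M; have v2 : `|v| <= 2^-1.
  by rewrite /v normrM normfV (gtr0_norm N0) ler_pdivrMr // mulrC.
move: v2; rewrite ler_norml => /andP[v2 v2'].
have v1 : 0 <= 1 + v by lra.
have Nv : expR u = expR v ^+ (2 ^ M).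
  by rewrite -expRM_natl natrX mulrC /v divfK // gt_eqF.
have d0 : 0 <= 2 * u ^+ 2 / 2 ^+ M by rewrite divr_ge0 ?(ltW N0) // mulr_ge0 // sqr_ge0.
rewrite /approx_exp -/v; split.
  rewrite -[leLHS]mul1r ler_pM ?exprn_ge0 //; first by rewrite -[leLHS]expR0 ler_expR.
  by rewrite Nv lerXn2r ?nnegrE ?expR_ge0 // expR_ge1Dx.
have -> : 2 * u ^+ 2 / 2 ^+ M = (2 ^ M)%:R * (2 * v ^+ 2).
  by rewrite natrX /v; field; rewrite gt_eqF.
rewrite expRM_natl Nv -exprMn lerXn2r ?nnegrE ?expR_ge0 ?mulr_ge0 ?expR_ge0 //.
rewrite mulrC -ler_pdivrMr ?expR_gt0 // -expRN -expRD; exact: expR_le_1D.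
Qed.

Lemma mult_close_expR d u v : `|u - v| <= d -> mult_close d (expR u) (expR v).
Proof. by rewrite ler_norml => /andP[? ?]; split; rewrite -expRD ler_expR; lra. Qed.

Lemma spin_prob_gt0 (r : R) b : 0 < r -> 0 < spin_prob r b.
Proof. by move=> r0; rewrite divr_gt0 ?ltr_pwDl //; [case: b|exact: ltW]. Qed.

Lemma spin_prob_close d (r s : R) b : 0 <= d -> 0 <= r -> 0 <= s ->
  mult_close d r s -> mult_close (2 * d) (spin_prob r b) (spin_prob s b).
Proof.
move=> d0 r0 s0 rs; rewrite mulrDl mul1r; apply: mult_close_div.
- by case: b.
- by case: b.
- by rewrite ltr_pwDl.
- by rewrite ltr_pwDl.
- by case: b => //; exact: mult_close_refl.
- exact: mult_close_1D.
Qed.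

(* An additive error [t] on a probability that is at least [w] is a
   multiplicative error [2 t / w]. *)
Lemma additive_close (p q t w : R) : 0 < w -> w <= p -> `|q - p| <= t -> 2 * t <= w ->
  mult_close (2 * t / w) q p.
Proof.
move=> w0 wp; rewrite ler_norml => /andP[h1 h2] tw.
have t0 : 0 <= t by lra.
have th0 : 0 <= 2 * t / w by rewrite divr_ge0 ?(ltW w0) // mulr_ge0.
have tp : t <= 2^-1 * (2 * t / w) * p.
  have -> : 2^-1 * (2 * t / w) = t / w by field; rewrite gt_eqF.
  by rewrite mulrAC ler_pdivlMr // ler_wpM2l //; lra.
have th1 : 2 * t / w <= 1 by rewrite ler_pdivrMr // mul1r.
set th := 2 * t / w in th0 tp th1 *.
have p0 : 0 < p by lra.
split.
  apply: (@le_trans _ _ ((1 + th) * p)); first by nra.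
  by rewrite ler_wpM2r ?(ltW p0) // expR_ge1Dx.
have q0 : p * (1 - th / 2) <= q by nra.
apply: (@le_trans _ _ ((1 + th) * q)); first by nra.
by rewrite ler_wpM2r ?expR_ge1Dx //; nra.
Qed.

Lemma expR_le_1D2 d : 0 <= d <= 2^-1 -> expR d <= 1 + 2 * d.
Proof.
move=> /andP[d0 d1]; have h1 : (1 - d) * expR d <= 1.
  by rewrite -ler_pdivlMr ?expR_gt0 // div1r -expRN expR_ge1Dx.
have : (1 - d) * expR d <= (1 - d) * (1 + 2 * d) by nra.
by rewrite ler_pM2l //; lra.
Qed.

End ApproxExp.

(** * Accuracy of the approximations *)

Section Precision.
Variables (R : realType) (Delta : nat) (beta alpha : R).

(** Bounds the logarithm of the edge weight: its base lies within [|beta| + 1] of 1, where the 1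
    absorbs the error of [approx_exp], and is raised to the power 4. *)
Definition edge_log : R := 4 * `|beta| + 4.
(** Distance from a vertex weight to [exp (2 h)]: 2 for the error of the squared exponential, the
    rest for two inverse bases per neighbour. *)
Definition weight_log : R := 2 + 2 * (Delta%:R * (`|beta| + 1)).
(** Halved because the weight behaves like [exp (2 h)]: twice this number is the margin of
    [far_vertex], plus the distance [weight_log], plus the logarithm [alpha] of [A]. *)
Definition far_threshold : R := edge_log * Delta%:R + weight_log / 2 + alpha / 2.

(* The factor by which the recursion contracts at a vertex with field [u]. *)
Definition field_factor (u : R) : R :=
  if far_threshold <= `|u| then expR (edge_log - alpha) else expR edge_log.

(** The deterministic interface between probability and algorithm. The bound on the fields controls
    the approximate exponentials and keeps conditional probabilities from being too small; the path
    sums control the truncation. *)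
Definition good_fields (n : nat) (a : rel nat) (h : nat -> R) : Prop :=
  [/\ forall y, (count (a y) (iota 0 n) <= Delta)%N,
      forall x, `|h x| <= n%:R &
      forall m x, (x < n)%N -> (n ^ 2 <= 2 ^ m)%N ->
        path_sum n a (field_factor \o h) m [::] x <= 2 ^- m].

(** One summand per source of error: the exponentials, the truncation, the coins, and the constant
    part of the smallest conditional probability. *)
Definition precision_bound : R :=
  64 * (1 + `|beta|) ^+ 2 + 64 * (edge_log * Delta%:R) + 64 +
  4 * expR (weight_log + 2 * (edge_log * Delta%:R)).

Variables (n : nat) (a : rel nat) (h : nat -> R) (M D : nat) (eps : R).
Hypothesis alpha_ge0 : 0 <= alpha.
Hypothesis irr : forall y, ~~ a y y.
Hypothesis sym : symmetric a.
Hypothesis good : good_fields n a h.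
Hypothesis eps_gt0 : 0 < eps.
Hypothesis D_large : precision_bound <= D%:R.
Hypothesis M_large : D%:R * n.+1%:R ^+ 4 * (1 + eps^-1) <= 2 ^+ M.

Local Notation k := edge_log.
Local Notation kD := (edge_log * Delta%:R).
Local Notation b := (edge_base beta M).
Local Notation c := (edge_weight beta M).
Local Notation e := (fun x => approx_exp M (h x)).
Local Notation lam := (vertex_weight n a beta h M).
Local Notation eta := (2 * (n.+1%:R * (1 + `|beta|)) ^+ 2 / 2 ^+ M).

Let N : R := n.+1%:R.
Let E : R := 1 + eps^-1.

Lemma scale_facts : [/\ 1 <= N, 1 <= E, 0 <= kD, 0 < (2 : R) ^+ M & D%:R * N ^+ 4 * E <= 2 ^+ M].
Proof.
split=> //; first by rewrite ler1n.
- by rewrite lerDl invr_ge0 ltW.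
- by rewrite /edge_log mulr_ge0 // addr_ge0 // mulr_ge0.
Qed.

Lemma D_facts : [/\ 64 * (1 + `|beta|) ^+ 2 <= D%:R, 64 * kD <= D%:R, 64 <= (D%:R : R) &
  4 * expR (weight_log + 2 * kD) <= D%:R].
Proof.
have [_ _ k0 _ _] := scale_facts.
have e0 := expR_ge0 (weight_log + 2 * kD).
have b0 : 0 <= (1 + `|beta|) ^+ 2 by rewrite sqr_ge0.
have Db : 64 * (1 + `|beta|) ^+ 2 + 64 * kD + 64 +
  4 * expR (weight_log + 2 * kD) <= D%:R := D_large.
split; lra.
Qed.

Lemma N_pow : [/\ N <= N ^+ 4, N ^+ 2 <= N ^+ 4 & N ^+ 2 * N ^+ 2 = N ^+ 4].
Proof.
have [N1 _ _ _ _] := scale_facts.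
by split; [apply: ler_eXnr|apply: ler_weXn2l|rewrite -exprD].
Qed.

(** Origin of the fourth power in the scale: two powers of [N] bound the squared field inside [eta],
    the other two the number of factors of a configuration weight. *)
Lemma eta_le : eta * (N ^+ 2 * E) <= 2^-1 / 16 /\ eta <= 1 /\ 0 <= eta.
Proof.
have [N1 E1 k0 Q0 leQ] := scale_facts; have [D1 D2 D3 D4] := D_facts.
have [P1 P2 P3] := N_pow.
have b0 : 0 <= (1 + `|beta|) ^+ 2 by rewrite sqr_ge0.
have N0 : 0 <= N ^+ 2 by rewrite sqr_ge0.
have main : eta * (N ^+ 2 * E) <= 2^-1 / 16.
  rewrite mulrAC ler_pdivrMr // exprMn.
  apply: (@le_trans _ _ (2^-1 / 16 * (D%:R * N ^+ 4 * E))); last by rewrite ler_wpM2l.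
  rewrite -P3; set X := N ^+ 2 in N0 *; set Y := (1 + _) ^+ 2 in D1 b0 *.
  have -> : 2 * (X * Y) * (X * E) = 2^-1 / 16 * ((64 * Y) * (X * X) * E) by field.
  by rewrite ler_wpM2l // ler_wpM2r ?(le_trans ler01 E1) // ler_wpM2r // mulr_ge0.
have eta0 : 0 <= eta by rewrite divr_ge0 ?mulr_ge0 ?sqr_ge0 // ltW.
split=> //; split=> //.
have : eta * 1 <= eta * (N ^+ 2 * E).
  by rewrite ler_wpM2l // -[leLHS]mulr1 ler_pM // expr_ge1 // (le_trans ler01 N1).
lra.
Qed.

Lemma eta_pos : 0 <= eta. Proof. by have [_ []] := eta_le. Qed.
Lemma eta_le1 : eta <= 1. Proof. by have [_ []] := eta_le. Qed.

Lemma field_close u : `|u| <= N * (1 + `|beta|) ->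
  0 < approx_exp M u /\ mult_close eta (approx_exp M u) (expR u).
Proof.
move=> uN; have [N1 E1 k0 Q0 leQ] := scale_facts; have [D1 D2 D3 D4] := D_facts.
have [P1 P2 P3] := N_pow.
have b1 : 1 <= 1 + `|beta| by rewrite lerDl.
have uM : `|u| <= 2 ^+ M / 2.
  rewrite ler_pdivlMr //; apply: le_trans leQ.
  apply: (@le_trans _ _ (N * (1 + `|beta|) * 2)); first by rewrite ler_wpM2r.
  apply: (@le_trans _ _ (D%:R * N ^+ 4 * 1)); last first.
    by rewrite ler_wpM2l // mulr_ge0 // exprn_ge0 // (le_trans ler01 N1).
  rewrite mulr1 -mulrA mulrC ler_pM //; last by nra.
have a0 : 0 < approx_exp M u by exact: approx_exp_gt0.
split=> //; apply: mult_close_weaken (approx_exp_close uM).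
- exact: ltW.
- exact: expR_ge0.
- rewrite ler_wpM2r ?invr_ge0 ?(ltW Q0) // ler_wpM2l //.
  by rewrite -[u ^+ 2]real_normK ?num_real // lerXn2r ?nnegrE // mulr_ge0 // (le_trans ler01) // b1.
Qed.

Lemma base_close : 0 < b /\ mult_close eta b (expR beta).
Proof.
apply: field_close; have [N1 _ _ _ _] := scale_facts; have := normr_ge0 beta; nra.
Qed.

Lemma exp_field_close x : 0 < e x /\ mult_close eta (e x) (expR (h x)).
Proof.
apply: field_close; have [_ /(_ x) hx _] := good.
apply: le_trans hx _; have := normr_ge0 beta.
have nN : n%:R <= N by rewrite ler_nat.
have [N1 _ _ _ _] := scale_facts; nra.
Qed.

Lemma base_log : mult_close (`|beta| + 1) b 1.
Proof.
have [b0 bc] := base_close.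
have bc1 : mult_close 1 b (expR beta).
  by apply: mult_close_weaken bc; rewrite ?(ltW b0) ?expR_ge0 // eta_le1.
rewrite addrC; apply: mult_close_trans bc1 _; rewrite -expR0; apply: mult_close_expR.
by rewrite subr0.
Qed.

Lemma edge_log_ge0 : 0 <= k.
Proof. by rewrite /edge_log addr_ge0 // mulr_ge0. Qed.

Lemma edge_weight_close : mult_close k c 1.
Proof.
have [b0 _] := base_close; have bl := base_log.
rewrite /edge_weight /edge_log.
have -> : 4 * `|beta| + 4 = (`|beta| + 1) + ((`|beta| + 1) + ((`|beta| + 1) + (`|beta| + 1))) by ring.
rewrite !exprS expr0 mulr1 -[X in mult_close _ _ X]mulr1.
rewrite -[X in mult_close _ _ (_ * X)]mulr1 -[X in mult_close _ _ (_ * (_ * X))]mulr1.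
by do 3 (apply: mult_close_mul => //; rewrite ?mulr_ge0 ?(ltW b0) //).
Qed.

Lemma edge_weight_le : c <= expR k.
Proof. by have [+ _] := edge_weight_close; rewrite mulr1. Qed.

Lemma edge_weight_ge : expR (- k) <= c.
Proof.
by have [_ +] := edge_weight_close; rewrite mulrC -ler_pdivrMr ?expR_gt0 // div1r -expRN.
Qed.

Lemma edge_weight_gt0 : 0 < c.
Proof. exact: lt_le_trans (expR_gt0 _) edge_weight_ge. Qed.

Lemma vertex_weight_gt0 z : (z < n)%N -> 0 < lam z.
Proof.
move=> zn; rewrite /vertex_weight zn mulr_gt0 //.
  by rewrite exprn_gt0 //; have [] := exp_field_close z.
by rewrite prodr_gt0 // => y _; rewrite invr_gt0 exprn_gt0 //; have [] := base_close.
Qed.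

Lemma vertex_weight_out z : (n <= z)%N -> lam z = 0.
Proof. by move=> nz; rewrite /vertex_weight ltnNge nz. Qed.

Lemma vertex_weight_close z : (z < n)%N -> mult_close weight_log (lam z) (expR (2 * h z)).
Proof.
move=> zn; rewrite /vertex_weight zn -[X in mult_close _ _ X]mulr1.
have [ez ec] := exp_field_close z; have [b0 _] := base_close; have bl := base_log.
have ec1 : mult_close 1 (e z) (expR (h z)).
  by apply: mult_close_weaken ec; rewrite ?(ltW ez) ?expR_ge0 // eta_le1.
apply: mult_close_mul.
- by rewrite sqr_ge0.
- exact: expR_ge0.
- by apply: prodr_ge0 => y _; rewrite invr_ge0 sqr_ge0.
- by [].
- rewrite mulrDl mul1r expRD expr2; apply: mult_close_mul; rewrite ?(ltW ez) ?expR_ge0 //.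
- apply: (@mult_close_weaken _ (\sum_(0 <= y < n | a z y) (2 * (`|beta| + 1)))) => //.
  + by apply: prodr_ge0 => y _; rewrite invr_ge0 sqr_ge0.
  + rewrite big_const_seq iter_addr addr0 -[_ *+ _]mulr_natr mulrAC -mulrA.
    rewrite [X in _ <= 2 * X]mulrC mulrA mulrAC -mulrA ler_wpM2l // mulrC.
    rewrite [leRHS]mulrC ler_wpM2l ?addr_ge0 // ler_nat.
    by have [+ _ _] := good; move=> /(_ z); rewrite /index_iota subn0.
  + have F : \prod_(0 <= y < n | a z y) 1 = 1 :> R by rewrite big1.
    rewrite -[X in mult_close _ _ X]F; apply: mult_close_prod => y _ //.
      by rewrite invr_ge0 sqr_ge0.
    rewrite -[X in mult_close _ _ X]invr1; apply: mult_close_inv => //.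
      by rewrite exprn_gt0.
    rewrite mulrDl mul1r expr2 -[X in mult_close _ _ X]mulr1.
    by apply: mult_close_mul => //; rewrite ltW.
Qed.

Lemma far_field_vertex z : (z < n)%N -> far_threshold <= `|h z| ->
  far_vertex k Delta lam (expR alpha) z.
Proof.
move=> zn; rewrite /far_threshold ler_normr => /orP[hz|hz];
  have [l1 l2] := vertex_weight_close zn; apply/orP; [left|right].
  rewrite -expRD; have : expR (2 * h z - weight_log) <= lam z.
    by rewrite expRB ler_pdivrMr ?expR_gt0 // [leRHS]mulrC.
  by apply: le_trans; rewrite ler_expR; lra.
rewrite -expRN.
apply: (@le_trans _ _ (expR (2 * kD) * (expR weight_log * expR (2 * h z)))).
  by rewrite ler_wpM2l ?expR_ge0.
by rewrite -!expRD ler_expR; lra.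
Qed.

Lemma decay_factor_le z : (z < n)%N ->
  decay_factor k Delta lam (expR alpha) z <= field_factor (h z).
Proof.
move=> zn; rewrite /decay_factor /field_factor expRB.
case: (leP far_threshold) => hz; first by rewrite far_field_vertex.
case: ifP => // _; rewrite ler_pdivrMr ?expR_gt0 // ler_peMr ?expR_ge0 //.
by rewrite -[leLHS]expR0 ler_expR.
Qed.

Lemma path_sum_le (kappa kappa' : nat -> R) m p x :
  (forall z, 0 <= kappa z) -> (forall z, (z < n)%N -> kappa z <= kappa' z) ->
  path_sum n a kappa m p x <= path_sum n a kappa' m p x.
Proof.
move=> k0 kk'; elim: m p x => [|m IHm] p x //=.
rewrite big_seq_cond [leRHS]big_seq_cond; apply: ler_sum => y.
rewrite mem_index_iota => /andP[/andP[_ yn] _].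
by rewrite ler_pM ?kk' // path_sum_ge0.
Qed.

Lemma pinned_ratio_close s x : (x < n)%N ->
  mult_close (kD * 2 ^- M) (pinned_ratio n a beta h M s x)
    (gas_ratio n a c (pinned a c lam s x) x).
Proof.
move=> xn; have [N1 E1 k0 Q0 leQ] := scale_facts; have [D1 D2 D3 D4] := D_facts.
have [degree _ paths] := good.
have lam0 : forall z, 0 <= lam z := lam_ge0 vertex_weight_gt0 vertex_weight_out.
have hr : reachable n a c lam (pinned a c lam s x).
  apply: reachable_pinned => //; [exact: edge_weight_gt0|exact: vertex_weight_gt0|exact: vertex_weight_out|exact: edge_weight_ge|exact: ltnW].
have p0 z : 0 <= pinned a c lam s x z by have [+ _] := hr; apply.
have := trunc_ratio_close irr sym degree edge_log_ge0 edge_weight_le edge_weight_ge lam0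
   (expR_gt0 alpha) M (p := [::]) hr xn _.
move=> /(_ (fun z H => False_rect _ (notF H))).
apply: mult_close_weaken; first exact: trunc_ratio_ge0 edge_weight_ge _ _ _ p0.
  by apply: gas_ratio_ge0 => //; exact: edge_weight_gt0.
rewrite ler_wpM2l //; apply: le_trans (path_sum_le _ _ _ _ _) (paths M x xn _).
- by move=> z; apply: decay_factor_ge0; exact: expR_gt0.
- exact: decay_factor_le.
(* The scale exceeds [n ^ 2], so depth [M] lies in the range where [good_fields] bounds the path
   sums. *)
rewrite -(ler_nat R) !natrX; apply: le_trans leQ.
apply: (@le_trans _ _ (N ^+ 2)); first by rewrite lerXn2r ?nnegrE // ler_nat.
have [P1 P2 P3] := N_pow; apply: le_trans P2 _.
have N4 : 0 <= N ^+ 4 by rewrite exprn_ge0.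
have D1' : 1 <= D%:R * E by rewrite -[leLHS]mulr1 ler_pM //; lra.
by rewrite mulrAC ler_peMl.
Qed.

(** Passes from the ratio to the pinned weight, the original weight, [exp (2 h)] and finally 1. This
    is the lower bound on conditional probabilities that the sampler needs. *)
Lemma pinned_ratio_log s x : (x < n)%N ->
  mult_close (2 * n%:R + (weight_log + 2 * kD)) (pinned_ratio n a beta h M s x) 1.
Proof.
move=> xn; have [degree hn paths] := good.
have lam0 : forall z, 0 <= lam z := lam_ge0 vertex_weight_gt0 vertex_weight_out.
have hr : reachable n a c lam (pinned a c lam s x).
  apply: reachable_pinned => //; [exact: edge_weight_gt0|exact: vertex_weight_gt0|exact: vertex_weight_out|exact: edge_weight_ge|exact: ltnW].
have p0 z : 0 <= pinned a c lam s x z by have [+ _] := hr; apply.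
have C1 : mult_close kD (pinned_ratio n a beta h M s x) (pinned a c lam s x x).
  exact: (mult_close_trunc_ratio degree edge_log_ge0 edge_weight_le edge_weight_ge M x p0).
have C2 : mult_close kD (pinned a c lam s x x) (lam x).
  apply: (reachable_close degree edge_log_ge0 edge_weight_le edge_weight_ge lam0 hr).
  by rewrite gt_eqF // (pinned_gt0 a edge_weight_gt0 vertex_weight_gt0 s xn).
have C3 := vertex_weight_close xn.
have C4 : mult_close (2 * n%:R) (expR (2 * h x)) 1.
  rewrite -[X in mult_close _ _ X]expR0; apply: mult_close_expR; rewrite subr0 normrM ger0_norm //.
  by rewrite ler_wpM2l.
have -> : 2 * n%:R + (weight_log + 2 * kD) = kD + (kD + (weight_log + 2 * n%:R)) by ring.
apply: mult_close_trans C1 _; apply: mult_close_trans C2 _; exact: mult_close_trans C3 C4.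
Qed.

Local Notation L := (M + (4 * n + D))%N.

(** [L] coins give an additive error [2 ^- L]. As the probability is at least [w], this is a
    relative error [2 * 2 ^- L / w], and [4 exp (2 n + C) <= 16 ^ n * 2 ^ D] brings it below
    [2 ^- M]. *)
Lemma coin_prob_close (r : R) bt :
  mult_close (2 * n%:R + (weight_log + 2 * kD)) r 1 ->
  mult_close (2 ^- M) (coin_prob R L (fun t => (coin_value R t 0 L * (1 + r) < r) == bt))
    (spin_prob r bt).
Proof.
set C := weight_log + 2 * kD => -[r1 r2].
have [N1 E1 k0 Q0 leQ] := scale_facts; have [D1 D2 D3 D4] := D_facts.
have r0 : 0 < r.
  by have : 0 < expR (2 * n%:R + C) * r by [exact: lt_le_trans r2]; rewrite pmulr_rgt0 ?expR_gt0.
have rr0 : 0 < 1 + r by lra.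
set w := expR (- (2 * n%:R + C)) / 2.
have w0 : 0 < w by rewrite divr_gt0 ?expR_gt0.
have C0 : 0 <= 2 * n%:R + C.
  rewrite /C /weight_log !addr_ge0 // ?mulr_ge0 // ?addr_ge0 // ?mulr_ge0 //; exact: edge_log_ge0.
have wp : w <= spin_prob r bt.
  have e1 : expR (- (2 * n%:R + C)) <= 1 by rewrite -[leRHS]expR0 ler_expR; lra.
  have e2 : expR (- (2 * n%:R + C)) <= r by rewrite expRN -div1r ler_pdivrMr ?expR_gt0 // mulrC.
  have e3 : expR (- (2 * n%:R + C)) * r <= 1.
    by rewrite expRN mulrC ler_pdivrMr ?expR_gt0 // mul1r -[leRHS]mulr1.
  have e4 : expR (- (2 * n%:R + C)) * r <= 1 * r by rewrite ler_wpM2r // ltW.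
  rewrite /w /spin_prob ler_pdivlMr //; case: bt; lra.
have F : `|coin_prob R L (fun t => (coin_value R t 0 L * (1 + r) < r) == bt) - spin_prob r bt| <= 2 ^- L.
  have Ep : (fun t => coin_value R t 0 L * (1 + r) < r) = (fun t => coin_value R t 0 L < r / (1 + r)).
    by apply/funext => t; rewrite ltr_pdivlMr.
  have p01 : 0 <= r / (1 + r) <= 1.
    by rewrite divr_ge0 ?(ltW r0) ?(ltW rr0) //= ler_pdivrMr // mul1r lerDr.
  have [_ _ /(_ p01) H] := coin_prob_lt L (r / (1 + r)).
  case: bt {wp} => /=.
    rewrite (@eq_coin_prob _ _ _ (fun t => coin_value R t 0 L < r / (1 + r))) //.
    by move=> t; rewrite eqb_id ltr_pdivlMr.
  rewrite (@eq_coin_prob _ _ _ (fun t => ~~ (coin_value R t 0 L < r / (1 + r)))); last first.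
    by move=> t; rewrite eqbF_neg ltr_pdivlMr.
  rewrite coin_prob_not /spin_prob.
  have -> : 1 - coin_prob R L (fun t => coin_value R t 0 L < r / (1 + r)) - 1 / (1 + r) =
    - (coin_prob R L (fun t => coin_value R t 0 L < r / (1 + r)) - r / (1 + r)).
    by field; rewrite gt_eqF.
  by rewrite normrN.
have tw : 2 * 2 ^- L / w <= 2 ^- M.
  have X0 : (0 : R) < 16 ^+ n * 2 ^+ D by rewrite mulr_gt0 // exprn_gt0.
  have big : 4 * expR (2 * n%:R + C) <= 16 ^+ n * 2 ^+ D.
    have en : expR (2 * n%:R) <= 16 ^+ n :> R.
      have -> : 2 * n%:R = n%:R * 2 :> R by ring.
      rewrite expRM_natl lerXn2r ?nnegrE ?expR_ge0 //.
      have eh : expR (2^-1) <= 2 :> R.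
        have half : 0 <= (2^-1 : R) <= 2^-1 by rewrite lexx andbT invr_ge0.
        by apply: le_trans (expR_le_1D2 half) _; lra.
      have -> : 2 = 4%:R * 2^-1 :> R by field.
      rewrite expRM_natl; have -> : 16 = 2 ^+ 4 :> R by ring.
      by rewrite lerXn2r ?nnegrE ?expR_ge0.
    rewrite expRD mulrCA ler_pM ?mulr_ge0 ?expR_ge0 //; apply: le_trans D4 _.
    by rewrite -natrX ler_nat ltnW // ltn_expl.
  rewrite /w expRN -invfM invrK mulrA exprD (exprD _ (4 * n)%N) exprM.
  have -> : 2 ^+ 4 = 16 :> R by ring.
  rewrite invfM.
  have -> : 2 * (2 ^- M * (16 ^+ n * 2 ^+ D)^-1) * expR (2 * n%:R + C) * 2 =
    2 ^- M * ((4 * expR (2 * n%:R + C)) / (16 ^+ n * 2 ^+ D)).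
    by field; rewrite !gt_eqF // exprn_gt0.
  by rewrite ler_piMr ?invr_ge0 ?(ltW Q0) // ler_pdivrMr // mul1r.
have Q1 : (2 : R) ^- M <= 1 by rewrite invf_le1 // exprn_ege1 // ler1n.
apply: (mult_close_weaken _ _ tw (additive_close w0 wp F _)).
- exact: coin_prob_ge0.
- by rewrite ltW // spin_prob_gt0.
- by have := le_trans tw Q1; rewrite ler_pdivrMr // mul1r.
Qed.

Lemma quadratic_le : (n * n + n)%:R <= N ^+ 2.
Proof. by rewrite -[N ^+ 2]natrX ler_nat expnS expn1 mulSn mulnS; lia. Qed.

Lemma precision_facts : [/\ (n * n + n)%:R * eta <= E^-1 / 32,
  n%:R * (kD * 2 ^- M) <= E^-1 / 64 & n%:R * 2 ^- M <= E^-1 / 64].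
Proof.
have [N1 E1 k0 Q0 leQ] := scale_facts; have [D1 D2 D3 D4] := D_facts.
have [P1 P2 P3] := N_pow; have [heta _] := eta_le; have eta0 := eta_pos.
have E0 : 0 < E by exact: lt_le_trans E1.
have nN : n%:R <= N by rewrite ler_nat.
have N0 : 0 <= N by exact: le_trans N1.
have small (z : R) : 0 <= z -> 64 * z <= D%:R -> n%:R * (z * 2 ^- M) <= E^-1 / 64.
  move=> z0 zD; have nzE : n%:R * z * 64 * E <= 2 ^+ M.
    apply: le_trans leQ; rewrite ler_wpM2r ?(ltW E0) // -mulrA mulrC [z * _]mulrC.
    by rewrite ler_pM ?mulr_ge0 //; exact: le_trans nN P1.
  rewrite mulrA ler_pdivrMr //.
  have -> : n%:R * z = E^-1 / 64 * (n%:R * z * 64 * E) by field; rewrite gt_eqF.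
  by rewrite ler_wpM2l // divr_ge0 // invr_ge0 ltW.
have nnN := quadratic_le.
split.
- apply: (@le_trans _ _ (N ^+ 2 * eta)); first exact: (ler_wpM2r eta0 nnN).
  have -> : N ^+ 2 * eta = E^-1 * (eta * (N ^+ 2 * E)).
    by rewrite [RHS]mulrCA [E^-1 * _]mulrCA mulVf ?gt_eqF // mulr1 mulrC.
  by rewrite ler_wpM2l ?invr_ge0 ?(ltW E0) //; lra.
- exact: small.
- by rewrite -[2 ^- M]mul1r; apply: small; rewrite ?mulr1.
Qed.

(** [E^-1 = eps / (1 + eps)] replaces the minimum of [eps] and 1 as tolerance; the step to total
    variation needs a small relative error even for large [eps]. *)
Lemma inv_E_le : E^-1 <= eps /\ E^-1 <= 1.
Proof.
have [N1 E1 k0 Q0 leQ] := scale_facts; have E0 : 0 < E by exact: lt_le_trans E1.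
split; last by rewrite invf_le1.
by rewrite invf_ple ?posrE // /E lerDr.
Qed.

Local Notation exact_weight := (spin_weight a (expR beta) (fun x => expR (h x))).
Local Notation ratio := (pinned_ratio n a beta h M).

Lemma spin_weight_approx (sigma : config n) : [/\ 0 < spin_weight a b e sigma, 0 < exact_weight sigma &
  mult_close ((n * n + n)%:R * eta) (spin_weight a b e sigma) (exact_weight sigma)].
Proof.
have [b0 bc] := base_close.
have pos (b' : R) (e' : nat -> R) : 0 < b' -> (forall x, 0 < e' x) -> 0 < spin_weight a b' e' sigma.
  move=> b0' e0'; rewrite mulr_gt0 ?prodr_gt0 // => x _.
    by rewrite prodr_gt0 // => y _; case: ifP => _; rewrite ?invr_gt0.
  by case: ifP => _; rewrite ?invr_gt0.
split.
- by apply: pos => // x; have [] := exp_field_close x.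
- by apply: pos => [|x]; exact: expR_gt0.
- apply: spin_weight_close => //.
  + exact: expR_gt0.
  + by move=> x; have [] := exp_field_close x.
  + by move=> x; exact: expR_gt0.
  + by move=> x; have [] := exp_field_close x.
Qed.

Lemma spin_weight_prefactor (sigma : config n) :
  spin_weight a b e sigma = prefactor_upto n a beta h M n * gas_weight a c lam sigma.
Proof.
rewrite spin_weight_gas //; first by have [] := base_close.
by move=> x; have [] := exp_field_close x.
Qed.

Lemma spin_sum_prefactor : \sum_(sigma : config n) spin_weight a b e sigma =
  prefactor_upto n a beta h M n * gas_sum n a c lam.
Proof. by rewrite mulr_sumr; apply: eq_bigr => tau _; rewrite spin_weight_prefactor. Qed.

Lemma prefactor_gt0 : 0 < prefactor_upto n a beta h M n.
Proof.
rewrite prodr_gt0 // => x _; rewrite mulr_gt0 ?invr_gt0 //; first by have [] := exp_field_close x.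
by rewrite prodr_gt0 // => y _; have [] := base_close.
Qed.

Lemma ratio_pos s x : (x < n)%N -> 0 <= ratio s x /\
  0 <= gas_ratio n a c (pinned a c lam s x) x.
Proof.
move=> xn; have p0 : forall z, 0 <= pinned a c lam s x z.
  by move=> z; apply: pinned_ge0 => //; [exact: edge_weight_gt0|exact: vertex_weight_gt0|exact: vertex_weight_out].
split; first exact: trunc_ratio_ge0 edge_weight_ge _ _ _ p0.
by apply: gas_ratio_ge0 => //; exact: edge_weight_gt0.
Qed.

Lemma count_close : mult_close eps
  (prefactor_upto n a beta h M n * \prod_(0 <= x < n) (1 + ratio xpred0 x))
  (\sum_(sigma : config n) exact_weight sigma).
Proof.
have [N1 E1 k0 Q0 leQ] := scale_facts.
have [F1 F2 F3] := precision_facts; have [G1 G2] := inv_E_le.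
have p0 := prefactor_gt0.
have Ei : 0 <= E^-1 by rewrite invr_ge0 (le_trans ler01).
apply: (@mult_close_weaken _ (n%:R * (kD * 2 ^- M) + (n * n + n)%:R * eta)).
- rewrite mulr_ge0 ?(ltW p0) // big_seq prodr_ge0 // => x.
  by rewrite mem_index_iota => /andP[_ /(ratio_pos xpred0)[r0 _]]; rewrite addr_ge0.
- by apply: sumr_ge0 => sigma _; have [_ /ltW] := spin_weight_approx sigma.
- lra.
apply: (@mult_close_trans _ _ _ _ (\sum_(sigma : config n) spin_weight a b e sigma)); last first.
  by apply: mult_close_sum => sigma _; have [] := spin_weight_approx sigma.
rewrite spin_sum_prefactor -[n%:R * _]add0r.
(* The empty configuration has gas weight 1, so the chain rule expresses [1 / Z] as the product of
   the [1 / (1 + r)]. *)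
have chain := gas_chain_rule irr sym edge_weight_gt0 vertex_weight_gt0 vertex_weight_out xpred0.
rewrite (gas_weight_pinned n a c lam xpred0) big1 // in chain.
have -> : gas_sum n a c lam = \prod_(0 <= x < n) (1 + gas_ratio n a c (pinned a c lam xpred0 x) x).
  rewrite -[LHS]invrK -[X in X^-1]mul1r chain -prodfV; apply: eq_bigr => x _.
  by rewrite /spin_prob div1r invrK.
rewrite big_seq [X in mult_close _ _ (_ * X)]big_seq.
have pos x : x \in index_iota 0 n -> 0 <= ratio xpred0 x /\
    0 <= gas_ratio n a c (pinned a c lam xpred0 x) x.
  by rewrite mem_index_iota => /andP[_]; exact: ratio_pos.
apply: mult_close_mul.
- exact: ltW.
- exact: ltW.
- by apply: prodr_ge0 => x /pos[r0 _]; rewrite addr_ge0.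
- by apply: prodr_ge0 => x /pos[_ r0]; rewrite addr_ge0.
- by apply: mult_close_refl => //; exact: ltW.
have -> : n%:R * (kD * 2 ^- M) = \sum_(x <- index_iota 0 n | x \in index_iota 0 n) (kD * 2 ^- M).
  by rewrite -big_seq big_const_seq count_predT size_iota subn0 iter_addr addr0 mulr_natl.
apply: mult_close_prod => x xn; have [r0 r0'] := pos x xn; rewrite ?addr_ge0 //.
apply: mult_close_1D; first by rewrite mulr_ge0 // invr_ge0 ltW.
by apply: pinned_ratio_close; move: xn; rewrite mem_index_iota.
Qed.

(** Every vertex loses [2 ^- M] for the coins and twice the ratio error; the approximate weights
    enter twice, through the weight and its normalisation. *)
Lemma sample_close (s : nat -> bool) (sigma : config n) : (forall x : 'I_n, sigma x = s x) ->
  mult_close (E^-1 / 2)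
   (\prod_(0 <= x < n) coin_prob R L
      (fun t => (coin_value R t 0 L * (1 + ratio s x) < ratio s x) == s x))
   (exact_weight sigma / \sum_(tau : config n) exact_weight tau).
Proof.
move=> sE; have -> : sigma = [ffun x : 'I_n => s (val x)] by apply/ffunP => x; rewrite ffunE.
have [N1 E1 k0 Q0 leQ] := scale_facts.
have [F1 F2 F3] := precision_facts; have [G1 G2] := inv_E_le.
have p0 := prefactor_gt0.
set sg := [ffun x => _].
have Ei : 0 <= E^-1 by rewrite invr_ge0 (le_trans ler01).
have Zpos (f : config n -> R) : (forall tau, 0 < f tau) -> 0 < \sum_tau f tau.
  move=> f0; rewrite (bigD1 sg) //= ltr_pwDl // sumr_ge0 // => tau _; exact: ltW.
have Z0 : 0 < \sum_(tau : config n) exact_weight tau by apply: Zpos => tau; have [] := spin_weight_approx tau.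
have Z0' : 0 < \sum_(tau : config n) spin_weight a b e tau by apply: Zpos => tau; have [] := spin_weight_approx tau.
have [wa we wc] := spin_weight_approx sg.
apply: (@mult_close_weaken _ (n%:R * (2 ^- M + 2 * (kD * 2 ^- M)) +
   ((n * n + n)%:R * eta + (n * n + n)%:R * eta))).
- by apply: prodr_ge0 => x _; exact: coin_prob_ge0.
- by rewrite divr_ge0 // ltW.
- lra.
apply: (@mult_close_trans _ _ _ _ (spin_weight a b e sg / \sum_(tau : config n) spin_weight a b e tau)); last first.
  apply: mult_close_div; rewrite ?(ltW wa) ?(ltW we) //.
  by apply: mult_close_sum => tau _; have [] := spin_weight_approx tau.
rewrite spin_sum_prefactor spin_weight_prefactor -mulf_div divff ?gt_eqF // mul1r.
rewrite (gas_chain_rule irr sym edge_weight_gt0 vertex_weight_gt0 vertex_weight_out).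
rewrite big_seq [X in mult_close _ _ X]big_seq.
have -> : n%:R * (2 ^- M + 2 * (kD * 2 ^- M)) =
    \sum_(x <- index_iota 0 n | x \in index_iota 0 n) (2 ^- M + 2 * (kD * 2 ^- M)).
  by rewrite -big_seq big_const_seq count_predT size_iota subn0 iter_addr addr0 mulr_natl.
apply: mult_close_prod => x; rewrite mem_index_iota => /andP[_ xn].
- exact: coin_prob_ge0.
- have [_ r0] := ratio_pos s xn; rewrite divr_ge0 ?addr_ge0 //; by case: (s x).
have [r0 r0'] := ratio_pos s xn.
apply: mult_close_trans (coin_prob_close _ (pinned_ratio_log s xn)) _.
apply: spin_prob_close => //; last exact: pinned_ratio_close.
by rewrite mulr_ge0 // invr_ge0 ltW.
Qed.

End Precision.

(** * Correctness of the two programs *)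

Section Instance.
Variables (R : realType) (n : nat) (G : sgraph n) (beta : R) (h : 'I_n -> R) (eps : R).
Local Notation I := (instance_input G beta h eps).
Local Notation a := (in_adj I).

Lemma in_adjE (x y : 'I_n) : a x y = adj G x y.
Proof. by rewrite /= !valK. Qed.

Lemma in_fieldE (x : 'I_n) : in_field I x = h x.
Proof. by rewrite /= valK. Qed.

Lemma in_adj_irr y : ~~ a y y.
Proof. by rewrite /=; case: insubP => [x _ _|//]; rewrite adj_irrefl. Qed.

Lemma in_adj_sym : symmetric a.
Proof.
move=> x y /=; case: insubP => [x' _ _|_]; case: insubP => [y' _ _|_] //.
exact: adj_sym.
Qed.

Lemma in_adj_degree Delta y : (max_degree G <= Delta)%N ->
  (count (a y) (iota 0 n) <= Delta)%N.
Proof.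
move=> degG; have [yn|ny] := ltnP y n; last first.
  by rewrite (@eq_count _ _ pred0) ?count_pred0 // => x /=; rewrite insubN // -leqNgt.
apply: leq_trans degG; rewrite /max_degree.
apply: leq_trans (leq_bigmax (Ordinal yn)).
rewrite -sum1_card -sum1_count.
have -> : iota 0 n = index_iota 0 n by rewrite /index_iota subn0.
rewrite big_mkord leq_eqVlt; apply/orP; left; apply/eqP; apply: eq_bigl => x.
by rewrite inE -in_adjE.
Qed.

Lemma expR_hamiltonian sigma :
  expR (- hamiltonian G beta h sigma) =
  spin_weight a (expR beta) (fun x => expR (in_field I x)) sigma.
Proof.
rewrite /hamiltonian opprK expRD mulr_sumr !expR_sum; congr (_ * _).
  apply: eq_bigr => x _; rewrite mulr_sumr expR_sum.
  apply: eq_big => y; first by rewrite in_adjE andbC.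
  by rewrite /spin; case: (sigma x); case: (sigma y) => /= _; rewrite -?expRN; congr expR; ring.
apply: eq_bigr => x _; rewrite in_fieldE /spin; case: (sigma x); rewrite -?expRN; congr expR; ring.
Qed.

Lemma partition_functionE : partition_function G beta h =
  \sum_(sigma : config n) spin_weight a (expR beta) (fun x => expR (in_field I x)) sigma.
Proof. by apply: eq_bigr => sigma _; rewrite expR_hamiltonian. Qed.

End Instance.

Lemma exists_scale (R : realType) (X : R) : exists M : nat,
  X <= 2 ^+ M /\ (forall k, (k < M)%N -> 2 ^+ k < X).
Proof.
have exM : exists M, X <= 2 ^+ M.
  exists (Num.bound `|X|); apply: (@le_trans _ _ (Num.bound `|X|)%:R).
    by apply: le_trans (ler_norm _) (ltW (archi_boundP (normr_ge0 X))).
  by rewrite -natrX ler_nat ltnW // ltn_expl.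
case: (ex_minnP exM) => M leM minM; exists M; split=> // k kM.
by rewrite ltNge; apply/negP => /minM; rewrite leqNgt kM.
Qed.

Section Runs.
Variables (R : realType) (I : input R) (tape : nat -> bool).

Lemma iter_step_nil t (s : state R) : iter t (step I tape) ([::], s) = ([::], s).
Proof. by elim: t => //= t ->. Qed.

(** A halted machine stays put. Hence one time bound serves all tapes, although the number of steps
    depends on the coins. *)
Lemma wp_run c T Q : wp I tape c T Q (init_state R) -> forall T', (T <= T')%N ->
  halts I tape c T' /\ Q (run I tape c T').2.
Proof.
move=> [t [s [tT runs Qs]]] T' TT'; rewrite /halts /run.
by rewrite -(subnK (leq_trans tT TT')) iterD runs iter_step_nil.
Qed.

End Runs.

Lemma dfs_time_le (R : realType) (I : input R) (Delta M : nat) :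
  (dfs_time I Delta M <= (40 * in_size I + 100) * (Delta.+1) ^ M * M.+1)%N.
Proof.
elim: M => [|M IHM] /=; first by rewrite expn0; lia.
set n := in_size I in IHM *; set p := (Delta.+1 ^ M)%N in IHM *.
have p1 : (1 <= p)%N by rewrite expn_gt0.
have E : (Delta.+1 ^ M.+1 = Delta.+1 * p)%N by rewrite expnS.
rewrite E; have := leq_mul (leqnn Delta) IHM.
nia.
Qed.

Section Algorithms.
Variables (R : realType) (Delta : nat) (beta alpha : R) (D : nat).
Hypothesis alpha_ge0 : 0 <= alpha.
Hypothesis D_large : precision_bound Delta beta <= D%:R.

(** The tolerance 1 is a placeholder: adjacency and fields are the same for every tolerance, and the
    class must not depend on it. *)
Definition tractable : instance_class R := fun n G h =>
  let I := instance_input G beta h 1 in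
  (max_degree G <= Delta)%N /\ good_fields Delta beta alpha n (in_adj I) (in_field I).

Lemma D_ge1 : (1 : R) <= D%:R.
Proof.
apply: le_trans D_large; rewrite /precision_bound /edge_log.
have e0 := expR_ge0 (weight_log Delta beta + 2 * ((4 * `|beta| + 4) * Delta%:R)).
have b0 : 0 <= (1 + `|beta|) ^+ 2 by rewrite sqr_ge0.
have d0 : 0 <= (4 * `|beta| + 4) * Delta%:R by rewrite mulr_ge0 // addr_ge0 // mulr_ge0.
rewrite /edge_log; lra.
Qed.

Section Fixed.
Variables (n : nat) (G : sgraph n) (h : 'I_n -> R) (eps : R) (M : nat).
Hypothesis eps_gt0 : 0 < eps.
Local Notation I := (instance_input G beta h eps).
Hypothesis leM : scale_value I D <= 2 ^+ M.
Hypothesis ltM : forall k, (k < M)%N -> 2 ^+ k < scale_value I D.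

Let q := (2 ^ M)%N.

Lemma scale_value_ge : n.+1%:R <= scale_value I D.
Proof.
rewrite /scale_value; have D1 := D_ge1; have N1 : 1 <= n.+1%:R :> R by rewrite ler1n.
have N4 : n.+1%:R <= n.+1%:R ^+ 4 :> R by apply: ler_eXnr.
have E1 : 1 <= 1 + eps^-1 by rewrite lerDl invr_ge0 ltW.
have N0 : 0 <= n.+1%:R ^+ 4 :> R by rewrite exprn_ge0.
apply: (le_trans N4); rewrite -[leLHS]mul1r -[leLHS]mulr1.
by rewrite ler_pM ?mul1r // ler_peMl.
Qed.

Lemma n_lt_q : (n < q)%N.
Proof. by rewrite -(ler_nat R) natrX; apply: le_trans leM; exact: scale_value_ge. Qed.

Lemma M_lt_q : (M < q)%N.
Proof. exact: ltn_expl. Qed.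

Lemma q_le : q%:R <= 2 * D%:R * (n%:R + eps^-1 + 1) ^+ 5.
Proof.
have B1 : n.+1%:R <= n%:R + eps^-1 + 1 by rewrite -natr1 lerD2r lerDl invr_ge0 ltW.
have B2 : 1 + eps^-1 <= n%:R + eps^-1 + 1 by rewrite addrC lerD2r lerDr.
have E0 : 0 <= 1 + eps^-1 by rewrite addr_ge0 // invr_ge0 ltW.
set B := n%:R + eps^-1 + 1 in B1 B2 *.
apply: (@le_trans _ _ (2 * scale_value I D)).
  have s1 : 1 <= scale_value I D by apply: le_trans scale_value_ge; rewrite ler1n.
  (* Minimality of [M] keeps [2 ^ M] below twice the scale. *)
  rewrite /q; case: M ltM => [|m] ltM'; first by rewrite expn0; lra.
  by rewrite natrX exprS ler_wpM2l // ltW // ltM'.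
rewrite -mulrA ler_wpM2l // /scale_value -mulrA ler_wpM2l // [leRHS]exprSr.
by rewrite ler_pM ?exprn_ge0 // lerXn2r ?nnegrE // (le_trans _ B1).
Qed.

(** [Delta + 1 <= 2 ^ Delta] turns the branching [(Delta + 1) ^ M] into [q ^ Delta], so the degree
    of the polynomial depends on [Delta]. *)
Lemma dfs_time_q : (dfs_time I Delta M <= 280 * q ^ Delta.+2)%N.
Proof.
have nq := n_lt_q; have Mq := M_lt_q; apply: leq_trans (dfs_time_le _ _ _) _.
have pq : (Delta.+1 ^ M <= q ^ Delta)%N.
  have [->|M0] := posnP M; first by rewrite expn0 expn_gt0 /q expn_gt0.
  by rewrite /q -expnM mulnC expnM leq_exp2r // ltn_expl.
have -> : (q ^ Delta.+2 = q ^ Delta * (q * q))%N by rewrite !expnSr mulnA.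
have -> : (280 * (q ^ Delta * (q * q)) = (140 * q) * q ^ Delta * (2 * q))%N by ring.
by apply: leq_mul; [apply: leq_mul => //=; lia|lia].
Qed.

Lemma setup_time_q : (setup_time I M <= 100 * q ^ Delta.+3)%N.
Proof.
have nq : (n < q)%N := n_lt_q; have Mq := M_lt_q.
rewrite !expnS; have qD : (1 <= q ^ Delta)%N by rewrite expn_gt0 /q expn_gt0.
set p := (q ^ Delta)%N in qD *; rewrite /setup_time /=.
have h1 : (n * (M * 4 + n * 9 + 23) <= q * (36 * q))%N by apply: leq_mul; lia.
have h2 : (q <= q * q)%N by rewrite leq_pmulr; lia.
have h3 : (q * q * 1 <= q * q * (q * p))%N.
  by rewrite leq_mul2l muln_gt0; apply/orP; right; apply/andP; split; lia.
rewrite !mulnA in h3 *; lia.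
Qed.

Lemma count_time_q : (count_time I Delta M <= 500 * q ^ Delta.+3)%N.
Proof.
have nq : (n < q)%N := n_lt_q; have Mq := M_lt_q; have h1 := setup_time_q; have h2 := dfs_time_q.
rewrite /count_time [in_size I]/=.
have q1 : (1 <= q ^ Delta.+2)%N by rewrite expn_gt0 /q expn_gt0.
have E : (q ^ Delta.+3 = q * q ^ Delta.+2)%N by rewrite expnS.
rewrite {}E in h1 *; set p := (q ^ Delta.+2)%N in h1 h2 q1 *.
have h3 := leq_mul (ltnW nq) (leqnn (280 * p + 30)).
have h4 : (n * (dfs_time I Delta M + 30) <= n * (280 * p + 30))%N by rewrite leq_mul2l; lia.
have : (1 <= q * p)%N by rewrite muln_gt0; lia.
have : (q <= q * p)%N by rewrite leq_pmulr.
lia.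
Qed.

Lemma sample_time_q : (sample_time I Delta D M <= (1000 + 10 * D) * q ^ Delta.+3)%N.
Proof.
have nq : (n < q)%N := n_lt_q; have Mq := M_lt_q; have h1 := setup_time_q; have h2 := dfs_time_q.
rewrite /sample_time /coins_per_vertex [in_size I]/=.
have q1 : (1 <= q ^ Delta.+1)%N by rewrite expn_gt0 /q expn_gt0.
have E : (q ^ Delta.+3 = q * q ^ Delta.+2)%N by rewrite expnS.
have E2 : (q ^ Delta.+2 = q * q ^ Delta.+1)%N by rewrite expnS.
have qp : (q <= q ^ Delta.+2)%N by rewrite E2 leq_pmulr.
rewrite {}E in h1 *; set p := (q ^ Delta.+2)%N in h1 h2 qp *.
set d := dfs_time _ _ _ in h2 *.
have h4 : (n * (d + (M + (4 * n + D)) * 10 + n * 6 + 50) <= q * (280 * p + (5 * q + D) * 10 + q * 6 + 50))%N.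
  by apply: leq_mul; lia.
have h5 : (q * (280 * p + (5 * q + D) * 10 + q * 6 + 50) <= q * ((400 + 10 * D) * p))%N.
  by rewrite leq_mul2l; apply/orP; right; nia.
have : (1 <= q * p)%N by rewrite muln_gt0; lia.
have E3 : (q * ((400 + 10 * D) * p) = 400 * (q * p) + 10 * D * (q * p))%N by ring.
have E4 : ((1000 + 10 * D) * (q * p) = 1000 * (q * p) + 10 * D * (q * p))%N by ring.
rewrite E4; rewrite E3 in h5; lia.
Qed.

Lemma time_bound_ge C T : (T <= C * q ^ Delta.+3)%N ->
  T%:R <= time_bound (C * (2 * D) ^ Delta.+3) (5 * Delta.+3) n eps.
Proof.
move=> leT; rewrite /time_bound; have ql := q_le.
have B0 : 0 <= n%:R + eps^-1 + 1 by rewrite !addr_ge0 // invr_ge0 ltW.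
apply: (@le_trans _ _ (C * q ^ Delta.+3)%:R); first by rewrite ler_nat.
rewrite natrM [in leRHS]natrM -mulrA ler_wpM2l // !natrX exprM -exprMn.
by move: ql; rewrite /q natrX => ql; rewrite lerXn2r ?nnegrE ?mulr_ge0 ?exprn_ge0 // natrM.
Qed.

End Fixed.

Lemma tractable_fptas : is_fptas beta tractable (count_cmd D).
Proof.
split=> //; exists (500 * (2 * D) ^ Delta.+3)%N, (5 * Delta.+3)%N => n G h hS eps eps0.
set I := instance_input G beta h eps.
have [M [leM ltM]] := exists_scale (scale_value I D).
have [degG good] := hS.
have irr := in_adj_irr G beta h eps; have sym := in_adj_sym G beta h eps.
have degree y := in_adj_degree beta h eps y degG.
have c0 : edge_weight beta M != 0.
  by rewrite gt_eqF //; exact: (edge_weight_gt0 eps0 D_large leM).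
have W := wp_count (fun=> false) irr degree c0 leM ltM.
have [halt out] := wp_run W (leqnn _).
have [H1 H2] := count_close alpha_ge0 irr sym good eps0 D_large leM.
rewrite -/I in H1 H2.
exists (count_time I Delta M); rewrite (partition_functionE _ _ _ eps) /out_real out; split.
- exact: (time_bound_ge eps0 ltM (count_time_q eps0 leM)).
- exact: halt.
- by rewrite expRN mulrC ler_pdivrMr ?expR_gt0 // [leRHS]mulrC.
- exact: H2.
Qed.

(** For [d <= 1/2] the relative error gives [|mu - nu| <= 2 d nu] pointwise; summing and halving
    leaves [d]. *)
Lemma tv_dist_close (T : finType) (mu nu : T -> R) d : 0 <= d <= 2^-1 ->
  (forall t, 0 <= nu t) -> \sum_t nu t = 1 ->
  (forall t, mult_close d (mu t) (nu t)) -> tv_dist mu nu <= d.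
Proof.
move=> d01 nu0 nu1 mn; have e2 := expR_le_1D2 d01; move/andP: d01 => [d0 d1].
have e1 : 1 <= expR d by rewrite -[leLHS]expR0 ler_expR.
rewrite /tv_dist -[leRHS](mulKf (_ : 2 != 0)) // ler_wpM2l //.
apply: (@le_trans _ _ (\sum_t (2 * d) * nu t)); last by rewrite -mulr_sumr nu1 mulr1.
apply: ler_sum => t _; have [h1 h2] := mn t; rewrite ler_norml; have n0 := nu0 t.
have h3 : expR d * nu t <= (1 + 2 * d) * nu t by rewrite ler_wpM2r.
have mu0 : 0 <= mu t by rewrite -(pmulr_rge0 _ (expR_gt0 d)) (le_trans n0).
apply/andP; split; last by lra.
have h4 : (1 - d) * nu t <= mu t.
  have : (1 - d) * nu t <= (1 - d) * expR d * mu t by rewrite -mulrA ler_wpM2l //; lra.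
  have : (1 - d) * expR d <= 1.
    by rewrite -ler_pdivlMr ?expR_gt0 // div1r -expRN expR_ge1Dx.
  by move=> /(ler_wpM2r mu0); lra.
have : 0 <= d * nu t by rewrite mulr_ge0.
lra.
Qed.

Definition spins n (sigma : config n) : nat -> bool :=
  fun x => if insub x is Some i then sigma i else false.

Lemma spinsE n (sigma : config n) (x : 'I_n) : sigma x = spins sigma x.
Proof. by rewrite /spins valK. Qed.

Lemma eq_pinned_ratio n (a : rel nat) (h : nat -> R) M s t x :
  (forall y, (y < x)%N -> s y = t y) ->
  pinned_ratio n a beta h M s x = pinned_ratio n a beta h M t x.
Proof. by move=> st; rewrite /pinned_ratio (eq_pinned _ _ _ st). Qed.

(** The output is [sigma] exactly if every comparison, made with thresholds computed from [sigma]
    itself, returns the spin of [sigma]. These thresholds are fixed and the comparisons read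
    disjoint blocks of coins, so the law is a product. *)
Lemma tractable_sampling : is_sampling_scheme beta tractable (sample_cmd D).
Proof.
exists ((1000 + 10 * D) * (2 * D) ^ Delta.+3)%N, (5 * Delta.+3)%N => n G h hS eps eps0.
set I := instance_input G beta h eps.
have [M [leM ltM]] := exists_scale (scale_value I D).
have [degG good] := hS.
have irr := in_adj_irr G beta h eps; have sym := in_adj_sym G beta h eps.
have degree y := in_adj_degree beta h eps y degG.
have c0 : edge_weight beta M != 0.
  by rewrite gt_eqF //; exact: (edge_weight_gt0 eps0 D_large leM).
have W t := wp_sample t irr degree c0 leM ltM.
set T0 := sample_time I Delta D M in W.
set L := coins_per_vertex I D M in W.
have nL : (n * L <= T0)%N by rewrite /T0 /sample_time -/L [in_size I]/=; nia.
exists T0; split.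
- exact: (time_bound_ge eps0 ltM (sample_time_q eps0 leM)).
- by move=> w; have [halt _] := wp_run (W (bits w)) (leqnn _).
have [G1 G2] := inv_E_le Delta beta eps0 leM.
set E := 1 + eps^-1 in G1 G2.
have E0 : 0 < E by rewrite /E ltr_pwDl // invr_ge0 ltW.
have Ei : 0 <= E^-1 by rewrite invr_ge0 ltW.
apply: (@le_trans _ _ (E^-1 / 2)); last by lra.
have Wpos sigma : 0 <= expR (- hamiltonian G beta h sigma) by exact: expR_ge0.
have Zpos : 0 < partition_function G beta h.
  rewrite /partition_function (bigD1 [ffun=> false]) //= ltr_pwDl ?expR_gt0 //.
  by apply: sumr_ge0.
apply: tv_dist_close.
- by lra.
- by move=> sigma; rewrite divr_ge0 // ltW.
- by rewrite -mulr_suml divff // gt_eqF.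
move=> sigma; rewrite /ising (partition_functionE _ _ _ eps) (expR_hamiltonian _ _ _ eps).
have := sample_close alpha_ge0 irr sym good eps0 D_large leM (spinsE sigma).
suff -> : output_law I (sample_cmd D) T0 sigma =
  \prod_(0 <= x < n) coin_prob R L (fun t =>
    (coin_value R t 0 L * (1 + pinned_ratio n (in_adj I) beta (in_field I) M (spins sigma) x)
       < pinned_ratio n (in_adj I) beta (in_field I) M (spins sigma) x) == spins sigma x) by [].
rewrite -(coin_prob_blocks n L (T0 - n * L) (fun x u =>
  (u * (1 + pinned_ratio n (in_adj I) beta (in_field I) M (spins sigma) x) <
       pinned_ratio n (in_adj I) beta (in_field I) M (spins sigma) x) == spins sigma x)).
rewrite subnKC // -card_coin_prob /output_law; congr (_%:R / _).
apply: eq_card => w; rewrite !inE.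
have [_ /= spec] := wp_run (W (bits w)) (leqnn _).
pose s (y : nat) := nmem (run I (bits w) (sample_cmd D) T0).2 0 y != 0%N.
rewrite -/I -/s in spec.
apply/eqP/allP => [out x|test].
  rewrite mem_iota add0n => /andP[_ xn]; apply/eqP.
  have sE y : (y < n)%N -> s y = spins sigma y.
    move=> yn; rewrite -[y]/(val (Ordinal yn)) -spinsE -out ffunE; by [].
  rewrite -(sE x xn) -(@eq_pinned_ratio _ _ _ _ s) => [|y yx]; last by rewrite sE // (ltn_trans yx).
  by rewrite [RHS]spec.
(* Strong induction: once the spins below [x] agree, so do the thresholds at [x]. *)
have sE x : (x < n)%N -> s x = spins sigma x.
  elim/ltn_ind: x => x IHx xn; rewrite -[LHS]/(nmem _ 0 x != 0%N) spec //.
  have xin : x \in iota 0 n by rewrite mem_iota.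
  by rewrite -(eqP (test x xin)) (@eq_pinned_ratio _ _ _ _ s (spins sigma)) // => y yx; rewrite IHx // (ltn_trans yx).
apply/ffunP => x; rewrite ffunE spinsE -sE //.
Qed.

End Algorithms.

(** * Expected path sums *)

Section PathSum.
Variables (R : realType) (n : nat) (a : rel nat).
Implicit Types (kappa : nat -> R).

Lemma eq_path_sum kappa kappa' m p x : (forall z, (z < n)%N -> kappa z = kappa' z) ->
  path_sum n a kappa m p x = path_sum n a kappa' m p x.
Proof.
move=> kk'; elim: m p x => [|m IHm] p x //=.
rewrite big_seq_cond [RHS]big_seq_cond; apply: eq_bigr => y.
by rewrite mem_index_iota => /andP[/andP[_ yn] _]; rewrite kk' // IHm.
Qed.

(** Pigeonhole. This leaves only finitely many lengths, [m < n], to be controlled. *)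
Lemma path_sum_long kappa m p x : uniq (x :: p) -> all (fun z => z < n)%N (x :: p) ->
  (n <= m + size p)%N -> path_sum n a kappa m p x = 0.
Proof.
elim: m p x => [|m IHm] p x up ap le_n /=.
  have : (size (x :: p) <= size (iota 0 n))%N.
    by apply: uniq_leq_size up _ => z /(allP ap) zn; rewrite mem_iota.
  by rewrite size_iota /= ltnNge => /negP[].
rewrite big_seq_cond big1 // => y; rewrite mem_index_iota => /andP[/andP[_ yn] /andP[_ yp]].
rewrite IHm ?mulr0 //; first by rewrite cons_uniq yp.
  by rewrite /= yn.
by rewrite /= addnS -addSn.
Qed.

Variables (Delta : nat) (p0 lo hi : R).
Hypothesis degree : forall y, (count (a y) (iota 0 n) <= Delta)%N.
Hypothesis p0_ge0 : 0 <= p0.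
Hypothesis p0_le1 : p0 <= 1.
Hypothesis lo_ge0 : 0 <= lo.
Hypothesis hi_ge0 : 0 <= hi.

(** Only whether a field is low matters, so the expectation over the fields becomes a finite sum
    over bit patterns. A low field ([true]) receives the factor [hi], any other the factor [lo]. *)
Definition bernoulli_weight (t : bool) : R := if t then p0 else 1 - p0.

Definition product_weight (b : config n) : R := \prod_(x < n) bernoulli_weight (b x).

Definition two_valued (b : config n) (y : nat) : R :=
  if insub y is Some i then (if b i then hi else lo) else 0.

Definition mean_factor : R := p0 * hi + (1 - p0) * lo.

Lemma bernoulli_weight_ge0 t : 0 <= bernoulli_weight t.
Proof. by case: t => //; rewrite subr_ge0. Qed.

Lemma product_weight_ge0 b : 0 <= product_weight b.
Proof. by apply: prodr_ge0 => x _; exact: bernoulli_weight_ge0. Qed.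

Lemma two_valued_ge0 b y : 0 <= two_valued b y.
Proof. by rewrite /two_valued; case: insub => // i; case: ifP. Qed.

Lemma mean_factor_ge0 : 0 <= mean_factor.
Proof. by rewrite addr_ge0 // mulr_ge0 // subr_ge0. Qed.

Lemma expected_product (A : seq nat) : uniq A -> all (fun z => z < n)%N A ->
  \sum_b product_weight b * \prod_(y <- A) two_valued b y = mean_factor ^+ size A.
Proof.
move=> uA aA.
have permA : perm_eq A [seq y <- iota 0 n | y \in A].
  apply: uniq_perm => //; first by rewrite filter_uniq // iota_uniq.
  move=> y; rewrite mem_filter mem_iota add0n /=.
  by case: (boolP (y \in A)) => // /(allP aA) ->.
have E (F : nat -> R) : \prod_(y <- A) F y = \prod_(x < n) (if (x : nat) \in A then F x else 1).
  rewrite (perm_big _ permA) big_filter -big_mkcond -(big_mkord (fun x => x \in A)).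
  by rewrite /index_iota subn0.
pose F (x : 'I_n) (t : bool) : R := bernoulli_weight t *
   (if (x : nat) \in A then (if t then hi else lo) else 1).
transitivity (\sum_(b : config n) \prod_(x < n) F x (b x)).
  apply: eq_bigr => b _; rewrite E -big_split; apply: eq_bigr => x _.
  by rewrite /F /two_valued valK.
rewrite -(bigA_distr_bigA F).
transitivity (\prod_(x < n) (if (x : nat) \in A then mean_factor else 1)).
  apply: eq_bigr => x _; rewrite big_bool /F /=; case: ifP => _ //.
  by rewrite !mulr1 addrC subrK.
by rewrite -(E (fun=> mean_factor)) big_const_seq count_predT -Monoid.iteropE.
Qed.

(** [A] collects vertices already traversed, with their factors kept inside the expectation. The
    next vertex is new, so independence yields another [mean_factor], for at most [Delta]
    choices. *)
Lemma expected_path_sum m (A p : seq nat) x : uniq A -> all (fun z => z < n)%N A ->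
  {subset A <= x :: p} ->
  \sum_b product_weight b * (\prod_(y <- A) two_valued b y * path_sum n a (two_valued b) m p x) <=
  mean_factor ^+ size A * (Delta%:R * mean_factor) ^+ m.
Proof.
have q0 := mean_factor_ge0.
elim: m A p x => [|m IHm] A p x uA aA sA.
  rewrite expr0 mulr1 -expected_product // le_eqVlt; apply/orP; left; apply/eqP.
  by apply: eq_bigr => b _; rewrite mulr1.
rewrite /=; under eq_bigr do rewrite mulr_sumr mulr_sumr.
rewrite exchange_big /=.
apply: (@le_trans _ _ (\sum_(0 <= y < n | a x y && (y \notin x :: p))
   mean_factor ^+ (size A).+1 * (Delta%:R * mean_factor) ^+ m)).
  rewrite big_seq_cond [leRHS]big_seq_cond; apply: ler_sum => y.
  rewrite mem_index_iota => /andP[/andP[_ yn] /andP[_ yp]].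
  have yA : y \notin A by apply: contra yp => /sA.
  have := IHm (y :: A) (x :: p) y; rewrite cons_uniq yA uA /= yn aA => /(_ isT isT).
  move=> IH; apply: le_trans (IH _); last first.
    move=> z; rewrite inE => /orP[/eqP->|/sA zp]; first by rewrite mem_head.
    by rewrite inE zp orbT.
  rewrite le_eqVlt; apply/orP; left; apply/eqP; apply: eq_bigr => b _.
  by rewrite big_cons; ring.
rewrite big_const_seq iter_addr addr0 -[_ *+ _]mulr_natr exprS [(_ * _) ^+ m.+1]exprS.
set X := _ ^+ m; set Y := _ ^+ size A.
have -> : Y * (Delta%:R * mean_factor * X) = mean_factor * Y * X * Delta%:R by ring.
rewrite ler_wpM2l // ?mulr_ge0 ?exprn_ge0 ?mulr_ge0 // ler_nat.
apply: leq_trans (degree x); rewrite /index_iota subn0.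
by apply: sub_count => y /andP[].
Qed.

Definition short_sums (b : config n) : bool :=
  [forall m : 'I_n, forall x : 'I_n, (n ^ 2 <= 2 ^ m)%N ==>
    (path_sum n a (two_valued b) m [::] x <= 2 ^- m)].

Lemma short_sumsP b m x : short_sums b -> (x < n)%N -> (n ^ 2 <= 2 ^ m)%N ->
  path_sum n a (two_valued b) m [::] x <= 2 ^- m.
Proof.
move=> /forallP short xn nm; have [mn|nm'] := ltnP m n.
  by have /forallP/(_ (Ordinal xn))/implyP := short (Ordinal mn); exact.
by rewrite path_sum_long ?invr_ge0 ?exprn_ge0 //= ?xn ?addn0.
Qed.

(* Markov's inequality for the sum of all the terms [2 ^ m * path_sum m x]. *)
Lemma long_sums_weight : (0 < n)%N -> Delta%:R * mean_factor <= 8^-1 ->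
  \sum_(b | ~~ short_sums b) product_weight b <= n%:R^-1.
Proof.
move=> n0 Dq; have q0 := mean_factor_ge0.
pose S b : R := \sum_(m < n) \sum_(x < n | (n ^ 2 <= 2 ^ m)%N)
  2 ^+ m * path_sum n a (two_valued b) m [::] x.
have term0 b (m x : 'I_n) : 0 <= 2 ^+ m * path_sum n a (two_valued b) m [::] x.
  by rewrite mulr_ge0 ?exprn_ge0 // path_sum_ge0 // => z; exact: two_valued_ge0.
have S0 b : 0 <= S b by do 2 (apply: sumr_ge0 => ? _).
have S1 b : ~~ short_sums b -> 1 <= S b.
  rewrite negb_forall => /existsP[m]; rewrite negb_forall => /existsP[x].
  rewrite negb_imply -ltNge => /andP[nm lt].
  rewrite /S (bigD1 m) //= (bigD1 x) //= -addrA ler_wpDr //.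
    by rewrite addr_ge0 //; do ?[apply: sumr_ge0 => ? _].
  by rewrite -ler_pdivrMl ?exprn_gt0 // mulr1 ltW.
apply: (@le_trans _ _ (\sum_b product_weight b * S b)).
  rewrite [leRHS](bigID short_sums) /= ler_wpDl //.
    by apply: sumr_ge0 => b _; rewrite mulr_ge0 // product_weight_ge0.
  by apply: ler_sum => b /S1 Sb; rewrite ler_peMr // product_weight_ge0.
under eq_bigr do rewrite mulr_sumr.
rewrite exchange_big /=.
under eq_bigr => m _ do (under eq_bigr do rewrite mulr_sumr; rewrite exchange_big /=).
(* Each expectation is at most [2 ^ m / 8 ^ m = 1 / 4 ^ m], which [2 ^ m >= n ^ 2] bounds by
   [1 / n ^ 4]; there are [n ^ 2] pairs. *)
apply: (@le_trans _ _ (\sum_(m < n) \sum_(x < n) (n%:R ^+ 4)^-1)).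
  apply: ler_sum => m _; rewrite big_mkcond; apply: ler_sum => x _.
  case: ifP => [nm|_]; last by rewrite invr_ge0 exprn_ge0.
  have := @expected_path_sum m [::] [::] x isT isT (fun z H => False_rect _ (notF H)).
  rewrite expr0 mul1r => H.
  apply: (@le_trans _ _ (2 ^+ m * (8^-1) ^+ m)).
    have -> : \sum_b product_weight b * (2 ^+ m * path_sum n a (two_valued b) m [::] x) =
      2 ^+ m * \sum_b product_weight b * (\prod_(y <- [::]) two_valued b y * path_sum n a (two_valued b) m [::] x).
      by rewrite mulr_sumr; apply: eq_bigr => b _; rewrite big_nil mul1r mulrCA.
    rewrite ler_wpM2l ?exprn_ge0 //; apply: le_trans H _.
    by rewrite lerXn2r ?nnegrE // mulr_ge0.
  rewrite -exprMn; have -> : 2 * 8^-1 = (2 ^+ 2)^-1 :> R by field.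
  rewrite exprVn -exprM mulnC exprM lef_pV2 ?posrE ?exprn_gt0 ?ltr0n //.
  have -> : n%:R ^+ 4 = (n%:R ^+ 2) ^+ 2 :> R by rewrite -exprM.
  by rewrite lerXn2r ?nnegrE ?exprn_ge0 // -!natrX ler_nat.
rewrite !sumr_const card_ord -mulrnA -[leLHS]mulr_natr natrM.
have nR : n%:R != 0 :> R by rewrite pnatr_eq0 -lt0n.
have -> : (n%:R ^+ 4)^-1 * (n%:R * n%:R) = n%:R^-1 * n%:R^-1 :> R by field.
by rewrite ler_piMr ?invr_ge0 // invf_le1 ?ler1n // ltr0n.
Qed.

End PathSum.

(** * Gaussian fields *)

Section GaussianTails.
Variables (R : realType) (s : R).
Hypothesis s_gt0 : 0 < s.
Local Notation mu := (@lebesgue_measure R).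

Lemma normal_peak_le : normal_peak s <= s^-1.
Proof.
rewrite /normal_peak lef_pV2 ?posrE //; last first.
  by rewrite sqrtr_gt0 mulrn_wgt0 // mulr_gt0 ?pi_gt0 // exprn_gt0.
rewrite -[leLHS](gtr0_norm s_gt0) -sqrtr_sqr.
rewrite ler_sqrt; last by rewrite mulrn_wge0 // mulr_ge0 ?pi_ge0 // sqr_ge0.
rewrite -mulrnAr ler_peMr ?sqr_ge0 //.
by have := pi_ge2 R; lra.
Qed.

Lemma set_absr_lt (K : R) : [set r : R | `|r| < K] = `]- K, K[%classic.
Proof. by apply/seteqP; split=> r /=; rewrite in_itv /= ltr_norml. Qed.

Lemma normal_prob_small (K : R) : 0 <= K ->
  (normal_prob 0 s [set r | (`|r| < K)%R] <= (2 * K / s)%:E)%E.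
Proof.
move=> K0; rewrite set_absr_lt /normal_prob; set A : set R := `]- K, K[%classic.
have mA : measurable A by exact: measurable_itv.
apply: (@le_trans _ _ (\int[mu]_(x in A) (s^-1)%R%:E)%E).
  apply: ge0_le_integral => //=.
  - by move=> x _; rewrite lee_fin normal_pdf_ge0.
  - apply/measurable_EFinP; apply: measurable_funTS; exact: measurable_normal_pdf.
  - by move=> x _; rewrite lee_fin (le_trans (normal_pdf_ub _ _ _)) ?normal_peak_le ?gt_eqF.
rewrite integral_cst //= lebesgue_measure_itv /= lte_fin.
case: ifP => _; last by rewrite mule0 lee_fin divr_ge0 ?mulr_ge0 // ltW.
rewrite -EFinB -EFinM lee_fin le_eqVlt; apply/orP; left; apply/eqP; field.
by rewrite gt_eqF.
Qed.

(** Chernoff's bound with parameter 1: multiplying the density by [exp x] or [exp (- x)] moves its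
    mean to [s ^ 2] or [- s ^ 2] and produces the factor [exp (s ^ 2 / 2)]. The two tails account
    for the 2. *)
Lemma normal_prob_tail (T : R) :
  (normal_prob 0 s [set r | (T < `|r|)%R] <= (2 * expR (s ^+ 2 / 2 - T))%:E)%E.
Proof.
set V := [set r | _]; rewrite /normal_prob.
have mV : measurable V.
  have -> : V = (fun r : R => `|r|) @^-1` `]T, +oo[%classic.
    by apply/seteqP; split=> r /=; rewrite in_itv /= andbT.
  rewrite -[_ @^-1` _]setTI; exact: normr_measurable.
pose g (x : R) := normal_pdf (s ^+ 2) s x + normal_pdf (- s ^+ 2) s x.
have g0 x : 0 <= g x by rewrite addr_ge0 // normal_pdf_ge0.
have mg : measurable_fun setT g.
  by apply: measurable_funD; exact: measurable_normal_pdf.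
have s0 : s != 0 by rewrite gt_eqF.
apply: (@le_trans _ _ (\int[mu]_(x in V) (expR (s ^+ 2 / 2 - T) * g x)%R%:E)%E).
  apply: ge0_le_integral => //=.
  - by move=> x _; rewrite lee_fin normal_pdf_ge0.
  - apply/measurable_EFinP; apply: measurable_funTS; exact: measurable_normal_pdf.
  - apply/measurable_EFinP; apply: measurable_funTS; exact: measurable_funM.
  - move=> x; rewrite /V /= ltr_normr => Tx; rewrite lee_fin /g !normal_pdfE // -mulrDr mulrCA.
    rewrite ler_wpM2l ?normal_peak_ge0 // /normal_fun mulrDr -!expRD.
    case/orP: Tx => Tx.
      apply: ler_wpDr; first exact: expR_ge0.
      have -> : - (x - s ^+ 2) ^+ 2 / (s ^+ 2 *+ 2) = - (x - 0) ^+ 2 / (s ^+ 2 *+ 2) + x - s ^+ 2 / 2.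
        by field.
      by rewrite ler_expR; lra.
    apply: ler_wpDl; first exact: expR_ge0.
    have -> : - (x - - s ^+ 2) ^+ 2 / (s ^+ 2 *+ 2) = - (x - 0) ^+ 2 / (s ^+ 2 *+ 2) - x - s ^+ 2 / 2.
      by field.
    by rewrite ler_expR; lra.
apply: (@le_trans _ _ (\int[mu]_x (expR (s ^+ 2 / 2 - T) * g x)%R%:E)%E).
  apply: ge0_subset_integral => //=.
    by apply/measurable_EFinP; exact: measurable_funM.
  by move=> x _; rewrite lee_fin mulr_ge0 // expR_ge0.
under eq_integral do rewrite EFinM.
rewrite ge0_integralZl_EFin ?expR_ge0 //; last 2 first.
- by move=> x _; rewrite lee_fin.
- exact/measurable_EFinP.
under eq_integral do rewrite EFinD.
rewrite ge0_integralD //=; first last.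
- by apply/measurable_EFinP; exact: measurable_normal_pdf.
- by move=> x _; rewrite lee_fin normal_pdf_ge0.
- by apply/measurable_EFinP; exact: measurable_normal_pdf.
- by move=> x _; rewrite lee_fin normal_pdf_ge0.
rewrite !integral_normal_pdf -EFinD -EFinM lee_fin; lra.
Qed.

End GaussianTails.

Section UnionBound.
Variables (R : realType) (d : measure_display) (Omega : measurableType d).
Variables (P : probability Omega R) (J : finType) (F : J -> set Omega) (r : J -> R).
Variable Q : pred J.
Hypothesis mF : forall j, Q j -> measurable (F j).
Hypothesis leF : forall j, Q j -> (P (F j) <= (r j)%:E)%E.

Lemma measurable_bigsetU_fin : measurable (\big[setU/set0]_(j | Q j) F j).
Proof. by apply: big_ind => //; exact: measurableU. Qed.

Lemma union_bound : (P (\big[setU/set0]_(j | Q j) F j) <= (\sum_(j | Q j) r j)%:E)%E.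
Proof.
suff [] : measurable (\big[setU/set0]_(j | Q j) F j) /\
  (P (\big[setU/set0]_(j | Q j) F j) <= (\sum_(j | Q j) r j)%:E)%E by [].
elim/big_rec2: _ => [|j x A Qj [mA PA]]; first by rewrite measure0.
split; first by apply: measurableU => //; exact: mF.
apply: (le_trans (measureU2 P (mF Qj) mA)).
by rewrite EFinD leeD ?leF.
Qed.

Lemma mem_bigsetU_fin j w : Q j -> F j w -> (\big[setU/set0]_(j | Q j) F j) w.
Proof. by move=> Qj Fjw; rewrite (bigD1 j) //=; left. Qed.

End UnionBound.

(** * Choice of the variance and the exceptional event *)

Section RandomFields.
Variables (R : realType) (Delta : nat) (beta : R).
Hypothesis Delta_gt0 : (0 < Delta)%N.

Local Notation k := (edge_log beta).

(* Chosen so that a vertex with a large field contracts by [1 / (16 Delta)]. *)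
Definition contraction_log : R := k + 16 * Delta%:R.
Local Notation alpha := contraction_log.
Local Notation K := (far_threshold Delta beta alpha).

(** Rare enough to offset the expansion by [exp k] at a low field. *)
Definition small_prob : R := expR (- k) / (16 * Delta%:R).
(** A standard deviation: the density is at most [1 / s], so an interval of length [2 K] gets mass
    at most [small_prob]. The 1 keeps it positive. *)
Definition field_scale : R := 2 * K / small_prob + 1.
Local Notation s := field_scale.

Lemma contraction_log_ge0 : 0 <= alpha.
Proof. by rewrite addr_ge0 ?edge_log_ge0 // mulr_ge0. Qed.

Lemma far_threshold_ge0 : 0 <= K.
Proof.
have a0 := contraction_log_ge0; have k0 := edge_log_ge0 beta.
by rewrite /far_threshold /weight_log !addr_ge0 ?divr_ge0 ?mulr_ge0 ?addr_ge0 ?mulr_ge0 ?addr_ge0.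
Qed.

Lemma small_prob_gt0 : 0 < small_prob.
Proof. by rewrite divr_gt0 ?expR_gt0 // mulr_gt0 // ltr0n. Qed.

Lemma field_scale_gt0 : 0 < s.
Proof.
by rewrite ltr_wpDl // divr_ge0 ?(ltW small_prob_gt0) // mulr_ge0 // far_threshold_ge0.
Qed.

Definition low_set (t : bool) : set R :=
  if t then [set r | `|r| < K] else ~` [set r | `|r| < K].

Lemma measurable_low_set t : measurable (low_set t).
Proof.
have m1 : measurable [set r : R | `|r| < K] by rewrite set_absr_lt; exact: measurable_itv.
by case: t => //; exact: measurableC.
Qed.

Definition low_prob : R := fine (normal_prob 0 s (low_set true)).

Lemma low_probE t : normal_prob 0 s (low_set t) = (bernoulli_weight low_prob t)%:E.
Proof.
have E : normal_prob 0 s (low_set true) = low_prob%:E.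
  by rewrite /low_prob fineK // fin_num_measure //; exact: measurable_low_set.
case: t => //; rewrite /low_set -[LHS]/(normal_prob 0 s (~` (low_set true))).
transitivity (1 - normal_prob 0 s (low_set true))%E; last by rewrite E.
exact: (probability_setC (normal_prob 0 s : probability _ R) (measurable_low_set true)).
Qed.

Lemma low_prob_ge0 : 0 <= low_prob.
Proof. by rewrite fine_ge0 // measure_ge0. Qed.

Lemma low_prob_le1 : low_prob <= 1.
Proof. by rewrite -lee_fin -(low_probE true) probability_le1 //; exact: measurable_low_set. Qed.

Lemma low_prob_small : low_prob <= small_prob.
Proof.
rewrite -lee_fin -(low_probE true).
apply: le_trans (normal_prob_small field_scale_gt0 far_threshold_ge0) _.
rewrite lee_fin ler_pdivrMr ?field_scale_gt0 // /field_scale [leRHS]mulrC.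
rewrite [leRHS]mulrDl mul1r divfK ?gt_eqF ?small_prob_gt0 //.
by rewrite lerDl ltW // small_prob_gt0.
Qed.

(** Low and high fields each contribute at most [1 / (16 Delta)]. *)
Lemma mean_factor_small :
  Delta%:R * mean_factor low_prob (expR (k - alpha)) (expR k) <= 8^-1.
Proof.
have D0 : 0 < Delta%:R :> R by rewrite ltr0n.
have p0 := low_prob_ge0; have p1 := low_prob_le1; have ps := low_prob_small.
have e1 : expR (k - alpha) <= (16 * Delta%:R)^-1.
  have -> : k - alpha = - (16 * Delta%:R) by rewrite /contraction_log; ring.
  rewrite expRN lef_pV2 ?posrE ?expR_gt0 ?mulr_gt0 //.
  by apply: le_trans (expR_ge1Dx _); rewrite lerDr.
have e2 : low_prob * expR k <= (16 * Delta%:R)^-1.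
  rewrite -ler_pdivlMr ?expR_gt0 //; apply: le_trans ps _.
  by rewrite /small_prob expRN mulrC.
have e3 : (1 - low_prob) * expR (k - alpha) <= (16 * Delta%:R)^-1.
  apply: le_trans e1; rewrite ler_piMl ?expR_ge0 //; lra.
have -> : 8^-1 = Delta%:R * ((16 * Delta%:R)^-1 + (16 * Delta%:R)^-1) :> R.
  by field; rewrite gt_eqF.
by rewrite ler_wpM2l ?(ltW D0) // lerD.
Qed.

(** The 2 comes from [1 / n <= 2 / (n + 1)], the 16 from the tail term and
    [n exp (- n) <= 4 / n]. *)
Definition failure_rate (n : nat) : R := (2 + 16 * expR (s ^+ 2 / 2)) / n.+1%:R.

Lemma failure_rate_cvg : failure_rate @ \oo --> (0 : R).
Proof.
rewrite -[0](mulr0 (2 + 16 * expR (s ^+ 2 / 2))); apply: cvgM; first exact: cvg_cst.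
exact: cvg_harmonic.
Qed.

Lemma failure_rate_ge (n : nat) : (0 < n)%N ->
  n%:R^-1 + n%:R * (2 * expR (s ^+ 2 / 2 - n%:R)) <= failure_rate n.
Proof.
move=> n0; have nR : 0 < n%:R :> R by rewrite ltr0n.
set C := expR (s ^+ 2 / 2); have C0 : 0 <= C by exact: expR_ge0.
have inv_le : n%:R^-1 <= 2 / n.+1%:R :> R.
  rewrite ler_pdivlMr ?ltr0n // mulrC ler_pdivrMr // -natr1.
  have : 1 <= n%:R :> R by rewrite ler1n.
  lra.
have en : n%:R * expR (- n%:R) <= 4 * n%:R^-1 :> R.
  have : (n%:R / 2) ^+ 2 <= expR n%:R :> R.
    have -> : n%:R = 2%:R * (n%:R / 2) :> R by field.
    rewrite expRM_natl [2%:R * _ / 2]mulrAC divff // mul1r lerXn2r ?nnegrE ?expR_ge0 ?divr_ge0 //.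
    by apply: le_trans (expR_ge1Dx _); rewrite lerDr.
  move=> h; rewrite expRN ler_pdivrMr ?expR_gt0 //.
  have E : n%:R = 4 * n%:R^-1 * (n%:R / 2) ^+ 2 :> R by field; rewrite gt_eqF.
  rewrite [leLHS]E.
  by rewrite ler_wpM2l // mulr_ge0 // invr_ge0 ltW.
rewrite /failure_rate [leRHS]mulrDl lerD //.
have -> : n%:R * (2 * expR (s ^+ 2 / 2 - n%:R)) = 2 * C * (n%:R * expR (- n%:R)).
  by rewrite expRD -/C; ring.
apply: (@le_trans _ _ (2 * C * (4 * (2 / n.+1%:R)))); last first.
  by rewrite le_eqVlt; apply/orP; left; apply/eqP; rewrite -/C; move: (n.+1%:R^-1) => V; ring.
rewrite ler_wpM2l ?mulr_ge0 //; apply: le_trans en _; by rewrite ler_wpM2l.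
Qed.

Lemma tractable_event (n : nat) (G : sgraph n) (d : measure_display)
    (Omega : measurableType d) (P : probability Omega R) (h : 'I_n -> {RV P >-> R}) :
  (max_degree G <= Delta)%N -> mutually_independent h ->
  (forall x : 'I_n, gaussian (s ^+ 2) (h x)) ->
  exists E : set Omega, [/\ measurable E, (P E >= (1 - failure_rate n)%:E)%E
    & forall w : Omega, E w -> tractable Delta beta alpha G (fun x => h x w)].
Proof.
move=> degG indep gauss; have [n0|n_gt0] := posnP n.
  (* For [n = 0] the failure rate exceeds 1, so the empty event qualifies. *)
  exists set0; split=> //; rewrite measure0 lee_fin /failure_rate n0 divr1.
  by have := expR_ge0 (s ^+ 2 / 2); lra.
have law x A : measurable A -> P (h x @^-1` A) = normal_prob 0 s A.
  by move=> mA; have := gauss x A mA; rewrite sqrtr_sqr gtr0_norm // field_scale_gt0.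
have mh x (A : set R) : measurable A -> measurable (h x @^-1` A).
  by move=> mA; rewrite -[_ @^-1` _]setTI; exact: measurable_funPT.
pose a := in_adj (instance_input G beta (fun=> 0 : R) 1).
have degree y : (count (a y) (iota 0 n) <= Delta)%N by exact: in_adj_degree.
pose lo : R := expR (k - alpha); pose hi : R := expR k.
(* [F b] prescribes which fields are low; by independence its probability is [product_weight], the
   link to the finite computation. *)
pose F (b : config n) : set Omega := \bigcap_(x in [set` [set: 'I_n]%SET]) (h x @^-1` low_set (b x)).
have mF b : measurable (F b).
  apply: fin_bigcap_measurable => [|x _]; first exact: finite_finset.
  by apply: mh; exact: measurable_low_set.
have PF b : P (F b) = (product_weight low_prob b)%:E.
  rewrite /F (indep [set: 'I_n]%SET (fun x => low_set (b x))) => [|x]; last exact: measurable_low_set.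
  rewrite /product_weight -prodEFin; apply: eq_big => [x|x _]; first by rewrite inE.
  by rewrite law ?low_probE //; exact: measurable_low_set.
pose short (b : config n) := short_sums a lo hi b.
pose U1 := \big[setU/set0]_(b : config n | ~~ short b) F b.
pose T (x : 'I_n) := h x @^-1` [set r | n%:R < `|r|].
have mtail : measurable [set r : R | n%:R < `|r|].
  have -> : [set r : R | n%:R < `|r|] = (fun r : R => `|r|) @^-1` `]n%:R, +oo[%classic.
    by apply/seteqP; split=> r /=; rewrite in_itv /= andbT.
  rewrite -[_ @^-1` _]setTI; exact: normr_measurable.
pose U2 := \big[setU/set0]_(x : 'I_n | true) T x.
have mU1 : measurable U1 by apply: measurable_bigsetU_fin => b _; exact: mF.
have mU2 : measurable U2 by apply: measurable_bigsetU_fin => x _; exact: mh.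
have PU1 : (P U1 <= (n%:R^-1)%:E)%E.
  apply: (@le_trans _ _ (\sum_(b | ~~ short b) product_weight low_prob b)%:E).
    by apply: union_bound => b _; [exact: mF|rewrite PF].
  rewrite lee_fin; apply: long_sums_weight => //.
  - exact: low_prob_ge0.
  - exact: low_prob_le1.
  - exact: expR_ge0.
  - exact: expR_ge0.
  - exact: mean_factor_small.
have PU2 : (P U2 <= (n%:R * (2 * expR (s ^+ 2 / 2 - n%:R)))%:E)%E.
  have -> : n%:R * (2 * expR (s ^+ 2 / 2 - n%:R)) = \sum_(x < n | true) (2 * expR (s ^+ 2 / 2 - n%:R)).
    by rewrite sumr_const card_ord mulr_natl.
  apply: union_bound => x _; first exact: mh.
  by rewrite law //; exact: (normal_prob_tail field_scale_gt0).
exists (~` (U1 `|` U2)); split.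
- by apply: measurableC; exact: measurableU.
- rewrite probability_setC; last exact: measurableU.
  rewrite EFinB leeB //; apply: le_trans (measureU2 P mU1 mU2) _.
  apply: (@le_trans _ _ ((n%:R^-1)%:E + (n%:R * (2 * expR (s ^+ 2 / 2 - n%:R)))%:E)%E).
    exact: leeD.
  by rewrite -EFinD lee_fin; exact: failure_rate_ge.
move=> w nU; have nU1 : ~ U1 w by move=> U1w; apply: nU; left.
have nU2 : ~ U2 w by move=> U2w; apply: nU; right.
pose b : config n := [ffun x => `|h x w| < K].
have Fb : F b w.
  move=> x _ /=; rewrite ffunE /low_set; case: ifP => //= hx.
  by rewrite hx.
have sb : short b.
  by apply/negPn/negP => nb; apply: nU1; exact: (@mem_bigsetU_fin _ _ _ F (fun b => ~~ short b) b w nb Fb).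
split=> //; split.
- exact: degree.
- move=> x /=; case: insubP => [i _ _|_]; last by rewrite normr0.
  by rewrite leNgt; apply/negP => hi'; apply: nU2; apply: (@mem_bigsetU_fin _ _ _ T xpredT i).
move=> m x xn nm; rewrite -(@eq_path_sum _ _ _ (two_valued lo hi b)); last first.
  move=> z zn; rewrite /two_valued /= /field_factor.
  by case: insubP => [i _ _|]; [rewrite ffunE ltNge; case: (_ <= _)|rewrite zn].
exact: (short_sumsP sb).
Qed.

End RandomFields.

Theorem theorem1p2 (R : realType) (Delta : nat) (beta : R) :
  (2 <= Delta)%N ->
  exists2 H : R, 0 < H &
  exists (S : instance_class R) (delta : nat -> R),
    [/\ exists A : cmd, is_fptas beta S A,
        exists B : cmd, is_sampling_scheme beta S B,
        delta @ \oo --> (0 : R)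
      & forall (n : nat) (G : sgraph n), (max_degree G <= Delta)%N ->
        forall (d : measure_display) (Omega : measurableType d)
          (P : probability Omega R) (h : 'I_n -> {RV P >-> R}),
        mutually_independent h -> (forall x : 'I_n, gaussian H (h x)) ->
        exists E : set Omega,
          [/\ measurable E, (P E >= (1 - delta n)%:E)%E
            & forall w : Omega, E w -> S n G (fun x => h x w)]].
Proof.
move=> Delta_ge2; have Delta_gt0 : (0 < Delta)%N by exact: leq_trans Delta_ge2.
pose alpha := contraction_log Delta beta; pose s := field_scale Delta beta.
have s_gt0 : 0 < s by exact: field_scale_gt0.
have alpha_ge0 : 0 <= alpha by exact: contraction_log_ge0.
(* A natural number fixed by [Delta] and [beta], hence usable as a numeral in programs chosen before
   the instance. *)
pose D := Num.bound `|precision_bound Delta beta|.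
have D_large : precision_bound Delta beta <= D%:R.
  by apply: le_trans (ler_norm _) (ltW (archi_boundP (normr_ge0 _))).
exists (s ^+ 2); first by rewrite exprn_gt0.
exists (tractable Delta beta alpha), (failure_rate Delta beta); split.
- by exists (count_cmd D); exact: tractable_fptas.
- by exists (sample_cmd D); exact: tractable_sampling.
- exact: failure_rate_cvg.
- move=> n G degG d Omega P h indep gauss.
  exact: (tractable_event Delta_gt0 degG indep gauss).
Qed.
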